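(* Let $0<\xi<1$ be a rational number. The commutative associative superalgebra $A_2(L_{\widehat{\mathfrak g}}(-\tfrac12,0))$ for $(L_{\widehat{\mathfrak g}}(-\tfrac12,0),\omega_\xi)$ is isomorphic to the quotient algebra $\mathbb C[t_1,t_2]/\langle q_1(t_1,t_2),q_2(t_1,t_2)\rangle$, where $$q_1(t_1,t_2)=t_1(t_1-2t_2),\qquad q_2(t_1,t_2)=t_2(t_2-2t_1).$$ Moreover, $(L_{\widehat{\mathfrak g}}(-\tfrac12,0),\omega_\xi)$ is $C_2$-cofinite.
   Context: $\mathfrak g=sl(2|1)$ is the complex Lie superalgebra of $3\times 3$ matrices with $\mathrm{str}(x)=x_{11}+x_{22}-x_{33}=0$, with basis (matrix units $E_{ij}$) $h_1=E_{11}+E_{33}$, $h_2=-E_{22}-E_{33}$, $e_{12}=E_{12}$, $f_{12}=E_{21}$ (even) and $e_1=E_{13}$, $e_2=E_{32}$, $f_1=E_{31}$, $f_2=-E_{23}$ (odd); $h_+=h_1+h_2$; $(x,y)=\mathrm{str}(xy)$. $\tilde{\mathfrak g}=\mathfrak g\otimes\mathbb C[t,t^{-1}]\oplus\mathbb C k$, $k$ central, $a(n)=a\otimes t^n$, $[a(m),b(n)]=[a,b](m+n)+m\delta_{m+n,0}(a,b)k$; $P=\mathfrak g\otimes\mathbb C[t]\oplus\mathbb C k$. For $\kappa\ne-1$, $V_{\widehat{\mathfrak g}}(\kappa,0)=U(\tilde{\mathfrak g})\otimes_{U(P)}\mathbb C$ ($\mathfrak g\otimes\mathbb C[t]$ acts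 by $0$ and $k$ by $\kappa$ on $\mathbb C$) is the universal affine vertex operator superalgebra, with vacuum $\mathbf 1=1\otimes 1$, $Y(a(-1)\mathbf 1,z)=\sum_n a(n)z^{-n-1}$ and Sugawara Virasoro element $\omega=\frac1{2(\kappa+1)}\big(h_1(-1)h_2(-1)+h_2(-1)h_1(-1)+e_{12}(-1)f_{12}(-1)+f_{12}(-1)e_{12}(-1)-e_1(-1)f_1(-1)+f_1(-1)e_1(-1)-e_2(-1)f_2(-1)+f_2(-1)e_2(-1)\big)\mathbf 1$, $Y(\omega,z)=\sum_nL(n)z^{-n-2}$. $L_{\widehat{\mathfrak g}}(\kappa,0)$ is its simple quotient. For rational $0<\xi<1$ put $\omega_\xi=\omega+\frac{\xi}{2}L(-1)h_+(-1)\mathbf 1$. Its modes $L'(n)$ ($Y(\omega_\xi,z)=\sum_nL'(n)z^{-n-2}$) are $L'(n)=L(n)-\frac{\xi}{2}(n+1)h_+(n)$, and $(L_{\widehat{\mathfrak g}}(\kappa,0),\omega_\xi)$ is a $\mathbb Q$-graded vertex operator superalgebra: it is the direct sum of finite-dimensional $L'(0)$-eigenspaces $V_{(n)}$ with rational eigenvalues $n$ bounded below. For a $\mathbb Q$-graded vertex operator superalgebra $V=\bigoplus_{n\in\mathbb Q}V_{(n)}$, write $Y(a,z)=\sum_n a_nz^{-n-1}$. $C_2(V)$ is the linear span of all $a_{-2}V$ with $a\in V_{(n)}$, $n\in\mathbb Z$, and all $a_{-1}V$ with $a\in V_{(n)}$, $n\notin\mathbb Z$. Set $A_2(V)=V/C_2(V)$;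 it is a commutative associative superalgebra with identity $\mathbf 1+C_2(V)$ under the product induced by $a\cdot b=a_{-1}b$ if $a,b$ are homogeneous of integer weights and $a\cdot b=0$ for homogeneous $a,b$ otherwise. $V$ is $C_2$-cofinite if $A_2(V)$ is finite-dimensional. *)

(* Defs.v *)
From HB Require Import structures.
From mathcomp Require Import all_boot all_order all_algebra.
From mathcomp Require Import boolp reals.
From mathcomp Require Import complex.
From mathcomp Require Import monalg mpoly.

Set Implicit Arguments.
Unset Strict Implicit.
Unset Printing Implicit Defensive.

Import Order.TTheory GRing.Theory Num.Theory.

Local Open Scope ring_scope.

Section LinearQuotient.
Variables (K : nzRingType) (V : lmodType K).

Definition lspan (S : V -> Prop) : {pred V} := fun v =>
  `[< exists n (c : 'I_n -> K) (s : 'I_n -> V),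
        (forall i, S (s i)) /\ v = \sum_(i < n) c i *: s i >].

Variable S : V -> Prop.

Lemma lspan_gen v : S v -> v \in lspan S.
Proof.
move=> Sv; apply/asboolP; exists 1%N, (fun=> 1), (fun=> v); split=> //.
by rewrite big_ord1 scale1r.
Qed.

Lemma lspan_submod_closed : submod_closed (lspan S).
Proof.
split.
  by apply/asboolP; exists 0%N, (fun=> 0), (fun=> 0); rewrite big_ord0; split=> // -[].
move=> a u v /asboolP[m [c [s [hs ->]]]] /asboolP[n [d [t [ht ->]]]].
apply/asboolP; exists (m + n)%N.
exists (fun i => match fintype.split i with inl j => a * c j | inr j => d j end).
exists (fun i => match fintype.split i with inl j => s j | inr j => t j end).
split=> [i|]; first by case: (fintype.split i).
rewrite big_split_ord /= scaler_sumr; congr (_ + _); apply: eq_bigr => i _.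
  by case: split_ordP => j /eqP; rewrite ?eq_lrshift // ?eq_lshift => /eqP<-;
    rewrite scalerA.
by case: split_ordP => j /eqP; rewrite ?eq_rlshift // ?eq_rshift => /eqP<-.
Qed.

HB.instance Definition _ := GRing.isSubmodClosed.Build K V (lspan S)
  lspan_submod_closed.

Definition lquot : Type := {ideal_quot lspan S}.
HB.instance Definition _ := GRing.Zmodule.on lquot.

Definition lproj (v : V) : lquot := \pi_{ideal_quot lspan S}%qT v.

Lemma lproj_is_zmod_morphism : zmod_morphism lproj.
Proof. exact: (raddfB \pi_{ideal_quot lspan S}%qT). Qed.

HB.instance Definition _ :=
  GRing.isZmodMorphism.Build V lquot lproj lproj_is_zmod_morphism.

Lemma lproj_eq u v : (lproj u == lproj v) = (u - v \in lspan S).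
Proof. by rewrite Quotient.idealrBE. Qed.

Lemma lproj_repr (x : lquot) : lproj (generic_quotient.repr x) = x.
Proof. exact: generic_quotient.reprK. Qed.

Lemma lproj_surj (x : lquot) : exists v, lproj v = x.
Proof. by exists (generic_quotient.repr x); exact: lproj_repr. Qed.

Definition lquot_scale (c : K) (x : lquot) : lquot :=
  lproj (c *: generic_quotient.repr x).

Lemma lquot_scaleE c v : lquot_scale c (lproj v) = lproj (c *: v).
Proof.
apply/eqP; rewrite lproj_eq -scalerBr rpredZ //.
by rewrite -lproj_eq lproj_repr.
Qed.

Lemma lquot_scaleA a b x :
  lquot_scale a (lquot_scale b x) = lquot_scale (a * b) x.
Proof. by have [v <-] := lproj_surj x; rewrite !lquot_scaleE scalerA. Qed.

Lemma lquot_scale1 : left_id 1 lquot_scale.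
Proof. by move=> x; have [v <-] := lproj_surj x; rewrite lquot_scaleE scale1r. Qed.

Lemma lquot_scaleDr : right_distributive lquot_scale +%R.
Proof.
move=> a x y; have [u <-] := lproj_surj x; have [v <-] := lproj_surj y.
by rewrite -raddfD !lquot_scaleE -raddfD scalerDr.
Qed.

Lemma lquot_scaleDl x : {morph lquot_scale^~ x : a b / a + b}.
Proof.
by move=> a b; have [v <-] := lproj_surj x; rewrite !lquot_scaleE scalerDl raddfD.
Qed.

HB.instance Definition _ := GRing.Zmodule_isLmodule.Build K lquot
  lquot_scaleA lquot_scale1 lquot_scaleDr lquot_scaleDl.

Lemma lproj_is_scalable : scalable lproj.
Proof. by move=> c v; rewrite -lquot_scaleE. Qed.

HB.instance Definition _ :=
  GRing.isScalable.Build K V lquot *:%R lproj lproj_is_scalable.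

End LinearQuotient.

Definition finite_dimensional (K : nzRingType) (V : lmodType K) : Prop :=
  exists n (b : 'I_n -> V), forall v, exists c : 'I_n -> K,
    v = \sum_(i < n) c i *: b i.

Lemma malg_scalerAr (M : monomType) (K : comNzRingType) (c : K)
  (x y : {malg K[M]}) : x * (c *: y) = c *: (x * y).
Proof.
rewrite -!mul_malgC !mulrA; congr (_ * _).
rewrite !malgM_def fgmulgU fgmulUg; apply: eq_bigr => k _.
by rewrite mulm1 mul1m mulrC.
Qed.

Section Sl21.
Variable R : realType.
Local Notation C := R[i].

Definition ipar (i : 'I_3) : bool := i == ord_max.

Definition mxpart (p : bool) (x : 'M[C]_3) : 'M[C]_3 :=
  \matrix_(i, j) (if ipar i (+) ipar j == p then x i j else 0).

Definition str (x : 'M[C]_3) : C := \sum_i (-1) ^+ ipar i * x i i.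

Definition sbracket (x y : 'M[C]_3) : 'M[C]_3 :=
  \sum_(p : bool) \sum_(q : bool)
    (mxpart p x *m mxpart q y
       - (-1) ^+ (p && q) *: (mxpart q y *m mxpart p x)).

Definition sl21_pred : {pred 'M[C]_3} := fun x => str x == 0.

Lemma sl21_submod_closed : submod_closed sl21_pred.
Proof.
split; first by rewrite unfold_in /str big1 // => i _; rewrite mxE mulr0.
move=> a x y /eqP hx /eqP hy; apply/eqP.
suff -> : str (a *: x + y) = a * str x + str y by rewrite hx hy mulr0 addr0.
rewrite /str mulr_sumr -big_split /=.
by apply: eq_bigr => i _; rewrite !mxE mulrDr mulrCA.
Qed.

HB.instance Definition _ := GRing.isSubmodClosed.Build C 'M[C]_3 sl21_pred
  sl21_submod_closed.

Record sl21 := Sl21 { sl21_val :> 'M[C]_3; _ : sl21_val \in sl21_pred }.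

HB.instance Definition _ := [isSub for sl21_val].
HB.instance Definition _ := [Choice of sl21 by <:].
HB.instance Definition _ := [SubChoice_isSubLmodule of sl21 by <:].

Lemma str_mulC p q (x y : 'M[C]_3) :
  str (mxpart p x *m mxpart q y)
    = (-1) ^+ (p && q) * str (mxpart q y *m mxpart p x).
Proof.
rewrite /str mulr_sumr.
under eq_bigr => i _ do rewrite mxE mulr_sumr.
under [RHS]eq_bigr => i _ do rewrite mxE mulr_sumr mulr_sumr.
rewrite exchange_big /=; apply: eq_bigr => j _; apply: eq_bigr => i _.
rewrite !mxE.
case: (ipar i) (ipar j) p q => [] [] [] [] /=;
  rewrite ?expr0 ?expr1 ?mul0r ?mulr0 ?mul1r ?mulN1r ?opprK //;
  by rewrite mulrC.
Qed.

Lemma str_sbracket x y : sbracket x y \in sl21_pred.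
Proof.
rewrite /sbracket; apply: rpred_sum => p _; apply: rpred_sum => q _.
rewrite unfold_in; apply/eqP.
transitivity (str (mxpart p x *m mxpart q y)
    - (-1) ^+ (p && q) * str (mxpart q y *m mxpart p x)).
  rewrite /str mulr_sumr -sumrB; apply: eq_bigr => i _.
  by rewrite !mxE mulrDr mulrN mulrCA.
by rewrite str_mulC subrr.
Qed.

Definition bracket (x y : sl21) : sl21 := Sl21 (str_sbracket x y).
Definition invform (x y : sl21) : C := str (sl21_val x *m sl21_val y).
Definition sl21_par (p : bool) (x : sl21) : Prop :=
  mxpart p x = x :> 'M[C]_3.

(* Matrix units, with the 1-based indices of the mathematical notation. *)
Definition Emx (i j : nat) : 'M[C]_3 :=
  \matrix_(a, b) ((a.+1 == i) && (b.+1 == j))%:R.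

Local Ltac str0 := by rewrite unfold_in /str !big_ord_recl big_ord0 !mxE /=
  !(expr0, expr1, addr0, add0r, oppr0, mulr0, mul1r, mulN1r, opprK, subrr, addNr).

Fact h1_sub : Emx 1 1 + Emx 3 3 \in sl21_pred.
Proof. str0. Qed.
Fact h2_sub : - Emx 2 2 - Emx 3 3 \in sl21_pred.
Proof. str0. Qed.
Fact e12_sub : Emx 1 2 \in sl21_pred. Proof. str0. Qed.
Fact f12_sub : Emx 2 1 \in sl21_pred. Proof. str0. Qed.
Fact e1_sub : Emx 1 3 \in sl21_pred. Proof. str0. Qed.
Fact e2_sub : Emx 3 2 \in sl21_pred. Proof. str0. Qed.
Fact f1_sub : Emx 3 1 \in sl21_pred. Proof. str0. Qed.
Fact f2_sub : - Emx 2 3 \in sl21_pred. Proof. str0. Qed.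

Definition h1 := Sl21 h1_sub.
Definition h2 := Sl21 h2_sub.
Definition e12 := Sl21 e12_sub.
Definition f12 := Sl21 f12_sub.
Definition e1 := Sl21 e1_sub.
Definition e2 := Sl21 e2_sub.
Definition f1 := Sl21 f1_sub.
Definition f2 := Sl21 f2_sub.
Definition hplus : sl21 := h1 + h2.

(* [Some (a, n)] stands for a(n) = a (x) t^n and [None] for k. *)
Definition affgen : Type := option (sl21 * int).

Local Notation freealg := {malg C[{fmonom affgen}]}.

Definition fgen (g : affgen) : freealg := << fmu g >>.

(* Defining relations of U(g~) as a quotient of the free algebra on affgen. *)
Inductive affrel : freealg -> Prop :=
| AffLin (c : C) a b n :
    affrel (fgen (Some (c *: a + b, n))
              - (c *: fgen (Some (a, n)) + fgen (Some (b, n))))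
| AffComm p q a b m n of sl21_par p a & sl21_par q b :
    affrel (fgen (Some (a, m)) * fgen (Some (b, n))
            - (-1) ^+ (p && q) *: (fgen (Some (b, n)) * fgen (Some (a, m)))
            - fgen (Some (bracket a b, m + n))
            - (if m + n == 0 then m%:~R * invform a b else 0) *: fgen None)
| AffCentral a n :
    affrel (fgen None * fgen (Some (a, n)) - fgen (Some (a, n)) * fgen None).

(* The induced module U(g~) (x)_U(P) C is the quotient of U(g~) by the left
   ideal generated by g (x) C[t] and k - kappa. *)
Inductive vacrel (kappa : C) : freealg -> Prop :=
| VacRel u r v of affrel r : vacrel kappa (u * r * v)
| VacAnn u a (n : nat) : vacrel kappa (u * fgen (Some (a, n%:Z)))
| VacLevel u : vacrel kappa (u * (fgen None - kappa *: 1)).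

Definition affV (kappa : C) : lmodType C := lquot (vacrel kappa).

Definition affvac (kappa : C) : affV kappa := lproj (vacrel kappa) 1.

Definition affact (kappa : C) (g : affgen) (v : affV kappa) : affV kappa :=
  lproj (vacrel kappa) (fgen g * generic_quotient.repr v).

Lemma affactE kappa g u :
  affact g (lproj (vacrel kappa) u) = lproj (vacrel kappa) (fgen g * u).
Proof.
apply/eqP; rewrite lproj_eq -mulrBr.
have : generic_quotient.repr (lproj (vacrel kappa) u) - u \in lspan (vacrel kappa).
  by rewrite -lproj_eq lproj_repr.
move: (_ - u) => w /asboolP[n [c [s [hs ->]]]].
rewrite mulr_sumr rpred_sum // => i _.
rewrite malg_scalerAr rpredZ //; apply: lspan_gen.
case: (hs i) => [u' r v hr|u' a m|u'].
- by rewrite mulrA [fgen g * (u' * r)]mulrA; exact: VacRel.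
- by rewrite mulrA; exact: VacAnn.
- by rewrite mulrA; exact: VacLevel.
Qed.

End Sl21.

Section VertexSuperalgebra.
Variable K : numFieldType.

Definition binomz (m : int) (i : nat) : K :=
  (\prod_(j < i) (m%:~R - j%:R)) / i`!%:R.

(* [nprod a n b] is a_n b, where Y(a, z) = \sum_n a_n z^(-n-1). *)
Record vertexSuperalgebra (V : lmodType K) := VertexSuperalgebra {
  vpar : bool -> V -> Prop;
  vac : V;
  nprod : V -> int -> V -> V;
  vpar0 : forall p, vpar p 0;
  vpar_linear : forall p c u v, vpar p u -> vpar p v -> vpar p (c *: u + v);
  vpar_sum : forall v, exists v0 v1,
    [/\ vpar false v0, vpar true v1 & v = v0 + v1];
  vpar_direct : forall v, vpar false v -> vpar true v -> v = 0;
  nprod_linearl : forall n b c u v,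
    nprod (c *: u + v) n b = c *: nprod u n b + nprod v n b;
  nprod_linearr : forall n a c u v,
    nprod a n (c *: u + v) = c *: nprod a n u + nprod a n v;
  nprod_par : forall p q n a b,
    vpar p a -> vpar q b -> vpar (p (+) q) (nprod a n b);
  nprod_trunc : forall a b, exists N : nat, forall n : int,
    N%:Z <= n -> nprod a n b = 0;
  vac_par : vpar false vac;
  vac_nprod : forall n b, nprod vac n b = if n == -1 then b else 0;
  nprod_vac : forall a, nprod a (-1) vac = a;
  nprod_vac0 : forall a (n : nat), nprod a n vac = 0;
  (* The Borcherds (Jacobi) identity; by [nprod_trunc] its three series over
     i >= 0 are finite, and N is any bound beyond which all terms vanish. *)
  borcherds : forall p q a b c (l m n : int) (N : nat),
    vpar p a -> vpar q b ->
    (forall i : nat, (N <= i)%N ->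
       [/\ nprod a (l + i%:Z) b = 0, nprod b (n + i%:Z) c = 0
         & nprod a (m + i%:Z) c = 0]) ->
    \sum_(i < N) binomz m i *: nprod (nprod a (l + i%:Z) b) (m + n - i%:Z) c
    = \sum_(i < N) ((-1) ^+ i * binomz l i) *:
        (nprod a (m + l - i%:Z) (nprod b (n + i%:Z) c)
         - ((-1) ^ l * (-1) ^+ (p && q)) *:
             nprod b (n + l - i%:Z) (nprod a (m + i%:Z) c))
}.

Definition videal (V : lmodType K) (Y : vertexSuperalgebra V)
    (I : V -> Prop) : Prop :=
  [/\ I 0, forall c u v, I u -> I v -> I (c *: u + v)
    & forall a n v, I v -> I (nprod Y a n v) /\ I (nprod Y v n a)].

Definition vsimple (V : lmodType K) (Y : vertexSuperalgebra V) : Prop :=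
  vac Y <> 0 /\
  forall I, videal Y I -> (forall v, I v -> v = 0) \/ (forall v, I v).

Definition vmorphism (V W : lmodType K) (Y : vertexSuperalgebra V)
    (Z : vertexSuperalgebra W) (f : {linear V -> W}) : Prop :=
  [/\ f (vac Y) = vac Z,
      forall p v, vpar Y p v -> vpar Z p (f v)
    & forall a n b, f (nprod Y a n b) = nprod Z (f a) n (f b)].

Definition simple_quotient (V W : lmodType K) (Y : vertexSuperalgebra V)
    (Z : vertexSuperalgebra W) (f : {linear V -> W}) : Prop :=
  [/\ vmorphism Y Z f, forall w, exists v, f v = w & vsimple Z].

Section C2.
Variables (V : lmodType K) (Y : vertexSuperalgebra V) (w : V).

(* V_(r), the r-eigenspace of the degree operator, i.e. of the z^(-2)
   coefficient w_1 of Y(w, z). *)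
Definition weight (r : rat) (v : V) : Prop := nprod Y w 1 v = ratr r *: v.

Inductive C2gen : V -> Prop :=
| C2Int r a b of r \is a Num.int & weight r a : C2gen (nprod Y a (-2) b)
| C2NonInt r a b of r \isn't a Num.int & weight r a : C2gen (nprod Y a (-1) b).

Definition A2 : lmodType K := lquot C2gen.

Definition A2proj : {linear V -> A2} := lproj C2gen.

Definition A2one : A2 := A2proj (vac Y).

Definition A2par (p : bool) (x : A2) : Prop :=
  exists2 v, vpar Y p v & x = A2proj v.

(* The product of A2 is the bilinear map induced by a . b. *)
Definition A2product (mul : A2 -> A2 -> A2) : Prop :=
  [/\ forall c x y z, mul (c *: x + y) z = c *: mul x z + mul y z,
      forall c x y z, mul x (c *: y + z) = c *: mul x y + mul x z
    & forall r s a b, weight r a -> weight s b ->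
        mul (A2proj a) (A2proj b) =
          if (r \is a Num.int) && (s \is a Num.int)
          then A2proj (nprod Y a (-1) b) else 0].

Definition C2_cofinite : Prop := finite_dimensional A2.

(* Isomorphism of A2 with an algebra B regarded as a purely even
   superalgebra: parity preservation says that odd elements map to 0. *)
Definition A2_isomorphic (B : comAlgType K) : Prop :=
  exists mul, A2product mul /\
  exists f : {linear A2 -> B},
    [/\ bijective f, f A2one = 1,
        forall x y, f (mul x y) = f x * f y
      & forall x, A2par true x -> f x = 0].

End C2.
End VertexSuperalgebra.

Section AffineVOSA.
Variables (R : realType) (kappa : R[i]).
Local Notation V := (affV kappa).

Definition cur (a : sl21 R) (n : int) (v : V) : V := affact (Some (a, n)) v.

Definition affine_structure (Y : vertexSuperalgebra V) : Prop :=
  [/\ vac Y = affvac kappa,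
      forall p a, sl21_par p a -> vpar Y p (cur a (-1) (affvac kappa))
    & forall a n v, nprod Y (cur a (-1) (affvac kappa)) n v = cur a n v].

Definition sugawara : V :=
  let one := affvac kappa in
  let pair a b := cur a (-1) (cur b (-1) one) in
  (2 * (kappa + 1))^-1 *:
    (pair (h1 R) (h2 R) + pair (h2 R) (h1 R)
     + pair (e12 R) (f12 R) + pair (f12 R) (e12 R)
     - pair (e1 R) (f1 R) + pair (f1 R) (e1 R)
     - pair (e2 R) (f2 R) + pair (f2 R) (e2 R)).

(* L(-1) is the mode sugawara_0. *)
Definition omega (Y : vertexSuperalgebra V) (xi : rat) : V :=
  sugawara + (ratr xi / 2) *:
    nprod Y sugawara 0 (cur (hplus R) (-1) (affvac kappa)).

End AffineVOSA.

Section LinearCombinations.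
Variables (A : comNzRingType) (x y : A).

Lemma lin2_0 : 0 = 0 * x + 0 * y. Proof. by rewrite !mul0r addr0. Qed.

Lemma lin2_lin c a b a' b' :
  c * (a * x + b * y) + (a' * x + b' * y) = (c * a + a') * x + (c * b + b') * y.
Proof. by rewrite mulrDr !mulrDl !mulrA addrACA. Qed.

End LinearCombinations.

Section QuotientAlgebra.
Variable R : realType.
Local Notation P := {mpoly R[i][2]}.

Definition t1 : P := 'X_ord0.
Definition t2 : P := 'X_ord_max.
Definition q1 : P := t1 * (t1 - 2 * t2).
Definition q2 : P := t2 * (t2 - 2 * t1).

Definition q_ideal : {pred P} := fun f =>
  `[< exists a b : P, f = a * q1 + b * q2 >].

Lemma meval_q1 : mpoly.meval (fun=> 0) q1 = 0.
Proof. by rewrite mpoly.mevalM mevalXU mul0r. Qed.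
Lemma meval_q2 : mpoly.meval (fun=> 0) q2 = 0.
Proof. by rewrite mpoly.mevalM mevalXU mul0r. Qed.

Lemma q_ideal_closed : idealr_closed q_ideal.
Proof.
split.
- by apply/asboolP; exists 0, 0; exact: lin2_0.
- apply/asboolP => -[a [b /(congr1 (mpoly.meval (fun=> 0)))]].
  rewrite mpoly.meval1 mpoly.mevalD (mpoly.mevalM _ a) (mpoly.mevalM _ b).
  by rewrite meval_q1 meval_q2 !mulr0 addr0 => /eqP; rewrite oner_eq0.
- move=> c u v /asboolP[a [b ->]] /asboolP[a' [b' ->]].
  by apply/asboolP; exists (c * a + a'), (c * b + b'); exact: lin2_lin.
Qed.

HB.instance Definition _ := isIdealr.Build P q_ideal q_ideal_closed.

Definition qalg : Type := {ideal_quot q_ideal}.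
HB.instance Definition _ := GRing.ComNzRing.on qalg.

Definition qproj (f : P) : qalg := \pi_{ideal_quot q_ideal}%qT f.

Definition qalg_scale (c : R[i]) (x : qalg) : qalg := qproj c%:MP * x.

Lemma qproj1 : qproj 1 = 1.
Proof. exact: (rmorph1 \pi_{ideal_quot q_ideal}%qT). Qed.
Lemma qprojD f g : qproj (f + g) = qproj f + qproj g.
Proof. exact: (raddfD \pi_{ideal_quot q_ideal}%qT). Qed.
Lemma qprojM f g : qproj (f * g) = qproj f * qproj g.
Proof. exact: (rmorphM \pi_{ideal_quot q_ideal}%qT). Qed.

Lemma qalg_scaleA a b x : qalg_scale a (qalg_scale b x) = qalg_scale (a * b) x.
Proof. by rewrite /qalg_scale mulrA -qprojM -mpolyCM. Qed.
Lemma qalg_scale1 : left_id 1 qalg_scale.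
Proof. by move=> x; rewrite /qalg_scale mpolyC1 qproj1 mul1r. Qed.
Lemma qalg_scaleDr : right_distributive qalg_scale +%R.
Proof. by move=> c x y; rewrite /qalg_scale mulrDr. Qed.
Lemma qalg_scaleDl x : {morph qalg_scale^~ x : a b / a + b}.
Proof. by move=> a b; rewrite /qalg_scale mpolyCD qprojD mulrDl. Qed.

HB.instance Definition _ := GRing.Zmodule_isLmodule.Build R[i] qalg
  qalg_scaleA qalg_scale1 qalg_scaleDr qalg_scaleDl.

Lemma qalg_scaleAl (c : R[i]) (x y : qalg) : c *: (x * y) = c *: x * y.
Proof. exact: mulrA. Qed.

HB.instance Definition _ := GRing.Lmodule_isLalgebra.Build R[i] qalg qalg_scaleAl.
HB.instance Definition _ := GRing.Lalgebra_isComAlgebra.Build R[i] qalg.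

End QuotientAlgebra.

(* Main.v *)
(** Write [a(n)] for the modes of the currents acting on the simple quotient
    [L]; the charged currents [e_12, f_12, e_i, f_i] have nonintegral
    [omega_xi]-weight, so their negative modes map [L] into [C_2(L)], and only
    [h_1(-1)] and [h_2(-1)] survive in [A_2(L)].

    Upper bound: at level -1/2 the universal algebra has two singular vectors
    of conformal weight 2 and charge 0.  They generate proper ideals, hence
    vanish in [L], and modulo [C_2(L)] they say [q_1(h_1, h_2) = 0] and
    [q_2(h_1, h_2) = 0]; so [1, h_1, h_2, h_1 h_2] span [A_2(L)].

    Lower bound: let [eps] be the coefficient of the vacuum, i.e. the projection
    onto the weight-0 space of [L(0)].  The functionals [v |-> eps (u v)], for
    [u = 1], for [u = -2 h_i(1)] and for one explicit quadratic expression [u]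
    in the modes [a(1) b(1)], assemble into a linear map
    [psi : L -> C[t_1, t_2] / <q_1, q_2>].  For all [a] and [b] it satisfies
    [psi (a_(-1) b) = psi a * psi b] and [psi (a_(-2) b) = 0], because both sides
    vanish for reasons of weight except in weight at most 2, where this is a
    finite computation in [sl(2|1)].  Since moreover [psi] kills odd vectors and
    vectors of nonintegral weight, it induces the isomorphism. *)
From HB Require Import structures.
Require Import Defs.
From mathcomp Require Import all_boot all_order all_algebra.
From mathcomp Require Import boolp reals complex.
From mathcomp Require Import ring.
From mathcomp Require Import monalg.

Set Implicit Arguments.
Unset Strict Implicit.
Unset Printing Implicit Defensive.

Import Order.TTheory GRing.Theory Num.Theory.

Local Open Scope ring_scope.

(** * Vertex superalgebras *)

(** Nothing is known in advance about the maximal ideal that is divided out. The upper bound uses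
    two of its elements and the lower bound none: [eps] exists on the simple quotient itself,
    because the vacuum is nonzero and every nonempty word in negative modes has positive
    [L(0)]-weight. So no functional has to be shown to descend from the universal algebra, and both
    bounds hold for any simple vertex superalgebra generated by currents of level -1/2
    ([affine_currents]). The two gradings have different tasks. The weights of [L(0)] are
    nonnegative integers and cut computations off; those of [L'(0)] only decide which products lie
    in C_2. The constants -2 come from duality: [(h_1, h_1) = (h_2, h_2) = 0] and [(h_1, h_2) = 1],
    so at level -1/2 the operator [-2 h_2(1)] reads off the coefficient of [h_1(-1) 1], and
    conversely. The product of A_2 is not constructed from [a_(-1) b]: it is transported from the
    polynomial quotient, and the multiplicativity of psi shows that it is the required one. *)

Section VertexAlgebraTheory.
Variables (K : numFieldType) (V : lmodType K) (Y : vertexSuperalgebra V).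

Local Notation "a *_[ n ] b" := (nprod Y a n b)
  (at level 39, n at level 99, left associativity, format "a  *_[ n ]  b").

Lemma binomz_0 m : binomz K m 0 = 1.
Proof. by rewrite /binomz big_ord0 divr1. Qed.

Lemma binomz_1 m : binomz K m 1 = m%:~R.
Proof. by rewrite /binomz big_ord1 subr0 divr1. Qed.

Lemma binomz_small (m i : nat) : (m < i)%N -> binomz K m i = 0.
Proof.
move=> lt_mi; rewrite /binomz (bigD1 (Ordinal lt_mi)) //=.
by rewrite -pmulrn subrr !mul0r.
Qed.

HB.instance Definition _ a n :=
  GRing.isLinear.Build K V V *:%R (nprod Y a n)
    (fun c u v => nprod_linearr Y n a c u v).

Definition nprod_left n b a := a *_[n] b.

HB.instance Definition _ n b :=
  GRing.isLinear.Build K V V *:%R (nprod_left n b)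
    (fun c u v => nprod_linearl Y n b c u v).

Lemma nprod0l n b : 0 *_[n] b = 0.
Proof. exact: (linear0 (nprod_left n b)). Qed.
Lemma nprodDl n b u v : (u + v) *_[n] b = u *_[n] b + v *_[n] b.
Proof. exact: (linearD (nprod_left n b)). Qed.
Lemma nprodZl n b c u : (c *: u) *_[n] b = c *: (u *_[n] b).
Proof. exact: (linearZ_LR (nprod_left n b)). Qed.
Lemma nprod_suml I r (P : pred I) (F : I -> V) n b :
  (\sum_(i <- r | P i) F i) *_[n] b = \sum_(i <- r | P i) F i *_[n] b.
Proof. exact: (linear_sum (nprod_left n b)). Qed.

Lemma nprod0r n a : a *_[n] 0 = 0.
Proof. exact: (linear0 (nprod Y a n)). Qed.
Lemma nprodDr n a u v : a *_[n] (u + v) = a *_[n] u + a *_[n] v.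
Proof. exact: (linearD (nprod Y a n)). Qed.
Lemma nprodBr n a u v : a *_[n] (u - v) = a *_[n] u - a *_[n] v.
Proof. exact: (linearB (nprod Y a n)). Qed.
Lemma nprodZr n a c u : a *_[n] (c *: u) = c *: (a *_[n] u).
Proof. exact: (linearZ_LR (nprod Y a n)). Qed.
Lemma nprod_sumr I r (P : pred I) (F : I -> V) n a :
  a *_[n] (\sum_(i <- r | P i) F i) = \sum_(i <- r | P i) a *_[n] F i.
Proof. exact: (linear_sum (nprod Y a n)). Qed.

Lemma vparD p u v : vpar Y p u -> vpar Y p v -> vpar Y p (u + v).
Proof. by move=> pu pv; rewrite -[u]scale1r; exact: vpar_linear. Qed.

Lemma vparZ p c u : vpar Y p u -> vpar Y p (c *: u).
Proof.
by move=> pu; rewrite -[_ *: u]addr0; apply: vpar_linear => //; exact: vpar0.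
Qed.

Lemma vparN p u : vpar Y p u -> vpar Y p (- u).
Proof. by rewrite -scaleN1r; exact: vparZ. Qed.

Lemma vpar_sumr p I r (P : pred I) (F : I -> V) :
  (forall i, P i -> vpar Y p (F i)) -> vpar Y p (\sum_(i <- r | P i) F i).
Proof. by apply: big_ind; [exact: vpar0 | exact: vparD]. Qed.

Lemma nprod_trunc_nat a b k : exists N : nat, forall i : nat, (N <= i)%N ->
  a *_[k + i%:Z] b = 0.
Proof.
have [N hN] := nprod_trunc Y a b; exists (N + `|k|)%N => i le_i.
apply: hN; have : (N + `|k|)%:Z <= i%:Z by rewrite lez_nat.
rewrite PoszD abszE; have := ler_norm (- k); rewrite normrN => h1 h2.
rewrite -lerBlDl; apply: le_trans h2; rewrite lerD2l //.
Qed.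

Lemma big_ord_pad (F : nat -> V) M N : (M <= N)%N ->
  (forall i, (M <= i)%N -> F i = 0) -> \sum_(i < N) F i = \sum_(i < M) F i.
Proof.
move=> le_MN F0; rewrite -!(big_mkord xpredT) (big_cat_nat (leq0n M) le_MN) /=.
by rewrite [X in _ + X]big_nat [X in _ + X]big1 ?addr0 // => i /andP[] /F0.
Qed.

(** The Borcherds identity at [l = 0], where [binomz K 0 i] vanishes for [i > 0]. The bound [M]
    concerns the products weighted by [binomz K m i], so for [m = 1] two terms suffice whatever the
    higher products of [a] and [b] are. *)
Lemma nprod_commutator p q a b c (m n : int) (M : nat) :
    vpar Y p a -> vpar Y q b ->
    (forall i, (M <= i)%N -> binomz K m i *: (a *_[i%:Z] b) = 0) ->
  a *_[m] (b *_[n] c) - (-1) ^+ (p && q) *: b *_[n] (a *_[m] c) =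
  \sum_(i < M) binomz K m i *: ((a *_[i%:Z] b) *_[m + n - i%:Z] c).
Proof.
move=> pa qb hM.
have [N1 h1] := nprod_trunc_nat a b 0.
have [N2 h2] := nprod_trunc_nat b c n.
have [N3 h3] := nprod_trunc_nat a c m.
pose N := (maxn M (maxn N1 (maxn N2 N3))).+1.
have hN i : (N <= i)%N -> [/\ a *_[0 + i%:Z] b = 0, b *_[n + i%:Z] c = 0
    & a *_[m + i%:Z] c = 0].
  rewrite /N => /ltnW; rewrite !geq_max => /and4P[_ l1 l2 l3].
  by split; [apply: h1 | apply: h2 | apply: h3].
have := borcherds pa qb hN; rewrite [X in _ = X]big_ord_recl [X in _ = _ + X]big1 => [|i _].
  rewrite addr0 binomz_0 mulr1 expr0 expr0z mul1r scale1r !addr0; move=> <-.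
  have le_MN : (M <= N)%N by rewrite leqW // leq_maxl.
  pose F i := binomz K m i *: ((a *_[i%:Z] b) *_[m + n - i%:Z] c).
  rewrite -[RHS](big_ord_pad (F := F) le_MN) => [|i /hM h0]; last first.
    by rewrite /F -nprodZl h0 nprod0l.
  by apply: eq_bigr => i _; rewrite /F add0r.
by rewrite (@binomz_small 0) // mulr0 scale0r.
Qed.

Lemma vpar_components_eq0 u v :
  vpar Y false u -> vpar Y true v -> u + v = 0 -> u = 0 /\ v = 0.
Proof.
move=> pu pv /eqP; rewrite addr_eq0 => /eqP uv.
have u0 : u = 0 by apply: (vpar_direct pu); rewrite uv; exact: vparN.
by split=> //; apply/eqP; rewrite -oppr_eq0 -uv u0.
Qed.

(** For even [a] the sign is 1 for both components of [b], so [b] may be inhomogeneous; the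
    vanishing hypothesis passes to the components because [a_i] preserves parity. *)
Lemma nprod_commutator_even a b c (m n : int) (M : nat) :
    vpar Y false a ->
    (forall i, (M <= i)%N -> binomz K m i *: (a *_[i%:Z] b) = 0) ->
  a *_[m] (b *_[n] c) - b *_[n] (a *_[m] c) =
  \sum_(i < M) binomz K m i *: ((a *_[i%:Z] b) *_[m + n - i%:Z] c).
Proof.
move=> pa; have [b0 [b1 [p0 p1 ->]]] := vpar_sum Y b => hM.
have h i : (M <= i)%N -> binomz K m i *: (a *_[i%:Z] b0) = 0 /\
    binomz K m i *: (a *_[i%:Z] b1) = 0.
  move=> /hM; rewrite linearD scalerDr; apply: vpar_components_eq0.
    by apply: vparZ; exact: (nprod_par i%:Z pa p0).
  by apply: vparZ; exact: (nprod_par i%:Z pa p1).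
have := nprod_commutator c n pa p0 (fun i le => proj1 (h i le)).
have := nprod_commutator c n pa p1 (fun i le => proj2 (h i le)).
rewrite /= expr0 !scale1r => e1 e0.
rewrite !nprodDl linearD opprD addrACA e0 e1 -big_split /=.
by apply: eq_bigr => i _; rewrite linearD nprodDl scalerDr.
Qed.

Lemma subn2z (i : nat) : -2 + i.+2%:Z = i.
Proof. by rewrite -[i.+2]addn2 PoszD addrC addrK. Qed.

(* The Borcherds identity with [b = 1], [l = -2] and [n = 0]: on the right all
   terms vanish. *)
Lemma nprod_derivative a n c :
  (a *_[-2] vac Y) *_[n] c = - n%:~R *: (a *_[n - 1] c).
Proof.
have [a0 [a1 [p0 p1 ->]]] := vpar_sum Y a.
suff main p d : vpar Y p d ->
    (d *_[-2] vac Y) *_[n] c = - n%:~R *: (d *_[n - 1] c).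
  by rewrite !nprodDl (main _ _ p0) (main _ _ p1) scalerDr.
move=> pd; have [N h] := nprod_trunc_nat d c n.
have hN i : (N.+2 <= i)%N -> [/\ d *_[-2 + i%:Z] vac Y = 0,
    vac Y *_[0 + i%:Z] c = 0 & d *_[n + i%:Z] c = 0].
  move=> le_i; split; first 1 last.
  - by rewrite vac_nprod add0r.
  - by apply: h; apply: leq_trans le_i; rewrite -addn2 leq_addr.
  - by case: i le_i => [|[|i]] // _; rewrite subn2z nprod_vac0.
have := borcherds pd (vac_par Y) hN.
rewrite [RHS]big1 => [|i _]; last first.
  rewrite !vac_nprod add0r linear0 (_ : 0 + -2 - _ == -1 = false).
    by rewrite scaler0 subr0 scaler0.
  by rewrite add0r -opprD eqr_opp.
rewrite !big_ord_recl /= [X in _ + (_ + X)]big1 => [|i _]; last first.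
  by rewrite /bump /= !add1n subn2z nprod_vac0 nprod0l scaler0.
rewrite addr0 binomz_0 binomz_1 scale1r !addr0.
rewrite (_ : bump 0 0 = 1%N) // (_ : -2 + 1%:Z = -1) // nprod_vac => /eqP.
by rewrite addr_eq0 scaleNr => /eqP.
Qed.

(** [nprod_derivative] solved for the deeper mode: inductions on the depth of a mode replace [a] by
    its derivative [a_(-2) 1]. *)
Lemma nprod_lower a (k : nat) b :
  a *_[- k.+2%:Z] b = k.+1%:R^-1 *: ((a *_[-2] vac Y) *_[- k.+1%:Z] b).
Proof.
rewrite nprod_derivative rmorphN opprK scalerA mulVf ?scale1r ?pnatr_eq0 //.
by rewrite -opprD -[k.+2]addn1 PoszD.
Qed.

(** The Borcherds identity at [m = 0]. It expresses the modes of [a_l b] through those of [a] and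
    [b], so that stability under currents propagates to all words. *)
Lemma nprod_iterate p q a b c (l n : int) : vpar Y p a -> vpar Y q b ->
  exists M : nat, (a *_[l] b) *_[n] c =
    \sum_(i < M) ((-1) ^+ i * binomz K l i) *:
        (a *_[l - i%:Z] (b *_[n + i%:Z] c)
         - ((-1) ^ l * (-1) ^+ (p && q)) *: b *_[n + l - i%:Z] (a *_[i%:Z] c)).
Proof.
move=> pa pb.
have [N1 h1] := nprod_trunc_nat a b l.
have [N2 h2] := nprod_trunc_nat b c n.
have [N3 h3] := nprod_trunc_nat a c 0.
pose N := (maxn N1 (maxn N2 N3)).+1.
have hN i : (N <= i)%N -> [/\ a *_[l + i%:Z] b = 0, b *_[n + i%:Z] c = 0
    & a *_[0 + i%:Z] c = 0].
  rewrite /N => /ltnW; rewrite !geq_max => /and3P[l1 l2 l3].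
  by split; [apply: h1 | apply: h2 | apply: h3].
exists N; have := borcherds pa pb hN; rewrite big_ord_recl [X in _ + X]big1 => [|i _].
  rewrite addr0 binomz_0 scale1r addr0 add0r subr0 => ->.
  by apply: eq_bigr => i _; rewrite !add0r.
by rewrite (@binomz_small 0) // scale0r.
Qed.

(** For the translation operator [T v = v_(-2) 1] this says [[T, a_l] = -l a_(l-1)]. It is the case
    [m = 0], [n = -2], [c = 1] of the Borcherds identity, where only [i = 0] and [i = 1] contribute
    on the right. *)
Lemma nprod_iterate_vac p q a b (l : int) : vpar Y p a -> vpar Y q b ->
  (a *_[l] b) *_[-2] vac Y = a *_[l] (b *_[-2] vac Y) - l%:~R *: (a *_[l - 1] b).
Proof.
move=> pa pb; have [N h] := nprod_trunc_nat a b l.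
have hN i : (N.+2 <= i)%N -> [/\ a *_[l + i%:Z] b = 0,
    b *_[-2 + i%:Z] vac Y = 0 & a *_[0 + i%:Z] vac Y = 0].
  move=> le_i; split.
  - by apply: h; apply: leq_trans le_i; rewrite -addn2 leq_addr.
  - by case: i le_i => [|[|i]] // _; rewrite subn2z nprod_vac0.
  - by rewrite add0r nprod_vac0.
have := borcherds pa pb hN; rewrite big_ord_recl [X in _ + X]big1 => [|i _].
  rewrite addr0 binomz_0 scale1r addr0 add0r subr0 => ->.
  rewrite !big_ord_recl /= [X in _ + (_ + X)]big1 => [|i _].
    rewrite !nprod_vac0 !linear0 binomz_0 binomz_1 /= !subr0 !addr0 expr0 expr1 mul1r mulN1r.
    by rewrite scale1r scaleNr add0r nprod_vac.
  by rewrite /bump /= !add1n subn2z !nprod_vac0 !linear0 addr0 scaler0.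
by rewrite (@binomz_small 0) // scale0r.
Qed.

End VertexAlgebraTheory.

(** * Subspaces, spans and eigenvectors *)

Section Linear.
Variables (K : fieldType) (V : lmodType K).

Definition subspace (P : V -> Prop) :=
  P 0 /\ forall c u v, P u -> P v -> P (c *: u + v).

Lemma subspace_sum (P : V -> Prop) (n : nat) (c : 'I_n -> K) (s : 'I_n -> V) :
  subspace P -> (forall i, P (s i)) -> P (\sum_i c i *: s i).
Proof.
case=> P0 Plin Ps; elim/big_rec: _ => // i x _; exact: Plin.
Qed.

Lemma lspan_sub (S P : V -> Prop) (v : V) :
  subspace P -> (forall u, S u -> P u) -> v \in lspan S -> P v.
Proof.
by move=> subP SP /asboolP[n [c [s [Ss ->]]]]; apply: subspace_sum => // i; exact: SP.
Qed.

Lemma lspan_subspace (S : V -> Prop) : subspace (fun v => v \in lspan S).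
Proof. by split=> [|c u v]; [exact: rpred0 | exact: (lspan_submod_closed S).2]. Qed.

(* Apply to [T] a polynomial that vanishes at the [l i] different from [r] but
   not at [r]. *)
Lemma eigen_component (T : {linear V -> V}) (n : nat) (l : 'I_n -> K)
    (y : 'I_n -> V) (r : K) :
  (forall i, T (y i) = l i *: y i) -> T (\sum_i y i) = r *: (\sum_i y i) ->
  \sum_i y i = \sum_(i | l i == r) y i.
Proof.
move=> Ty; rewrite (bigID (fun i => l i == r)) /= => Tz.
set z := \sum_(i | l i != r) y i in Tz *.
suff -> : z = 0 by rewrite addr0.
have {Tz} Tz : T z = r *: z.
  apply: (addrI (T (\sum_(i | l i == r) y i))); rewrite -linearD Tz scalerDr.
  congr (_ + _); rewrite [RHS]linear_sum scaler_sumr; apply: eq_bigr => i /eqP <-.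
  by rewrite Ty.
pose D (s : seq K) v := foldr (fun a w => T w - a *: w) v s.
have Dlin s : D s 0 = 0 /\ forall u v, D s (u + v) = D s u + D s v.
  elim: s => [//|a s [IH0 IHD]]; split=> [|u v] /=.
    by rewrite IH0 linear0 scaler0 subr0.
  by rewrite IHD linearD scalerDr opprD addrACA.
have Deig s v a : T v = a *: v -> D s v = (\prod_(b <- s) (a - b)) *: v.
  move=> Tv; elim: s => [|b s IH]; first by rewrite big_nil scale1r.
  by rewrite /= IH big_cons linearZ /= Tv !scalerA -scalerBl mulrC -mulrBl.
pose s := [seq l i | i <- enum 'I_n & l i != r].
have D0 : D s z = 0.
  rewrite /z (big_morph (D s) (Dlin s).2 (Dlin s).1) big1 // => i ir.
  rewrite (Deig _ _ _ (Ty i)) (_ : \prod_(b <- s) _ = 0) ?scale0r //.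
  apply/eqP; rewrite prodf_seq_eq0; apply/hasP; exists (l i).
    by apply: map_f; rewrite mem_filter ir mem_enum.
  by rewrite subrr eqxx.
have := Deig s z r Tz; rewrite D0 => /esym/eqP; rewrite scaler_eq0.
case/orP=> [|/eqP //]; rewrite prodf_seq_eq0 => /hasP[a /mapP[j]].
by rewrite mem_filter => /andP[jr _] -> /=; rewrite subr_eq0 eq_sym (negPf jr).
Qed.

End Linear.

(** * The Lie superalgebra sl(2|1) *)

Section Sl21Matrices.
Variable R : realType.
Local Notation C := R[i].
Implicit Types (x y a b : sl21 R) (m : 'M[C]_3).

Lemma sl21P x y : (sl21_val x = sl21_val y) -> x = y.
Proof. exact: val_inj. Qed.

Lemma sl21_valD x y : sl21_val (x + y) = sl21_val x + sl21_val y.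
Proof. exact: (raddfD (val : sl21 R -> 'M[C]_3)). Qed.

Lemma sl21_valZ c x : sl21_val (c *: x) = c *: sl21_val x.
Proof. exact: (linearZ_LR (val : sl21 R -> 'M[C]_3)). Qed.

(** For fixed [k], each of the two products comes from exactly one pair of parities, which fixes its
    sign. *)
Lemma sbracketE m m' i j : sbracket m m' i j =
  \sum_k (m i k * m' k j -
    (-1) ^+ ((ipar k (+) ipar j) && (ipar i (+) ipar k)) * (m' i k * m k j)).
Proof.
pose t p q k := (if ipar i (+) ipar k == p then m i k else 0) *
    (if ipar k (+) ipar j == q then m' k j else 0) -
    (-1) ^+ (p && q) * ((if ipar i (+) ipar k == q then m' i k else 0) *
    (if ipar k (+) ipar j == p then m k j else 0)).
have -> : sbracket m m' i j = \sum_p \sum_q \sum_k t p q k.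
  rewrite /sbracket summxE; apply: eq_bigr => p _.
  rewrite summxE; apply: eq_bigr => q _.
  rewrite mxE [X in _ + X]mxE [X in _ - X]mxE mxE [X in _ - _ * X]mxE mulr_sumr -sumrB.
  by apply: eq_bigr => k _; rewrite /t [mxpart _ _ _ _]mxE [mxpart q m' k j]mxE [mxpart q m' i k]mxE
      [mxpart p m k j]mxE.
under eq_bigr => p _ do rewrite exchange_big.
rewrite exchange_big; apply: eq_bigr => k _; rewrite !big_bool {}/t.
case: (ipar i (+) ipar k) (ipar k (+) ipar j) => [] [].
all: rewrite !(eqxx, mul0r, mulr0, expr0, expr1, mul1r, mulN1r, opprK, andbT, andbF).
all: rewrite /eq_op /= !(oppr0, add0r, addr0, subr0) //.
by rewrite addrC.
Qed.

Lemma ord3_ind (P : 'I_3 -> Prop) : P ord0 -> P (lift ord0 ord0) ->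
  P (lift ord0 (lift ord0 ord0)) -> forall k, P k.
Proof.
move=> P0 P1 P2 [[|[|[|//]]] lt3].
- by rewrite (_ : Ordinal lt3 = ord0) //; apply: val_inj.
- by rewrite (_ : Ordinal lt3 = lift ord0 ord0) //; apply: val_inj.
- by rewrite (_ : Ordinal lt3 = lift ord0 (lift ord0 ord0)) //; apply: val_inj.
Qed.

(* Matrices as tuples of entries, row by row: identities between brackets and
   forms of concrete elements then reduce to nine ring identities. *)
Definition t9 : Type := C * C * C * C * C * C * C * C * C.
Definition entries m : t9 :=
  let o0 := ord0 in let o1 := lift ord0 ord0 in
  let o2 := lift ord0 (lift ord0 ord0) in
  (m o0 o0, m o0 o1, m o0 o2, m o1 o0, m o1 o1, m o1 o2, m o2 o0, m o2 o1, m o2 o2).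

Lemma entries_inj m m' : entries m = entries m' -> m = m'.
Proof.
case=> ? ? ? ? ? ? ? ? ?; apply/matrixP => i j.
by elim/ord3_ind: i; elim/ord3_ind: j.
Qed.

Definition bracket9 (s t : t9) : t9 :=
  let: (x00, x01, x02, x10, x11, x12, x20, x21, x22) := s in
  let: (y00, y01, y02, y10, y11, y12, y20, y21, y22) := t in
  (x01 * y10 + x02 * y20 - (y01 * x10 - y02 * x20),
   x00 * y01 + x01 * y11 + x02 * y21 - (y00 * x01 + y01 * x11 - y02 * x21),
   x00 * y02 + x01 * y12 + x02 * y22 - (y00 * x02 + y01 * x12 + y02 * x22),
   x10 * y00 + x11 * y10 + x12 * y20 - (y10 * x00 + y11 * x10 - y12 * x20),
   x10 * y01 + x12 * y21 - (y10 * x01 - y12 * x21),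
   x10 * y02 + x11 * y12 + x12 * y22 - (y10 * x02 + y11 * x12 + y12 * x22),
   x20 * y00 + x21 * y10 + x22 * y20 - (y20 * x00 + y21 * x10 + y22 * x20),
   x20 * y01 + x21 * y11 + x22 * y21 - (y20 * x01 + y21 * x11 + y22 * x21),
   x20 * y02 + x21 * y12 - (- (y20 * x02) - y21 * x12)).

Definition form9 (s t : t9) : C :=
  let: (x00, x01, x02, x10, x11, x12, x20, x21, x22) := s in
  let: (y00, y01, y02, y10, y11, y12, y20, y21, y22) := t in
  x00 * y00 + x01 * y10 + x02 * y20 + x10 * y01 + x11 * y11 + x12 * y21
  - (x20 * y02 + x21 * y12 + x22 * y22).

Lemma entries_bracket x y :
  entries (bracket x y) = bracket9 (entries x) (entries y).
Proof.
rewrite /entries /= !sbracketE !big_ord_recl !big_ord0 /ipar /=.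
do ![congr (_, _)]; rewrite /eq_op /= ?(expr0, expr1); ring.
Qed.

Lemma entries_form x y : invform x y = form9 (entries x) (entries y).
Proof.
rewrite /invform /str /entries !big_ord_recl big_ord0 !mxE !big_ord_recl !big_ord0.
rewrite /ipar /form9 /= /eq_op /= ?(expr0, expr1); ring.
Qed.

End Sl21Matrices.

Section Sl21Basis.
Variable R : realType.
Local Notation C := R[i].
Implicit Types (x y a b : sl21 R) (m : 'M[C]_3).

Definition add9 (s t : t9 R) : t9 R :=
  let: (x00, x01, x02, x10, x11, x12, x20, x21, x22) := s in
  let: (y00, y01, y02, y10, y11, y12, y20, y21, y22) := t in
  (x00 + y00, x01 + y01, x02 + y02, x10 + y10, x11 + y11, x12 + y12,
   x20 + y20, x21 + y21, x22 + y22).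

Definition scale9 (c : C) (s : t9 R) : t9 R :=
  let: (x00, x01, x02, x10, x11, x12, x20, x21, x22) := s in
  (c * x00, c * x01, c * x02, c * x10, c * x11, c * x12, c * x20, c * x21, c * x22).

Lemma entriesD x y : entries (x + y) = add9 (entries x) (entries y).
Proof. by rewrite sl21_valD /entries !mxE. Qed.

Lemma entriesZ c x : entries (c *: x) = scale9 c (entries x).
Proof. by rewrite sl21_valZ /entries !mxE. Qed.

Lemma entries0 : entries (0 : sl21 R) = (0, 0, 0, 0, 0, 0, 0, 0, 0).
Proof.
have -> : sl21_val (0 : sl21 R) = 0 by exact: (raddf0 (val : sl21 R -> 'M[C]_3)).
by rewrite /entries !mxE.
Qed.

Lemma entries_eq x y : entries x = entries y -> x = y.
Proof. by move/entries_inj/sl21P. Qed.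

Local Ltac ent := rewrite /entries !mxE /= ?(addr0, add0r, oppr0).

Lemma entries_h1 : entries (h1 R) = (1, 0, 0, 0, 0, 0, 0, 0, 1).
Proof. by ent. Qed.
Lemma entries_h2 : entries (h2 R) = (0, 0, 0, 0, -1, 0, 0, 0, -1).
Proof. by ent. Qed.
Lemma entries_e12 : entries (e12 R) = (0, 1, 0, 0, 0, 0, 0, 0, 0).
Proof. by ent. Qed.
Lemma entries_f12 : entries (f12 R) = (0, 0, 0, 1, 0, 0, 0, 0, 0).
Proof. by ent. Qed.
Lemma entries_e1 : entries (e1 R) = (0, 0, 1, 0, 0, 0, 0, 0, 0).
Proof. by ent. Qed.
Lemma entries_e2 : entries (e2 R) = (0, 0, 0, 0, 0, 0, 0, 1, 0).
Proof. by ent. Qed.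
Lemma entries_f1 : entries (f1 R) = (0, 0, 0, 0, 0, 0, 1, 0, 0).
Proof. by ent. Qed.
Lemma entries_f2 : entries (f2 R) = (0, 0, 0, 0, 0, -1, 0, 0, 0).
Proof. by ent. Qed.

Lemma entries_sl21 x : exists a b c d e f g h : C,
  entries x = (a, b, c, d, e, f, g, h, a + e).
Proof.
exists (x ord0 ord0); do 7 eexists.
rewrite /entries; congr (_, _).
case: x => m /= /eqP; rewrite /str !big_ord_recl big_ord0 /= /ipar /eq_op /=.
rewrite !(expr0, expr1, mul1r, mulN1r, addr0) addrA => /eqP.
by rewrite subr_eq0 => /eqP <-.
Qed.

Lemma entries_even x : sl21_par false x -> exists a b c d : C,
  entries x = (a, b, 0, c, d, 0, 0, 0, a + d).
Proof.
move=> px; have [a [b [c [d [e [f [g [h ex]]]]]]]] := entries_sl21 x.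
exists a, b, d, e; rewrite ex.
have : entries x = entries (mxpart false x) by rewrite px.
rewrite {2}/entries !mxE /ipar /eq_op /= ex => -[_ _ -> _ _ -> -> -> _].
by rewrite /eq_op.
Qed.

Lemma entries_odd x : sl21_par true x -> exists a b c d : C,
  entries x = (0, 0, a, 0, 0, b, c, d, 0).
Proof.
move=> px; have [a [b [c [d [e [f [g [h ex]]]]]]]] := entries_sl21 x.
exists c, f, g, h; rewrite ex.
have : entries x = entries (mxpart true x) by rewrite px.
by rewrite {2}/entries !mxE /ipar /eq_op /= ex => -[-> -> _ -> -> _ _ _ ->].
Qed.

Local Ltac parity := apply: entries_inj; rewrite /entries !mxE /=;
  rewrite /ipar /eq_op /= ?(addr0, add0r, oppr0).

Lemma par_h1 : sl21_par false (h1 R). Proof. by parity. Qed.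
Lemma par_h2 : sl21_par false (h2 R). Proof. by parity. Qed.
Lemma par_e12 : sl21_par false (e12 R). Proof. by parity. Qed.
Lemma par_f12 : sl21_par false (f12 R). Proof. by parity. Qed.
Lemma par_e1 : sl21_par true (e1 R). Proof. by parity. Qed.
Lemma par_e2 : sl21_par true (e2 R). Proof. by parity. Qed.
Lemma par_f1 : sl21_par true (f1 R). Proof. by parity. Qed.
Lemma par_f2 : sl21_par true (f2 R). Proof. by parity. Qed.

Fact slproj_sub m : m + str m *: delta_mx ord_max ord_max \in @sl21_pred R.
Proof.
rewrite unfold_in; apply/eqP.
rewrite /str !big_ord_recl !big_ord0 !mxE /ipar /eq_op /=; ring.
Qed.

(* The projection along E_33; the images of the matrix units span sl(2|1). *)
Definition slproj m : sl21 R := Sl21 (slproj_sub m).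

(** All nine index pairs are kept, so that parity and charge have uniform formulas. The diagonal
    letters are [h_1], [-h_2] and 0, the only redundancy. *)
Definition letter (i j : 'I_3) : sl21 R := slproj (delta_mx i j).

(** The correction terms along E_33 add up to the supertrace of [x], which is 0. *)
Lemma letter_sum x : x = \sum_i \sum_j x i j *: letter i j.
Proof.
apply: val_inj; rewrite linear_sum; under [RHS]eq_bigr do rewrite linear_sum.
rewrite /= {1}[sl21_val x]matrix_sum_delta.
have e0 : \sum_i \sum_j x i j * str (delta_mx i j) = 0 :> C.
  transitivity (str x); last by case: x => m /= /eqP.
  rewrite [in RHS]/str; apply: eq_bigr => i _; rewrite (bigD1 i) //= big1 => [|j ji].
    rewrite /str (bigD1 i) //= big1 => [|k ki];
      first by rewrite !mxE !eqxx mulr1 addr0 addr0 mulrC.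
    by rewrite !mxE (negPf ki) mulr0.
  rewrite /str big1 ?mulr0 // => k _; rewrite !mxE.
  by case: (k =P i) => [->|_] /=; rewrite ?mulr0 // eq_sym (negPf ji) mulr0.
transitivity (\sum_i \sum_j x i j *: delta_mx i j +
    (\sum_i \sum_j x i j * str (delta_mx i j)) *: delta_mx ord_max ord_max).
  by rewrite e0 scale0r addr0.
rewrite scaler_suml -big_split /=; apply: eq_bigr => i _.
rewrite scaler_suml -big_split /=; apply: eq_bigr => j _.
by rewrite scalerDr scalerA.
Qed.

Lemma letter_par i j : sl21_par (ipar i (+) ipar j) (letter i j).
Proof.
apply: entries_inj; elim/ord3_ind: i; elim/ord3_ind: j; rewrite /entries /= /str !mxE /=;
  rewrite !big_ord_recl !big_ord0 !mxE /ipar /eq_op /=; do ![congr (_, _)]; ring.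
Qed.

(* The diagonal entries of h_+ = diag(1, -1, 0). *)
Definition hdiag (i : 'I_3) : int :=
  if val i == 0%N then 1 else if val i == 1%N then -1 else 0.

Definition charge (i j : 'I_3) : int := hdiag i - hdiag j.

Lemma bracket_hplusE x i j : bracket (hplus R) x i j = (charge i j)%:~R * x i j.
Proof.
have : entries (bracket (hplus R) x) = entries (\matrix_(i, j) ((charge i j)%:~R * x i j)).
  rewrite entries_bracket /hplus entriesD entries_h1 entries_h2 /entries !mxE.
  by rewrite /charge /hdiag /bracket9 /=; do ![congr (_, _)]; ring.
by move/entries_inj => /= ->; rewrite mxE.
Qed.

Lemma str_delta_neq i j : i != j -> str (delta_mx i j : 'M[C]_3) = 0.
Proof.
move=> ij; rewrite /str big1 // => k _; rewrite mxE.
by case: (k =P i) => [->|_] /=; rewrite ?(negPf ij) mulr0.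
Qed.

Lemma bracket_hplus i j : bracket (hplus R) (letter i j) = (charge i j)%:~R *: letter i j.
Proof.
apply/sl21P/matrixP => k l; rewrite bracket_hplusE sl21_valZ [RHS]mxE /= !mxE.
have [->|ij] := eqVneq i j.
  have [->|kl] := eqVneq k l; first by rewrite /charge !subrr !mul0r.
  rewrite [charge j j]subrr mul0r (_ : (k == j) && (l == j) = false); last first.
    by apply: contra_neqF kl => /andP[/eqP -> /eqP ->].
  rewrite (_ : (k == ord_max) && (l == ord_max) = false) ?mulr0 ?addr0 ?mulr0 //.
  by apply: contra_neqF kl => /andP[/eqP -> /eqP ->].
rewrite str_delta_neq // mul0r addr0.
by case: (k =P i) => [->|_] /=; rewrite ?mulr0 //; case: (l =P j) => [->|_] //; rewrite !mulr0.
Qed.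

Lemma bracket_linearl c x y a : bracket (c *: x + y) a = c *: bracket x a + bracket y a.
Proof.
have := entries_bracket (c *: x + y) a; have := entries_bracket y a;
have := entries_bracket x a.
move: (bracket x a) (bracket y a) (bracket (c *: x + y) a) => u v w eu ev ew.
apply: entries_eq; rewrite entriesD entriesZ eu ev ew entriesD entriesZ.
case: (entries x) => [[[[[[[[? ?] ?] ?] ?] ?] ?] ?] ?].
case: (entries y) => [[[[[[[[? ?] ?] ?] ?] ?] ?] ?] ?].
case: (entries a) => [[[[[[[[? ?] ?] ?] ?] ?] ?] ?] ?].
by rewrite /=; do ![congr (_, _)]; ring.
Qed.

Lemma bracket_linearr c x y a : bracket a (c *: x + y) = c *: bracket a x + bracket a y.
Proof.
have := entries_bracket a (c *: x + y); have := entries_bracket a y;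
have := entries_bracket a x.
move: (bracket a x) (bracket a y) (bracket a (c *: x + y)) => u v w eu ev ew.
apply: entries_eq; rewrite entriesD entriesZ eu ev ew entriesD entriesZ.
case: (entries x) => [[[[[[[[? ?] ?] ?] ?] ?] ?] ?] ?].
case: (entries y) => [[[[[[[[? ?] ?] ?] ?] ?] ?] ?] ?].
case: (entries a) => [[[[[[[[? ?] ?] ?] ?] ?] ?] ?] ?].
by rewrite /=; do ![congr (_, _)]; ring.
Qed.

Lemma invform_linearl c x y a : invform (c *: x + y) a = c * invform x a + invform y a.
Proof.
rewrite !entries_form entriesD entriesZ.
case: (entries x) => [[[[[[[[? ?] ?] ?] ?] ?] ?] ?] ?].
case: (entries y) => [[[[[[[[? ?] ?] ?] ?] ?] ?] ?] ?].
case: (entries a) => [[[[[[[[? ?] ?] ?] ?] ?] ?] ?] ?].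
by rewrite /=; ring.
Qed.

Lemma invform_linearr c x y a : invform a (c *: x + y) = c * invform a x + invform a y.
Proof.
rewrite !entries_form entriesD entriesZ.
case: (entries x) => [[[[[[[[? ?] ?] ?] ?] ?] ?] ?] ?].
case: (entries y) => [[[[[[[[? ?] ?] ?] ?] ?] ?] ?] ?].
case: (entries a) => [[[[[[[[? ?] ?] ?] ?] ?] ?] ?] ?].
by rewrite /=; ring.
Qed.

Lemma bracketDl x y a : bracket (x + y) a = bracket x a + bracket y a.
Proof. by rewrite -[x]scale1r bracket_linearl !scale1r. Qed.
Lemma bracketDr x y a : bracket a (x + y) = bracket a x + bracket a y.
Proof. by rewrite -[x]scale1r bracket_linearr !scale1r. Qed.
Lemma invformDl x y a : invform (x + y) a = invform x a + invform y a.
Proof. by rewrite -[x]scale1r invform_linearl mul1r scale1r. Qed.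
Lemma invformDr x y a : invform a (x + y) = invform a x + invform a y.
Proof. by rewrite -[x]scale1r invform_linearr mul1r scale1r. Qed.

Lemma slpart_sub p x : mxpart p x \in @sl21_pred R.
Proof.
case: x => m /= /eqP m0; rewrite unfold_in; apply/eqP; case: p.
  by rewrite /str big1 // => i _; rewrite mxE addbb mulr0.
rewrite -[RHS]m0 /str; apply: eq_bigr => i _; by rewrite mxE addbb.
Qed.

Lemma sl21_split x : exists x0 x1,
  [/\ sl21_par false x0, sl21_par true x1 & x = x0 + x1].
Proof.
exists (Sl21 (slpart_sub false x)), (Sl21 (slpart_sub true x)); split.
- by apply/matrixP => i j; rewrite !mxE; case: eqP.
- by apply/matrixP => i j; rewrite !mxE; case: eqP.
- apply: sl21P; rewrite sl21_valD; apply/matrixP => i j; rewrite !mxE.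
  by case: (_ (+) _); rewrite /= ?addr0 ?add0r.
Qed.

End Sl21Basis.

(** * Currents of the vacuum module and of its simple quotient *)

Section Currents.
Variables (R : realType) (kappa : R[i]) (V : lmodType R[i]).
Variables (Y : vertexSuperalgebra V) (J : sl21 R -> V).

(** Everything used about the algebra besides its simplicity: the products of currents at level
    [kappa], and generation from the vacuum, phrased as an induction principle. *)
Record affine_currents : Prop := AffineCurrents {
  cur_linear : forall c a b, J (c *: a + b) = c *: J a + J b;
  cur_par : forall p a, sl21_par p a -> vpar Y p (J a);
  cur_prod0 : forall a b,
    nprod Y (J a) 0 (J b) = J (bracket a b);
  cur_prod1 : forall a b,
    nprod Y (J a) 1 (J b) = (kappa * invform a b) *: vac Y;
  cur_prod_ge2 : forall a b (n : nat),
    nprod Y (J a) n.+2%:Z (J b) = 0;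
  cur_cyclic : forall P : V -> Prop, subspace P -> P (vac Y) ->
    (forall a n v, P v -> P (nprod Y (J a) n v)) -> forall v, P v
}.

End Currents.

(** * Relations and generation in the induced module *)

Section CyclicModule.
Variables (R : realType) (kappa : R[i]).
Variables (A : lalgType R[i]) (V : lmodType R[i]) (pi : {linear A -> V}).
Variables (gen : affgen R -> A) (act : affgen R -> V -> V).
Hypothesis scaleAr : forall c (x y : A), x * (c *: y) = c *: (x * y).
Hypothesis pi_surj : forall v, exists u, pi u = v.
Hypothesis actE : forall g u, act g (pi u) = pi (gen g * u).
Local Notation md a n := (Some (a, n)).

Hypothesis rel_linear : forall (c : R[i]) a b n u,
  pi ((gen (md (c *: a + b) n) - (c *: gen (md a n) + gen (md b n))) * u) = 0.
Hypothesis rel_commutator : forall p q a b m n u,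
  sl21_par p a -> sl21_par q b ->
  pi ((gen (md a m) * gen (md b n) - (-1) ^+ (p && q) *: (gen (md b n) * gen (md a m))
        - gen (md (bracket a b) (m + n))
        - (if m + n == 0 then m%:~R * invform a b else 0) *: gen None) * u) = 0.
Hypothesis rel_central : forall a n u,
  pi ((gen None * gen (md a n) - gen (md a n) * gen None) * u) = 0.
Hypothesis rel_vac : forall a (n : nat), pi (gen (md a (n%:Z))) = 0.
Hypothesis rel_level : pi (gen None - kappa *: 1) = 0.

Lemma act_linear g c u v : act g (c *: u + v) = c *: act g u + act g v.
Proof.
have [u' <-] := pi_surj u; have [v' <-] := pi_surj v.
by rewrite -linearP !actE mulrDr scaleAr linearP.
Qed.

Lemma act0 g : act g 0 = 0.
Proof. by rewrite -(linear0 pi) actE mulr0 linear0. Qed.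

Lemma act_linearl c a b n v :
  act (md (c *: a + b) n) v = c *: act (md a n) v + act (md b n) v.
Proof.
have [u <-] := pi_surj v; have := rel_linear c a b n u.
rewrite mulrBl linearB mulrDl -scalerAl linearP /= !actE.
by move/eqP; rewrite subr_eq0 => /eqP.
Qed.

Lemma act_commutator p q a b m n v : sl21_par p a -> sl21_par q b ->
  act (md a m) (act (md b n) v) = (-1) ^+ (p && q) *: act (md b n) (act (md a m) v)
    + act (md (bracket a b) (m + n)) v
    + (if m + n == 0 then m%:~R * invform a b else 0) *: act None v.
Proof.
move=> pa qb; have [u <-] := pi_surj v; rewrite !actE.
have := rel_commutator m n u pa qb.
rewrite 3!mulrBl 3!linearB -2!scalerAl !linearZ_LR -!mulrA /= ?scalerN => /eqP.
by rewrite subr_eq add0r 2!subr_eq => /eqP ->; rewrite addrC addrAC addrA.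
Qed.

Lemma act_central a n v : act None (act (md a n) v) = act (md a n) (act None v).
Proof.
have [u <-] := pi_surj v; rewrite !actE; have := rel_central a n u.
by rewrite mulrBl linearB -!mulrA => /eqP; rewrite subr_eq0 => /eqP.
Qed.

Lemma act_level_vac : act None (pi 1) = kappa *: pi 1.
Proof.
have /eqP := rel_level; rewrite linearB subr_eq0 => /eqP.
by rewrite actE mulr1 linearZ_LR.
Qed.

Lemma act_vac a (n : nat) : act (md a (n%:Z)) (pi 1) = 0.
Proof. by rewrite actE mulr1. Qed.

(** A word may contain the central generator, under which [P] is not assumed stable. Being central
    and equal to [kappa] on the vacuum, it acts by [kappa] on every word, and the induction carries
    this along. *)
Lemma act_cyclic (P : V -> Prop) : subspace P -> P (pi 1) ->
    (forall a n v, P v -> P (act (md a n) v)) ->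
  forall gs, P (foldr act (pi 1) gs).
Proof.
move=> [P0 Plin] Pvac Pact gs.
suff: P (foldr act (pi 1) gs) /\
    act None (foldr act (pi 1) gs) = kappa *: foldr act (pi 1) gs by case.
elim: gs => [|g gs] /=; first by split=> //; exact: act_level_vac.
set w := foldr _ _ _ => -[Pw kw].
have actZ h : act h (kappa *: w) = kappa *: act h w.
  by rewrite -[kappa *: w]addr0 act_linear act0 addr0.
case: g => [[a n]|]; first by rewrite act_central kw actZ; split=> //; exact: Pact.
by rewrite kw actZ kw; split=> //; rewrite -[_ *: w]addr0; exact: Plin.
Qed.

Lemma gen_words gs : pi (foldr (fun g u => gen g * u) 1 gs) = foldr act (pi 1) gs.
Proof. by elim: gs => //= g gs <-; rewrite actE. Qed.

End CyclicModule.

(* Products of currents are bilinear, so parity-homogeneous arguments suffice. *)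
Lemma bilinear_homogeneous (R : realType) (L : lmodType R[i])
    (Y : vertexSuperalgebra L) (J : sl21 R -> L) (n : int)
    (F : sl21 R -> sl21 R -> L) :
    (forall a b, J (a + b) = J a + J b) ->
    (forall x y a, F (x + y) a = F x a + F y a) ->
    (forall x y a, F a (x + y) = F a x + F a y) ->
    (forall q r a b, sl21_par q a -> sl21_par r b -> nprod Y (J a) n (J b) = F a b) ->
  forall a b, nprod Y (J a) n (J b) = F a b.
Proof.
move=> JD FDl FDr Fh a b; have [a0 [a1 [p0 p1 ->]]] := sl21_split a.
have [b0 [b1 [r0 r1 ->]]] := sl21_split b.
rewrite !JD !nprodDl !nprodDr.
rewrite (Fh _ _ _ _ p0 r0) (Fh _ _ _ _ p0 r1) (Fh _ _ _ _ p1 r0) (Fh _ _ _ _ p1 r1).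
by rewrite FDl !FDr.
Qed.

Section AffineVacuumModule.
Variables (R : realType) (kappa : R[i]).
Local Notation V := (affV kappa).
Local Notation pi := (lproj (vacrel kappa)).

Lemma pi_rel x : vacrel kappa x -> pi x = 0.
Proof.
move=> h; rewrite -(linear0 pi); apply/eqP.
by rewrite lproj_eq subr0; apply: lspan_gen.
Qed.

Lemma pi_affrel r u : affrel r -> pi (r * u) = 0.
Proof. by move=> hr; apply: pi_rel; rewrite -[r]mul1r; exact: VacRel. Qed.

Lemma pi_surj (v : V) : exists u, pi u = v. Proof. exact: lproj_surj. Qed.

Lemma cur_linearl c a b n (v : V) :
  cur (c *: a + b) n v = c *: cur a n v + cur b n v.
Proof.
apply: (act_linearl (pi := pi) pi_surj (@affactE _ _)) => *.
by apply: pi_affrel; exact: AffLin.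
Qed.

Lemma cur_commutator p q a b m n (v : V) : sl21_par p a -> sl21_par q b ->
  cur a m (cur b n v) = (-1) ^+ (p && q) *: cur b n (cur a m v)
    + cur (bracket a b) (m + n) v
    + (if m + n == 0 then m%:~R * invform a b else 0) *: affact None v.
Proof.
apply: (act_commutator (pi := pi) pi_surj (@affactE _ _)) => *.
by apply: pi_affrel; exact: AffComm.
Qed.

Lemma level_vac : affact None (affvac kappa) = kappa *: affvac kappa.
Proof.
apply: (act_level_vac (pi := pi) (@affactE _ _)); apply: pi_rel.
by rewrite -[_ - _]mul1r; exact: VacLevel.
Qed.

Lemma cur_vac a (n : nat) : cur a n (affvac kappa) = 0.
Proof.
apply: (act_vac (pi := pi) (@affactE _ _)) => b k; apply: pi_rel.
by rewrite -[fgen _]mul1r; exact: VacAnn.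
Qed.

Lemma affact0 g : affact g (0 : V) = 0.
Proof. exact: (act0 (pi := pi) (@affactE _ _)). Qed.

Lemma fgen_words (gs : seq (affgen R)) :
  << FMonom gs >> = foldr (fun g u => fgen g * u) 1 gs.
Proof.
elim: gs => [|g gs IH] /=; first by rewrite -fmoneE.
rewrite -IH /fgen malgM_def fgmulUU mul1r; congr << _ *g _ >>.
by rewrite /mmul /= fmmulE fmuE.
Qed.

Lemma affV_cyclic (P : V -> Prop) : subspace P -> P (affvac kappa) ->
  (forall a n v, P v -> P (cur a n v)) -> forall v, P v.
Proof.
move=> subP Pvac Pcur v; have [u <-] := pi_surj v.
rewrite [u]monalgE linear_sum /=; have [P0 Plin] := subP.
elim/big_rec: _ => // -[gs] w _ Pw.
rewrite (_ : << _ *g _ >> = u@_(FMonom gs) *: << FMonom gs >>); last first.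
  by apply/malgP => k; rewrite mcoeffZ !mcoeffU mulrnAr mulr1.
rewrite (linearZ_LR pi) fgen_words; apply: Plin => //.
rewrite (gen_words (@affactE R kappa)).
refine (@act_cyclic R kappa _ V pi (@fgen R) (@affact R kappa)
  (@malg_scalerAr _ _) pi_surj (@affactE R kappa) _ _ P _ Pvac Pcur gs).
- by move=> *; apply: pi_affrel; exact: AffCentral.
- by apply: pi_rel; rewrite -[_ - _]mul1r; exact: VacLevel.
- exact: subP.
Qed.

End AffineVacuumModule.

Section QuotientCurrents.
Variables (R : realType) (kappa : R[i]).
Local Notation V := (affV kappa).
Variables (Y : vertexSuperalgebra V) (L : lmodType R[i]).
Variables (YL : vertexSuperalgebra L) (p : {linear V -> L}).
Hypothesis Yaff : affine_structure Y.
Hypothesis pquot : simple_quotient Y YL p.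

Definition quot_cur (a : sl21 R) : L := p (cur a (-1) (affvac kappa)).

Lemma quot_vac : p (affvac kappa) = vac YL.
Proof. by case: Yaff => <- _ _; case: pquot => -[->]. Qed.

Lemma quot_nprod a n v : nprod YL (quot_cur a) n (p v) = p (cur a n v).
Proof. by case: pquot => -[_ _ <-] _ _; case: Yaff => _ _ ->. Qed.

(** As [a(n)] annihilates the vacuum for [n >= 0], the product is the commutator of [a(n)] with
    [b(-1)], applied to the vacuum. *)
Lemma quot_prod (n : nat) q r a b : sl21_par q a -> sl21_par r b ->
  nprod YL (quot_cur a) n (quot_cur b) =
    p (cur (bracket a b) (n%:Z - 1) (affvac kappa))
    + (if n == 1%N then kappa * invform a b else 0) *: vac YL.
Proof.
move=> qa rb; rewrite quot_nprod (cur_commutator _ _ _ qa rb).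
rewrite (cur_vac _ a n) {1}/cur affact0 scaler0 add0r level_vac linearD; congr (_ + _).
have pZ c v : p (c *: v) = c *: p v by exact: linearZ_LR.
rewrite [X in p X]scalerA pZ quot_vac subr_eq0 eqz_nat; congr (_ *: _).
by case: eqP => [->|_]; rewrite ?mul0r // mul1r mulrC.
Qed.

Lemma quot_curD a b : quot_cur (a + b) = quot_cur a + quot_cur b.
Proof. by rewrite /quot_cur -[a]scale1r cur_linearl linearP !scale1r. Qed.

Lemma quot_currents : affine_currents kappa YL quot_cur.
Proof.
split.
- by move=> c a b; rewrite /quot_cur cur_linearl linearP.
- move=> q a qa; case: pquot => -[_ pp _] _ _; apply: pp.
  by case: Yaff => _ hp _; exact: hp.
- apply: (bilinear_homogeneous (n := 0) (F := fun a b => quot_cur (bracket a b)) quot_curD).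
  + by move=> x y a; rewrite bracketDl quot_curD.
  + by move=> x y a; rewrite bracketDr quot_curD.
  + by move=> q r a b qa rb; rewrite (quot_prod 0 qa rb) scale0r addr0.
- apply: (bilinear_homogeneous (n := 1)
    (F := fun a b => (kappa * invform a b) *: vac YL) quot_curD).
  + by move=> x y a; rewrite invformDl mulrDr scalerDl.
  + by move=> x y a; rewrite invformDr mulrDr scalerDl.
  + by move=> q r a b qa rb; rewrite (quot_prod 1 qa rb) (cur_vac _ _ 0) linear0 add0r.
- move=> a b n; apply: (bilinear_homogeneous (n := n.+2%:Z) (F := fun a b => 0) quot_curD).
  + by move=> *; rewrite addr0.
  + by move=> *; rewrite addr0.
  + move=> q r x y qx ry; rewrite (quot_prod n.+2 qx ry) scale0r addr0.
    have -> : n.+2%:Z - 1 = n.+1 by rewrite -[n.+2]addn1 PoszD addrK.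
    by rewrite (cur_vac _ _ n.+1) linear0.
- move=> P [P0 Plin] Pvac Pcur w; have [v <-] : exists v, p v = w by case: pquot.
  pose Q v := P (p v); apply: (affV_cyclic (P := Q)) => [||a n u].
  + by split=> [|c u u']; rewrite /Q ?linear0 // linearP; exact: Plin.
  + by rewrite /Q quot_vac.
  + by rewrite /Q -quot_nprod; exact: Pcur.
Qed.

End QuotientCurrents.

(** * Quadratic vectors and the Sugawara vector *)

Section CurrentTheory.
Variables (R : realType) (kappa : R[i]) (V : lmodType R[i]).
Variables (Y : vertexSuperalgebra V) (J : sl21 R -> V).
Hypothesis HJ : affine_currents kappa Y J.
Local Notation C := R[i].
Local Notation "a *_[ n ] b" := (nprod Y a n b)
  (at level 39, n at level 99, left associativity, format "a  *_[ n ]  b").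
Local Notation vac := (vac Y).
Implicit Types (x a b : sl21 R).

Lemma JP c a b : J (c *: a + b) = c *: J a + J b.
Proof. exact: (cur_linear HJ). Qed.
Lemma JD a b : J (a + b) = J a + J b.
Proof. by have := JP 1 a b; rewrite !scale1r. Qed.
Lemma J0 : J 0 = 0.
Proof. by apply: (@addrI _ (J 0)); rewrite -JD !addr0. Qed.
Lemma JZ c a : J (c *: a) = c *: J a.
Proof. by have := JP c a 0; rewrite J0 !addr0. Qed.
Lemma J_sum I r (P : pred I) (F : I -> sl21 R) :
  J (\sum_(i <- r | P i) F i) = \sum_(i <- r | P i) J (F i).
Proof. exact: (big_morph J JD J0). Qed.

Lemma J_letters a : J a = \sum_i \sum_j a i j *: J (letter R i j).
Proof.
rewrite {1}(letter_sum a) J_sum; apply: eq_bigr => i _.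
by rewrite J_sum; apply: eq_bigr => j _; rewrite JZ.
Qed.

Definition quad (a b : sl21 R) : V := J a *_[-1] J b.

(** The affine relations are recovered from the products of currents: two terms remain in the
    commutator formula, since these products vanish from the second on. *)
Lemma current_commutator p q a b m n v : sl21_par p a -> sl21_par q b ->
  J a *_[m] (J b *_[n] v) = (-1) ^+ (p && q) *: (J b *_[n] (J a *_[m] v))
    + J (bracket a b) *_[m + n] v
    + (if m + n == 0 then m%:~R * (kappa * invform a b) else 0) *: v.
Proof.
move=> pa qb; apply/eqP; rewrite -addrA addrC -subr_eq; apply/eqP.
rewrite (nprod_commutator _ _ (cur_par HJ pa) (cur_par HJ qb) (M := 2)); last first.
  by case=> [|[|i]] // _; rewrite (cur_prod_ge2 HJ) scaler0.
rewrite !big_ord_recl big_ord0 /= addr0 binomz_0 binomz_1 scale1r.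
rewrite /bump /= (cur_prod0 HJ) (cur_prod1 HJ) !addr0; congr (_ + _).
rewrite nprodZl vac_nprod scalerA.
rewrite (_ : (m + n - _ == -1) = (m + n == 0)); last first.
  by rewrite addn0 subr_eq addNr.
by case: ifP; rewrite ?scaler0 ?scale0r.
Qed.

Lemma current_vac a (n : nat) : J a *_[n] vac = 0.
Proof. exact: nprod_vac0. Qed.

Section Quadratic.
Variables (p q : bool) (x a b : sl21 R).
Hypotheses (px : sl21_par p x) (qa : sl21_par q a).

Lemma quad_0 : J x *_[0] quad a b =
  quad (bracket x a) b + (-1) ^+ (p && q) *: quad a (bracket x b).
Proof.
rewrite /quad (current_commutator _ _ _ px qa) add0r /= scale0r addr0 addrC.
by rewrite (cur_prod0 HJ).
Qed.

Lemma quad_1 : J x *_[1] quad a b =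
  J (bracket (bracket x a) b) + (kappa * invform x a) *: J b
  + ((-1) ^+ (p && q) * (kappa * invform x b)) *: J a.
Proof.
rewrite /quad (current_commutator _ _ _ px qa) subrr eqxx mul1r.
rewrite (cur_prod0 HJ) (cur_prod1 HJ) nprodZr nprod_vac scalerA.
by rewrite -addrA addrC.
Qed.

Lemma quad_2 : J x *_[2] quad a b = (kappa * invform (bracket x a) b) *: vac.
Proof.
rewrite /quad (current_commutator _ _ _ px qa) (cur_prod_ge2 HJ _ _ 0) nprod0r.
by rewrite scaler0 add0r scale0r addr0 (cur_prod1 HJ).
Qed.

Lemma quad_ge3 (n : nat) : J x *_[n.+3] quad a b = 0.
Proof.
rewrite /quad (current_commutator _ _ _ px qa) (cur_prod_ge2 HJ) nprod0r.
by rewrite scaler0 add0r scale0r addr0 (cur_prod_ge2 HJ).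
Qed.

Lemma deriv_current (n : nat) d (qd : sl21_par q d) : J x *_[n] (J d *_[-2] vac) =
  J (bracket x d) *_[n%:Z - 2] vac
  + (if n == 2%N then 2 * (kappa * invform x d) else 0) *: vac.
Proof.
rewrite (current_commutator _ _ _ px qd) current_vac nprod0r scaler0 add0r.
by rewrite subr_eq0 eqz_nat; case: eqP => // ->.
Qed.

End Quadratic.

End CurrentTheory.

Section QuadraticSums.
Variables (R : realType) (kappa : R[i]) (V : lmodType R[i]).
Variables (Y : vertexSuperalgebra V) (J : sl21 R -> V).
Hypothesis HJ : affine_currents kappa Y J.
Local Notation C := R[i].
Local Notation "a *_[ n ] b" := (nprod Y a n b)
  (at level 39, n at level 99, left associativity, format "a  *_[ n ]  b").
Local Notation vac := (vac Y).
Local Notation quad := (quad Y J).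
Implicit Types (x a b : sl21 R) (p q : bool).

Definition zero9 : t9 R := (0, 0, 0, 0, 0, 0, 0, 0, 0).

Definition pick9 (k l : 'I_3) (t : t9 R) : C :=
  let: (x00, x01, x02, x10, x11, x12, x20, x21, x22) := t in
  match val k, val l with
  | 0, 0 => x00 | 0, 1 => x01 | 0, _ => x02
  | 1, 0 => x10 | 1, 1 => x11 | 1, _ => x12
  | _, 0 => x20 | _, 1 => x21 | _, _ => x22
  end%N.

Lemma pick9E k l x : sl21_val x k l = pick9 k l (entries x).
Proof. by elim/ord3_ind: k; elim/ord3_ind: l. Qed.

(* A list of [(c, q, a, b)] encodes the sum of the [c a(-1)b(-1)1], where [a]
   and [b] have parity [q]. *)
Fixpoint homogeneous (s : seq (C * bool * sl21 R * sl21 R)) : Prop :=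
  if s is (_, q, a, b) :: s' then
    [/\ sl21_par q a, sl21_par q b & homogeneous s'] else True.

Fixpoint qsum (s : seq (C * bool * sl21 R * sl21 R)) : V :=
  if s is (c, _, a, b) :: s' then c *: quad a b + qsum s' else 0.

Fixpoint entries_list (s : seq (C * bool * sl21 R * sl21 R)) :=
  if s is (c, q, a, b) :: s' then
    (c, q, entries a, entries b) :: entries_list s'
  else [::].

Section Modes.
Variables (p : bool) (tx : t9 R).
Implicit Type s : seq (C * bool * t9 R * t9 R).

(** [x(0)] of a quadratic vector is quadratic again. With the second factors expanded in letters,
    [mode0 k l] is the first factor standing before [letter k l]; its vanishing for all [k], [l]
    suffices for [x(0)] to kill the vector. [x(1)] yields a current and [x(2)] a multiple of the
    vacuum, so one matrix and one number describe them. *)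
Fixpoint mode0 (k l : 'I_3) s : t9 R :=
  if s is (c, q, a, b) :: s' then
    add9 (scale9 c (add9 (scale9 (pick9 k l b) (bracket9 tx a))
      (scale9 ((-1) ^+ (p && q) * pick9 k l (bracket9 tx b)) a))) (mode0 k l s')
  else zero9.

Fixpoint mode1 s : t9 R :=
  if s is (c, q, a, b) :: s' then
    add9 (scale9 c (add9 (add9 (bracket9 (bracket9 tx a) b)
      (scale9 (kappa * form9 tx a) b))
      (scale9 ((-1) ^+ (p && q) * (kappa * form9 tx b)) a))) (mode1 s')
  else zero9.

Fixpoint mode2 s : C :=
  if s is (c, q, a, b) :: s' then
    c * (kappa * form9 (bracket9 tx a) b) + mode2 s'
  else 0.

End Modes.

Lemma quadDl a a' b : quad (a + a') b = quad a b + quad a' b.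
Proof. by rewrite /quad (JD HJ) nprodDl. Qed.
Lemma quadZl c a b : quad (c *: a) b = c *: quad a b.
Proof. by rewrite /quad (JZ HJ) nprodZl. Qed.
Lemma quad0l b : quad 0 b = 0.
Proof. by rewrite /quad (J0 HJ) nprod0l. Qed.

Lemma quad_letters a b : quad a b = \sum_k \sum_l b k l *: quad a (letter R k l).
Proof.
rewrite /quad (J_letters HJ b) nprod_sumr; apply: eq_bigr => k _.
by rewrite nprod_sumr; apply: eq_bigr => l _; rewrite nprodZr.
Qed.

Lemma qsum_par s : homogeneous s -> vpar Y false (qsum s).
Proof.
elim: s => [|[[[c q] a] b] s IH] hs; first exact: vpar0.
have [qa qb hs'] := hs; apply: vpar_linear; last exact: IH.
rewrite -(addbb q); apply: nprod_par; exact: (cur_par HJ).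
Qed.

Lemma qsum_0 p x s : sl21_par p x -> homogeneous s ->
    (forall k l, mode0 p (entries x) k l (entries_list s) = zero9) ->
  J x *_[0] qsum s = 0.
Proof.
move=> px hs h0.
pose F k l := fix F (s : seq (C * bool * sl21 R * sl21 R)) : sl21 R :=
  if s is (c, q, a, b) :: s' then
    c *: (b k l *: bracket x a + ((-1) ^+ (p && q) * bracket x b k l) *: a) + F s'
  else 0.
have eF k l r : entries (F k l r) = mode0 p (entries x) k l (entries_list r).
  elim: r => [|[[[c q] a] b] r IH]; first exact: entries0.
  apply: etrans (entriesD _ _) _; rewrite IH; congr add9.
  apply: etrans (entriesZ _ _) _; congr scale9.
  apply: etrans (entriesD _ _) _; congr add9.
    apply: etrans (entriesZ _ _) _; rewrite pick9E; congr scale9.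
    exact: entries_bracket.
  apply: etrans (entriesZ _ _) _; congr (scale9 (_ * _) _).
  by rewrite pick9E; congr pick9; exact: entries_bracket.
have -> : J x *_[0] qsum s = \sum_k \sum_l quad (F k l s) (letter R k l).
  elim: s hs {h0} => [|[[[c q] a] b] s IH] /= hs.
    by rewrite nprod0r big1 // => k _; rewrite big1 // => l _; rewrite quad0l.
  have [qa _ hs'] := hs.
  rewrite nprodDr nprodZr (IH hs') (quad_0 HJ _ px qa).
  rewrite (quad_letters (bracket x a)) (quad_letters a (bracket x b)).
  rewrite scaler_sumr -big_split scaler_sumr -big_split; apply: eq_bigr => k _.
  rewrite scaler_sumr -big_split scaler_sumr -big_split; apply: eq_bigr => l _.
  by rewrite quadDl !quadZl quadDl !quadZl scalerA.
rewrite big1 // => k _; rewrite big1 // => l _.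
suff -> : F k l s = 0 by rewrite quad0l.
by apply: entries_eq; rewrite entries0 eF h0.
Qed.

Lemma qsum_1 p x s (y : sl21 R) : sl21_par p x -> homogeneous s ->
    mode1 p (entries x) (entries_list s) = entries y ->
  J x *_[1] qsum s = J y.
Proof.
move=> px hs hy.
pose F := fix F (s : seq (C * bool * sl21 R * sl21 R)) : sl21 R :=
  if s is (c, q, a, b) :: s' then
    c *: (bracket (bracket x a) b + (kappa * invform x a) *: b
      + ((-1) ^+ (p && q) * (kappa * invform x b)) *: a) + F s'
  else 0.
have eF r : entries (F r) = mode1 p (entries x) (entries_list r).
  elim: r => [|[[[c q] a] b] r IH]; first exact: entries0.
  apply: etrans (entriesD _ _) _; rewrite IH; congr add9.
  apply: etrans (entriesZ _ _) _; congr scale9.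
  apply: etrans (entriesD _ _) _; congr add9.
    apply: etrans (entriesD _ _) _; congr add9.
      apply: etrans (entries_bracket _ _) _; congr bracket9.
      exact: entries_bracket.
    by apply: etrans (entriesZ _ _) _; rewrite entries_form.
  by apply: etrans (entriesZ _ _) _; rewrite entries_form.
have <- : F s = y by apply: entries_eq; rewrite eF.
elim: s hs {hy} => [|[[[c q] a] b] s IH] hs; first by rewrite nprod0r /= (J0 HJ).
have [qa _ hs'] := hs.
rewrite /= nprodDr nprodZr (IH hs') (quad_1 HJ _ px qa).
by rewrite (JP HJ) !(JD HJ) !(JZ HJ).
Qed.

Lemma qsum_2 p x s : sl21_par p x -> homogeneous s ->
  J x *_[2] qsum s = mode2 (entries x) (entries_list s) *: vac.
Proof.
move=> px; elim: s => [|[[[c q] a] b] s IH] hs; first by rewrite nprod0r /= scale0r.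
have [qa _ hs'] := hs.
rewrite /= nprodDr nprodZr (IH hs') (quad_2 HJ _ px qa) scalerA scalerDl.
by rewrite entries_form entries_bracket.
Qed.

Lemma qsum_ge3 p x s (n : nat) : sl21_par p x -> homogeneous s ->
  J x *_[n.+3] qsum s = 0.
Proof.
move=> px; elim: s => [|[[[c q] a] b] s IH] hs; first by rewrite nprod0r.
have [qa _ hs'] := hs.
by rewrite /= nprodDr nprodZr (IH hs') (quad_ge3 HJ _ px qa) scaler0 addr0.
Qed.

End QuadraticSums.

Ltac entries_simpl := cbn [entries_list];
  rewrite ?entries_h1 ?entries_h2 ?entries_e12 ?entries_f12
    ?entries_e1 ?entries_e2 ?entries_f1 ?entries_f2.

(** * The Casimir element, the null vectors and the dual functional, in coordinates *)

Section Lists.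
Variables (R : realType) (kappa : R[i]).
Local Notation C := R[i].

Definition casimir : seq (C * bool * sl21 R * sl21 R) :=
  [:: (1, false, h1 R, h2 R); (1, false, h2 R, h1 R);
      (1, false, e12 R, f12 R); (1, false, f12 R, e12 R);
      (-1, true, e1 R, f1 R); (1, true, f1 R, e1 R);
      (-1, true, e2 R, f2 R); (1, true, f2 R, e2 R)].

(* For level -1/2, [null1 + h_1(-2) 1] and [null2 + h_2(-2) 1] span the singular
   vectors of weight 2 and charge 0. *)
Definition null1 : seq (C * bool * sl21 R * sl21 R) :=
  [:: (-2, false, h1 R, h1 R); (4, false, h1 R, h2 R); (2, false, e12 R, f12 R);
      (-4, true, e1 R, f1 R); (-2, true, e2 R, f2 R)].

Definition null2 : seq (C * bool * sl21 R * sl21 R) :=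
  [:: (4, false, h1 R, h2 R); (-2, false, h2 R, h2 R); (2, false, e12 R, f12 R);
      (-2, true, e1 R, f1 R); (-4, true, e2 R, f2 R)].

(* Read with modes [a(1) b(1)], this is the solution of the linear system saying
   that the functional [eps (u v)] vanishes on the [a(-1) b(-1) 1] with [a]
   charged and on the [h(-2) 1], and takes the values 1, 2, 2 on [h_1 h_2],
   [h_1 h_1], [h_2 h_2], like the coefficient of [t_1 t_2] modulo [q_1, q_2]. *)
Definition dual_top : seq (C * bool * sl21 R * sl21 R) :=
  [:: (4, false, h1 R, h1 R); (-12, false, h1 R, h2 R); (4, false, h2 R, h2 R);
      (-8, false, e12 R, f12 R); (8, true, e1 R, f1 R); (8, true, e2 R, f2 R)].

Lemma casimir_homogeneous : homogeneous casimir.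
Proof.
rewrite /=; do !split; first [exact: par_h1 | exact: par_h2 | exact: par_e12
  | exact: par_f12 | exact: par_e1 | exact: par_e2 | exact: par_f1 | exact: par_f2].
Qed.

Lemma null1_homogeneous : homogeneous null1.
Proof.
rewrite /=; do !split; first [exact: par_h1 | exact: par_h2 | exact: par_e12
  | exact: par_f12 | exact: par_e1 | exact: par_e2 | exact: par_f1 | exact: par_f2].
Qed.

Lemma null2_homogeneous : homogeneous null2.
Proof.
rewrite /=; do !split; first [exact: par_h1 | exact: par_h2 | exact: par_e12
  | exact: par_f12 | exact: par_e1 | exact: par_e2 | exact: par_f1 | exact: par_f2].
Qed.

Definition h1_9 : t9 R := (1, 0, 0, 0, 0, 0, 0, 0, 1).
Definition h2_9 : t9 R := (0, 0, 0, 0, -1, 0, 0, 0, -1).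
Definition e12_9 : t9 R := (0, 1, 0, 0, 0, 0, 0, 0, 0).
Definition f12_9 : t9 R := (0, 0, 0, 1, 0, 0, 0, 0, 0).
Definition e1_9 : t9 R := (0, 0, 1, 0, 0, 0, 0, 0, 0).
Definition e2_9 : t9 R := (0, 0, 0, 0, 0, 0, 0, 1, 0).
Definition f1_9 : t9 R := (0, 0, 0, 0, 0, 0, 1, 0, 0).
Definition f2_9 : t9 R := (0, 0, 0, 0, 0, -1, 0, 0, 0).

Definition casimir9 : seq (C * bool * t9 R * t9 R) :=
  [:: (1, false, h1_9, h2_9); (1, false, h2_9, h1_9);
      (1, false, e12_9, f12_9); (1, false, f12_9, e12_9);
      (-1, true, e1_9, f1_9); (1, true, f1_9, e1_9);
      (-1, true, e2_9, f2_9); (1, true, f2_9, e2_9)].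

Definition null1_9 : seq (C * bool * t9 R * t9 R) :=
  [:: (-2, false, h1_9, h1_9); (4, false, h1_9, h2_9); (2, false, e12_9, f12_9);
      (-4, true, e1_9, f1_9); (-2, true, e2_9, f2_9)].

Lemma casimir_entries : entries_list casimir = casimir9.
Proof. by rewrite /casimir; entries_simpl. Qed.

Lemma null1_entries : entries_list null1 = null1_9.
Proof. by rewrite /null1; entries_simpl. Qed.

Definition null2_9 : seq (C * bool * t9 R * t9 R) :=
  [:: (4, false, h1_9, h2_9); (-2, false, h2_9, h2_9); (2, false, e12_9, f12_9);
      (-2, true, e1_9, f1_9); (-4, true, e2_9, f2_9)].

Lemma null2_entries : entries_list null2 = null2_9.
Proof. by rewrite /null2; entries_simpl. Qed.

Lemma entries_homogeneous p (x : sl21 R) : sl21_par p x -> exists a b c d : C,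
  entries x = if p then (0, 0, a, 0, 0, b, c, d, 0)
              else (a, b, 0, c, d, 0, 0, 0, a + d).
Proof. by case: p => [/entries_odd|/entries_even]. Qed.

(** Invariance of the Casimir element under the adjoint action. *)
Lemma casimir_mode0 p (x : sl21 R) k l : sl21_par p x ->
  mode0 p (entries x) k l (entries_list casimir) = @zero9 R.
Proof.
rewrite casimir_entries => /entries_homogeneous[a [b [c [d ->]]]].
by case: p; elim/ord3_ind: k; elim/ord3_ind: l; rewrite /zero9 /= ?expr0 ?expr1;
  congr (_, _, _, _, _, _, _, _, _); ring.
Qed.

(** The form terms of the dual bases contribute [2 kappa]; the double brackets contribute 2, the
    eigenvalue of the Casimir element on the adjoint representation (dual Coxeter number 1). *)
Lemma casimir_mode1 p (x : sl21 R) : sl21_par p x ->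
  mode1 kappa p (entries x) (entries_list casimir) = scale9 (2 * (kappa + 1)) (entries x).
Proof.
rewrite casimir_entries => /entries_homogeneous[a [b [c [d ->]]]].
by case: p; rewrite /zero9 /= ?expr0 ?expr1; congr (_, _, _, _, _, _, _, _, _); ring.
Qed.

Lemma casimir_mode2 p (x : sl21 R) : sl21_par p x ->
  mode2 kappa (entries x) (entries_list casimir) = 0.
Proof.
rewrite casimir_entries => /entries_homogeneous[a [b [c [d ->]]]].
by case: p; rewrite /=; ring.
Qed.

(** [x(1)] and [x(2)] send [h_1(-2) 1] to [[x, h_1](-1) 1] and to [2 kappa (x, h_1) 1]. This lemma
    and [null1_mode2] say that the quadratic part cancels these, which uses the level -1/2. *)
Lemma null1_mode1 p (x : sl21 R) : sl21_par p x ->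
  mode1 (- (1 / 2)) p (entries x) (entries_list null1) =
  entries (- bracket x (h1 R)).
Proof.
rewrite null1_entries -[- bracket _ _]scaleN1r (entriesZ (-1) (bracket x (h1 R))).
rewrite (entries_bracket x (h1 R)) entries_h1.
move=> /entries_homogeneous[a [b [c [d ->]]]].
by case: p; rewrite /zero9 /= ?expr0 ?expr1; congr (_, _, _, _, _, _, _, _, _); field.
Qed.

Lemma null1_mode2 p (x : sl21 R) : sl21_par p x ->
  mode2 (- (1 / 2)) (entries x) (entries_list null1) =
  - (2 * (- (1 / 2) * invform x (h1 R))).
Proof.
rewrite null1_entries entries_form entries_h1 => /entries_homogeneous[a [b [c [d ->]]]].
by case: p; rewrite /=; field.
Qed.

Lemma null2_mode1 p (x : sl21 R) : sl21_par p x ->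
  mode1 (- (1 / 2)) p (entries x) (entries_list null2) =
  entries (- bracket x (h2 R)).
Proof.
rewrite null2_entries -[- bracket _ _]scaleN1r (entriesZ (-1) (bracket x (h2 R))).
rewrite (entries_bracket x (h2 R)) entries_h2.
move=> /entries_homogeneous[a [b [c [d ->]]]].
by case: p; rewrite /zero9 /= ?expr0 ?expr1; congr (_, _, _, _, _, _, _, _, _); field.
Qed.

Lemma null2_mode2 p (x : sl21 R) : sl21_par p x ->
  mode2 (- (1 / 2)) (entries x) (entries_list null2) =
  - (2 * (- (1 / 2) * invform x (h2 R))).
Proof.
rewrite null2_entries entries_form entries_h2 => /entries_homogeneous[a [b [c [d ->]]]].
by case: p; rewrite /=; field.
Qed.

End Lists.

Section Conformal.
Variables (K : numFieldType) (V : lmodType K) (Y : vertexSuperalgebra V).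
Local Notation "a *_[ n ] b" := (nprod Y a n b)
  (at level 39, n at level 99, left associativity, format "a  *_[ n ]  b").

(** [[w_1, a_n] = (w_0 a)_(n+1) + (w_1 a)_n], as [binomz K 1 i] vanishes for [i >= 2], and [w_0 a]
    is the derivative of [a]. No Virasoro relation enters, so the lemma serves [sug] and the shifted
    vector alike. *)
Lemma conformal_weight_nprod w a b (n : int) r s :
  vpar Y false w -> (forall v, w *_[0] v = v *_[-2] vac Y) ->
  w *_[1] a = r *: a -> w *_[1] b = s *: b ->
  w *_[1] (a *_[n] b) = (r + s - (n%:~R + 1)) *: (a *_[n] b).
Proof.
move=> pw w0 wa wb; apply/eqP; rewrite -subr_eq0; apply/eqP.
have := nprod_commutator_even b n (m := 1) (M := 2) (b := a) pw.
rewrite !big_ord_recl big_ord0 /= binomz_0 binomz_1 scale1r w0 wa wb => /(_ _)/wrap[|].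
  by case=> [|[|i]] // _; rewrite (@binomz_small _ 1) // scale0r.
move/eqP; rewrite subr_eq => /eqP ->.
rewrite nprod_derivative nprodZl nprodZr !addr0 /bump /= (addrC 1 n) !addrK scale1r.
by rewrite -!scalerDl -scalerBl intrD /= (_ : _ - _ = 0) ?scale0r //; ring.
Qed.

End Conformal.

(** * Sugawara modes, and words in currents as a spanning set *)

Section Words.
Variables (R : realType) (kappa : R[i]) (V : lmodType R[i]).
Variables (Y : vertexSuperalgebra V) (J : sl21 R -> V).
Hypothesis HJ : affine_currents kappa Y J.
Local Notation C := R[i].
Local Notation "a *_[ n ] b" := (nprod Y a n b)
  (at level 39, n at level 99, left associativity, format "a  *_[ n ]  b").
Local Notation vac := (vac Y).
Local Notation qsum := (qsum Y J).
Implicit Types (x a b : sl21 R) (p q : bool).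

Definition sug : V := (2 * (kappa + 1))^-1 *: qsum (casimir R).

Lemma sug_par : vpar Y false sug.
Proof. by apply: vparZ; apply: (qsum_par HJ); exact: casimir_homogeneous. Qed.

Lemma current_split n a (F : sl21 R -> V) v :
  (forall x y, F (x + y) = F x + F y) ->
  (forall p x, sl21_par p x -> J x *_[n] v = F x) -> J a *_[n] v = F a.
Proof.
move=> FD Fh; have [a0 [a1 [p0 p1 ->]]] := sl21_split a.
by rewrite (JD HJ) nprodDl FD (Fh _ _ p0) (Fh _ _ p1).
Qed.

Lemma sug_mode0 a : J a *_[0] sug = 0.
Proof.
apply: (@current_split _ _ (fun=> 0)) => [x y|p x px]; first by rewrite addr0.
rewrite nprodZr (qsum_0 HJ px (casimir_homogeneous R)) ?scaler0 // => k l.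
exact: casimir_mode0.
Qed.

Lemma sug_mode1 a : kappa + 1 != 0 -> J a *_[1] sug = J a.
Proof.
move=> hk; apply: (@current_split _ _ J) => [x y|p x px]; first exact: (JD HJ).
rewrite nprodZr (qsum_1 (y := (2 * (kappa + 1)) *: x) HJ px (casimir_homogeneous R)).
  by rewrite (JZ HJ) scalerA mulVf ?scale1r // mulf_neq0 // pnatr_eq0.
by rewrite (casimir_mode1 _ px) entriesZ.
Qed.

Lemma sug_mode_ge2 a (n : nat) : J a *_[n.+2] sug = 0.
Proof.
apply: (@current_split _ _ (fun=> 0)) => [x y|p x px]; first by rewrite addr0.
rewrite nprodZr; case: n => [|n].
  by rewrite (qsum_2 HJ px (casimir_homogeneous R)) (casimir_mode2 _ px) scale0r scaler0.
by rewrite (qsum_ge3 HJ _ px (casimir_homogeneous R)) scaler0.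
Qed.

Hypothesis kappa_ncrit : kappa + 1 != 0.

(** With the current on the left, the commutator formula involves only the products of a current
    with [sug], which are those just computed: 0, the current itself, then 0. *)
Lemma sug_commutator a m n v :
  J a *_[m] (sug *_[n] v) = sug *_[n] (J a *_[m] v) + m%:~R *: (J a *_[m + n - 1] v).
Proof.
apply: (@current_split _ _ (fun a => sug *_[n] (J a *_[m] v)
  + m%:~R *: (J a *_[m + n - 1] v))) => [x y|p x px].
  by rewrite (JD HJ) !nprodDl nprodDr scalerDr addrACA.
apply/eqP; rewrite addrC -subr_eq; apply/eqP.
have := nprod_commutator v n (m := m) (M := 2) (cur_par HJ px) sug_par.
rewrite !big_ord_recl big_ord0 /= binomz_0 binomz_1 scale1r => /(_ _)/wrap[|].
  by case=> [|[|i]] // _; rewrite sug_mode_ge2 scaler0.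
by rewrite andbF expr0 scale1r sug_mode0 nprod0l add0r addr0 sug_mode1.
Qed.

Lemma sug_current (n m : int) a v :
  sug *_[n] (J a *_[m] v) = J a *_[m] (sug *_[n] v) - m%:~R *: (J a *_[m + n - 1] v).
Proof. by rewrite sug_commutator addrK. Qed.

(* The letter [(i, j, k)] stands for the mode [n0 - 1 - k] of the current
   [letter i j], so that all modes occurring in a word are smaller than [n0]. *)
Fixpoint word (n0 : int) (y : V) (s : seq ('I_3 * 'I_3 * nat)) : V :=
  if s is (i, j, k) :: s' then J (letter R i j) *_[n0 - k.+1%:Z] word n0 y s' else y.

Fixpoint word_par (s : seq ('I_3 * 'I_3 * nat)) : bool :=
  if s is (i, j, _) :: s' then (ipar i (+) ipar j) (+) word_par s' else false.

Fixpoint word_deg (n0 : int) (s : seq ('I_3 * 'I_3 * nat)) : int :=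
  if s is (_, _, k) :: s' then k.+1%:Z - n0 + word_deg n0 s' else 0.

Lemma word_vpar n0 q y s : vpar Y q y -> vpar Y (word_par s (+) q) (word n0 y s).
Proof.
move=> qy; elim: s => [|[[i j] k] s IH] //=.
by rewrite -addbA; apply: nprod_par => //; apply: (cur_par HJ); exact: letter_par.
Qed.

Lemma word_weight n0 e y s : sug *_[1] y = e *: y ->
  sug *_[1] (word n0 y s) = (e + (word_deg n0 s)%:~R) *: word n0 y s.
Proof.
move=> ye; elim: s => [|[[i j] k] s IH] /=; first by rewrite addr0.
rewrite sug_current IH addrK nprodZr -scalerBl; congr (_ *: _).
by rewrite !intrD !rmorphN /=; ring.
Qed.

Section LowSpan.
Variables (n0 : int) (y : V).
Hypothesis y_sing : forall a (n : int), n0 <= n -> J a *_[n] y = 0.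

Definition short_word (r : nat) (v : V) :=
  exists s : seq ('I_3 * 'I_3 * nat), (size s <= r)%N /\ v = word n0 y s.

Definition is_word (v : V) := exists s : seq ('I_3 * 'I_3 * nat), v = word n0 y s.

Lemma current_in (S : V -> Prop) a n v :
  (forall i j, J (letter R i j) *_[n] v \in lspan S) -> J a *_[n] v \in lspan S.
Proof.
move=> h; rewrite (J_letters HJ a) nprod_suml rpred_sum // => i _.
by rewrite nprod_suml rpred_sum // => j _; rewrite nprodZl rpredZ.
Qed.

Lemma preimage_subspace (S : V -> Prop) (a : V) n :
  subspace (fun v => a *_[n] v \in lspan S).
Proof.
split=> [|c u v hu hv]; first by rewrite nprod0r rpred0.
by rewrite nprodDr nprodZr rpredD // rpredZ.
Qed.

Lemma short_word_low r a (n : int) v : n < n0 ->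
  v \in lspan (short_word r) -> J a *_[n] v \in lspan (short_word r.+1).
Proof.
move=> lt_n; apply: (lspan_sub (preimage_subspace _ _ _)) => _ [s [szs ->]].
apply: current_in => i j; apply: lspan_gen.
have [k nk] : exists k : nat, n = n0 - k.+1%:Z.
  exists (absz (n0 - n - 1)%R); rewrite -addn1 PoszD gez0_abs.
    by rewrite subrK opprB addrC subrK.
  by rewrite subr_ge0 -ltzD1 addrC -ltrBlDl subrr subr_gt0.
by exists ((i, j, k) :: s); rewrite nk.
Qed.

Lemma short_word_leq r r' v : (r <= r')%N ->
  v \in lspan (short_word r) -> v \in lspan (short_word r').
Proof.
move=> le_r; apply: (lspan_sub (lspan_subspace _)) => _ [s [szs ->]].
by apply: lspan_gen; exists s; split=> //; exact: leq_trans le_r.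
Qed.

(** Moving the mode past the first letter leaves that letter on a vector covered by induction, a
    bracket mode on a word shorter by one, and a scalar. Even if the bracket mode is below [n0], the
    length bound is kept. *)
Lemma short_word_high r a (n : int) v : n0 <= n ->
  v \in lspan (short_word r) -> J a *_[n] v \in lspan (short_word r).
Proof.
elim: r => [|r IH] in a n v * => le_n.
  apply: (lspan_sub (preimage_subspace _ _ _)) => _ [[|t s] [szs ->]] //=.
  by rewrite y_sing // rpred0.
apply: (lspan_sub (preimage_subspace _ _ _)) => _ [[|t s] [szs ->]] /=.
  by rewrite y_sing // rpred0.
case: t szs => [[i j] k] szs.
have ws : word n0 y s \in lspan (short_word r) by apply: lspan_gen; exists s.
apply: current_in => i' j'.
rewrite (current_commutator HJ _ _ _ (letter_par _ i' j') (letter_par _ i j)).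
apply: rpredD; first apply: rpredD.
- apply: rpredZ; apply: short_word_low; last exact: IH.
  by rewrite ltrBlDr ltrDl.
- set m := _ + _; have [le_m|lt_m] := leP n0 m.
    by apply: (@short_word_leq r); [| exact: IH].
  exact: short_word_low.
- by apply: rpredZ; apply: (@short_word_leq r).
Qed.

(* Modes [>= n0] are commuted to the right, where they annihilate [y]. *)
Lemma word_span_stable a (n : int) v :
  v \in lspan is_word -> J a *_[n] v \in lspan is_word.
Proof.
apply: (lspan_sub (preimage_subspace _ _ _)) => _ [s ->].
have sub u r : u \in lspan (short_word r) -> u \in lspan is_word.
  by apply: (lspan_sub (lspan_subspace _)) => _ [s' [_ ->]]; apply: lspan_gen; exists s'.
have ws : word n0 y s \in lspan (short_word (size s)) by apply: lspan_gen; exists s.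
have [le_n|lt_n] := leP n0 n.
  by apply: (sub _ (size s)); exact: short_word_high.
by apply: (sub _ (size s).+1); exact: short_word_low.
Qed.

End LowSpan.

Lemma vac_sing a (n : int) : 0 <= n -> J a *_[n] vac = 0.
Proof. by case: n => // n _; exact: nprod_vac0. Qed.

(** The vacuum is annihilated by all modes [>= 0], so the words in negative modes span a stable
    subspace, which is everything by cyclicity. Only spanning is claimed; the modes are not
    ordered. *)
Lemma neg_span v : v \in lspan (is_word 0 vac).
Proof.
apply: (cur_cyclic HJ (P := fun v => v \in lspan (is_word 0 vac))).
- exact: lspan_subspace.
- by apply: lspan_gen; exists [::].
- by move=> a n u; apply: word_span_stable; exact: vac_sing.
Qed.

Lemma words_ind (P : V -> Prop) : subspace P -> (forall s, P (word 0 vac s)) ->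
  forall v, P v.
Proof. by move=> subP Pw v; apply: (lspan_sub subP _ (neg_span v)) => _ [s ->]. Qed.

Lemma word_homogeneous s : vpar Y (word_par s) (word 0 vac s).
Proof. by rewrite -[word_par s]addbF; apply: word_vpar; exact: vac_par. Qed.

(** Both operators kill the vacuum and have the same commutator with every current mode, hence agree
    on words. *)
Lemma sug_translation v : sug *_[0] v = v *_[-2] vac.
Proof.
apply: (words_ind (P := fun v => sug *_[0] v = v *_[-2] vac)).
  split=> [|c u u' hu hu']; first by rewrite nprod0r nprod0l.
  by rewrite nprodDr nprodZr nprodDl (nprodZl _ _ _ c u) hu hu'.
elim=> [|[[i j] k] s IH] /=; first by rewrite nprod_vac0 vac_nprod.
rewrite (nprod_iterate_vac _ (cur_par HJ (letter_par R i j)) (word_homogeneous s)).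
by rewrite sug_current IH addr0.
Qed.

Lemma sug_vac : sug *_[1] vac = 0 *: vac.
Proof. by rewrite scale0r nprod_vac0. Qed.

End Words.

(** * Singular vectors vanish in a simple quotient *)

Section Simplicity.
Variables (R : realType) (kappa : R[i]) (V : lmodType R[i]).
Variables (Y : vertexSuperalgebra V) (J : sl21 R -> V).
Hypothesis HJ : affine_currents kappa Y J.
Hypothesis kappa_ncrit : kappa + 1 != 0.
Local Notation C := R[i].
Local Notation "a *_[ n ] b" := (nprod Y a n b)
  (at level 39, n at level 99, left associativity, format "a  *_[ n ]  b").
Local Notation vac := (vac Y).
Local Notation sug := (sug kappa Y J).
Local Notation word := (word Y J).
Implicit Types (x a b : sl21 R) (p q : bool).

Lemma subspaceZ (P : V -> Prop) c v : subspace P -> P v -> P (c *: v).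
Proof. by case=> P0 Plin Pv; rewrite -[_ *: v]addr0; exact: Plin. Qed.

Lemma subspaceB (P : V -> Prop) u v : subspace P -> P u -> P v -> P (u - v).
Proof. by case=> P0 Plin Pu Pv; rewrite addrC -scaleN1r; exact: Plin. Qed.

Lemma subspace_bigsum (P : V -> Prop) I (r : seq I) (F : I -> V) :
  subspace P -> (forall i, P (F i)) -> P (\sum_(i <- r) F i).
Proof.
case=> P0 Plin PF; elim/big_rec: _ => // i x _ Px.
by rewrite -[F i]scale1r; exact: Plin.
Qed.

(** Reduces the two-sided condition of [videal] to stability under current modes. The splitting
    hypothesis supplies homogeneous elements, without which the supercommutator formula cannot be
    applied. *)
Lemma stable_subspace_ideal (I : V -> Prop) : subspace I ->
    (forall a n v, I v -> I (J a *_[n] v)) ->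
    (forall v, I v -> exists v0 v1,
       [/\ vpar Y false v0, vpar Y true v1, I v0, I v1 & v = v0 + v1]) ->
  videal Y I.
Proof.
move=> subI Istable Isplit; have [I0 Ilin] := subI.
have left u : forall n v, I v -> I (u *_[n] v).
  apply: (words_ind HJ (P := fun u => forall n v, I v -> I (u *_[n] v))).
    split=> [n v _|c u1 u2 h1 h2 n v Iv]; first by rewrite nprod0l.
    by rewrite nprodDl nprodZl; apply: Ilin; [exact: h1 | exact: h2].
  elim=> [|[[i j] k] s IH] n v Iv /=.
    by rewrite vac_nprod; case: ifP.
  have [M ->] := nprod_iterate v (0 - k.+1%:Z) n
    (cur_par HJ (letter_par R i j)) (word_homogeneous HJ s).
  apply: subspace_bigsum => // l; apply: (subspaceZ _ subI); apply: subspaceB => //.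
    by apply: Istable; exact: IH.
  by apply: (subspaceZ _ subI); apply: IH; exact: Istable.
(* On the vacuum, [v_n 1] is 0 or a multiple of an iterated derivative of [v], and derivatives are
   left products by [sug]. On a longer word the first letter is commuted to the front. *)
have right u : forall n v, I v -> I (v *_[n] u).
  apply: (words_ind HJ (P := fun u => forall n v, I v -> I (v *_[n] u))).
    split=> [n v _|c u1 u2 h1 h2 n v Iv]; first by rewrite nprod0r.
    by rewrite nprodDr nprodZr; apply: Ilin; [exact: h1 | exact: h2].
  elim=> [|[[i j] k] s IH] n v Iv /=.
    case: n => n; first by rewrite nprod_vac0.
    elim: n => [|n IHn] in v Iv *; first by rewrite nprod_vac.
    rewrite NegzE nprod_lower; apply: (subspaceZ _ subI).
    by rewrite -NegzE; apply: IHn; rewrite -(sug_translation HJ kappa_ncrit); exact: left.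
  have [v0 [v1 [p0 p1 I0v I1v ->]]] := Isplit v Iv.
  suff main q z : vpar Y q z -> I z ->
      I (z *_[n] (J (letter R i j) *_[0 - k.+1%:Z] word 0 vac s)).
    rewrite nprodDl -[_ *_[n] _]scale1r; apply: Ilin; [exact: main p0 _ | exact: main p1 _].
  move=> qz Iz; set e := (-1) ^+ ((ipar i (+) ipar j) && q) : C.
  have [M hM] := nprod_trunc_nat Y (J (letter R i j)) z 0.
  have := nprod_commutator (word 0 vac s) n (m := 0 - k.+1%:Z) (M := M)
    (cur_par HJ (letter_par R i j)) qz.
  move=> /(_ _)/wrap[l /hM|]; first by rewrite add0r => ->; rewrite scaler0.
  set l := J (letter R i j) *_[_] _; set S := \sum_(_ < _) _ => hS.
  have h : e *: (z *_[n] (J (letter R i j) *_[0 - k.+1%:Z] word 0 vac s)) = l - S.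
    by rewrite -hS opprB [RHS]addrC subrK.
  have ee : e * e = 1 by rewrite -expr2 sqrr_sign.
  rewrite -[_ *_[n] _]scale1r -ee -scalerA h; apply: (subspaceZ _ subI).
  apply: subspaceB => //; first by apply: Istable; exact: IH.
  apply: subspace_bigsum => // r; apply: (subspaceZ _ subI); apply: IH.
  exact: Istable.
by split=> // u n v Iv; split; [exact: left | exact: right].
Qed.

Lemma lspan_split (S : V -> Prop) : (forall v, S v -> exists q, vpar Y q v) ->
  forall v, v \in lspan S -> exists v0 v1,
    [/\ vpar Y false v0, vpar Y true v1, v0 \in lspan S, v1 \in lspan S & v = v0 + v1].
Proof.
move=> Shom v; pose P v := exists v0 v1,
    [/\ vpar Y false v0, vpar Y true v1, v0 \in lspan S, v1 \in lspan S & v = v0 + v1].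
apply: (lspan_sub (P := P)) => [|u Su]; first split.
- by exists 0, 0; rewrite addr0 rpred0; split=> //; exact: vpar0.
- move=> c _ _ [u0 [u1 [p0 p1 h0 h1 ->]]] [w0 [w1 [r0 r1 g0 g1 ->]]].
  exists (c *: u0 + w0), (c *: u1 + w1); split; try exact: vpar_linear.
  + by rewrite rpredD // rpredZ.
  + by rewrite rpredD // rpredZ.
  + by rewrite scalerDr addrACA.
- have uS : u \in lspan S by exact: lspan_gen.
  case: (Shom u Su) => -[] qu.
    by exists 0, u; rewrite add0r rpred0; split=> //; exact: vpar0.
  by exists u, 0; rewrite addr0 rpred0; split=> //; exact: vpar0.
Qed.

(** The vacuum has [L(0)]-eigenvalue 0, and the component of eigenvalue 0 in a sum of eigenvectors
    with nonzero eigenvalues is an empty sum. *)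
Lemma vac_notin_lspan (S : V -> Prop) : vac <> 0 ->
  (forall v, S v -> exists2 e, e != 0 & sug *_[1] v = e *: v) -> vac \notin lspan S.
Proof.
move=> vac0 Se; apply/negP => /asboolP[n [c [s [Ss vacE]]]].
have [e he] := choice (fun i => let: ex_intro2 e e0 h := Se _ (Ss i) in
  ex_intro (fun e => e != 0 /\ sug *_[1] (s i) = e *: s i) e (conj e0 h)).
apply: vac0; rewrite vacE.
rewrite (@eigen_component _ _ (nprod Y sug 1) n e _ 0).
- by rewrite big1 // => i /eqP ei; have := (he i).1; rewrite ei eqxx.
- by move=> i; rewrite /= nprodZr (he i).2 !scalerA mulrC.
- by rewrite /= -vacE nprod_vac0 scale0r.
Qed.

Lemma word_deg_ge0 (n0 : int) s : n0 <= 1 -> 0 <= word_deg n0 s.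
Proof.
move=> le_n0; elim: s => [|[[i j] k] s IH] //=; apply: addr_ge0 => //.
by rewrite subr_ge0 (le_trans le_n0).
Qed.

(* The ideal generated by [y] is spanned by words in nonpositive modes applied to
   [y]; their weights are positive, so it does not contain the vacuum. *)
Lemma singular_eq0 q y (N : nat) : vsimple Y -> vpar Y q y ->
    (forall a (n : int), 1 <= n -> J a *_[n] y = 0) ->
    sug *_[1] y = N.+1%:R *: y -> y = 0.
Proof.
move=> [vac0 simple] qy ysing yN.
pose I v := v \in lspan (is_word Y J 1 y).
have Ihom v : is_word Y J 1 y v -> exists q, vpar Y q v.
  by case=> s ->; exists (word_par s (+) q); exact: (word_vpar HJ).
have ideal : videal Y I.
  apply: stable_subspace_ideal.
  - exact: lspan_subspace.
  - by move=> a n v; exact: (word_span_stable HJ ysing).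
  - exact: lspan_split.
case: (simple I ideal) => [I0|/(_ vac) Ivac].
  by apply: I0; apply: lspan_gen; exists [::].
have /negP[] : vac \notin lspan (is_word Y J 1 y); last exact: Ivac.
apply: vac_notin_lspan => // _ [s ->]; eexists; last exact: (word_weight HJ kappa_ncrit _ _ yN).
rewrite -[_%:R]/(N.+1%:Z%:~R) -intrD intr_eq0 gt_eqF //.
by rewrite ltr_wpDr // word_deg_ge0.
Qed.

End Simplicity.

(** * Null vectors of weight 2 and the coefficient of the vacuum *)

Section VacuumCoefficient.
Variables (R : realType) (kappa : R[i]) (V : lmodType R[i]).
Variables (Y : vertexSuperalgebra V) (J : sl21 R -> V).
Hypothesis HJ : affine_currents kappa Y J.
Hypothesis kappa_ncrit : kappa + 1 != 0.
Local Notation C := R[i].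
Local Notation "a *_[ n ] b" := (nprod Y a n b)
  (at level 39, n at level 99, left associativity, format "a  *_[ n ]  b").
Local Notation vac := (vac Y).
Local Notation sug := (sug kappa Y J).
Local Notation word := (word Y J 0 vac).
Local Notation qsum := (qsum Y J).
Implicit Types (x a b : sl21 R) (p q : bool).

Lemma sug_current_weight a n v e : sug *_[1] v = e *: v ->
  sug *_[1] (J a *_[n] v) = (e - n%:~R) *: (J a *_[n] v).
Proof.
by move=> ve; rewrite (sug_current HJ kappa_ncrit) ve addrK nprodZr scalerBl.
Qed.

Lemma sug_J a : sug *_[1] J a = 1 *: J a.
Proof.
have := @sug_current_weight a (-1) vac 0; rewrite nprod_vac0 scale0r nprod_vac.
by rewrite rmorphN sub0r opprK; apply.
Qed.

Lemma sug_quad a b : sug *_[1] quad Y J a b = 2%:R *: quad Y J a b.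
Proof.
rewrite (sug_current_weight a (-1) (sug_J b)) rmorphN opprK.
by rewrite -[1 + 1]/(2%:R).
Qed.

Lemma sug_qsum s : sug *_[1] qsum s = 2%:R *: qsum s.
Proof.
elim: s => [|[[[c q] a] b] s IH]; first by rewrite nprod0r scaler0.
by rewrite /= nprodDr nprodZr IH sug_quad scalerDr !scalerA mulrC.
Qed.

(** The hypotheses on modes 1 and 2 cancel the contributions of [d(-2) 1]; all higher modes vanish
    on both parts. The vector is thus singular of weight 2, hence 0 by simplicity. *)
Lemma null_vector (s : seq (C * bool * sl21 R * sl21 R)) d : vsimple Y ->
    homogeneous s -> sl21_par false d ->
    (forall p x, sl21_par p x ->
       mode1 kappa p (entries x) (entries_list s) = entries (- bracket x d)) ->
    (forall p x, sl21_par p x ->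
       mode2 kappa (entries x) (entries_list s) = - (2 * (kappa * invform x d))) ->
  qsum s + J d *_[-2] vac = 0.
Proof.
move=> simple hs pd m1 m2.
apply: (singular_eq0 (N := 1) HJ kappa_ncrit simple (q := false)).
- apply: vparD; first exact: (qsum_par HJ).
  rewrite -[false]/(false (+) false); apply: nprod_par; last exact: vac_par.
  exact: (cur_par HJ).
- move=> a n; case: n => [[|n] _|//] //.
  apply: (@current_split _ _ _ _ _ HJ _ _ (fun=> 0)) => [x y|p x px].
    by rewrite addr0.
  rewrite nprodDr; case: n => [|[|n]].
  + rewrite (qsum_1 (y := - bracket x d) HJ px hs (m1 p x px)).
    rewrite (deriv_current HJ px 1 pd) scale0r addr0 nprod_vac.
    by rewrite -(JD HJ) addNr (J0 HJ).
  + rewrite (qsum_2 HJ px hs) (m2 p x px) (deriv_current HJ px 2 pd) subrr.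
    by rewrite nprod_vac0 add0r eqxx scaleNr addNr.
  + rewrite (qsum_ge3 HJ n px hs) (deriv_current HJ px n.+3 pd) scale0r addr0 add0r.
    rewrite (_ : n.+3%:Z - 2 = n.+1); first by rewrite nprod_vac0.
    by rewrite -[n.+3]addn2 PoszD addrK.
- rewrite nprodDr sug_qsum scalerDr; congr (_ + _).
  have := @sug_current_weight d (-2) vac 0; rewrite nprod_vac0 scale0r => -> //.
  by rewrite rmorphN sub0r opprK.
Qed.

Hypothesis vac_neq0 : vac <> 0.

Definition positive_word (v : V) :=
  exists s : seq ('I_3 * 'I_3 * nat), s <> [::] /\ v = word s.

Lemma word_sug s : sug *_[1] word s = (word_deg 0 s)%:~R *: word s.
Proof.
have := word_weight HJ kappa_ncrit 0 s (@sug_vac _ kappa _ Y J).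
by rewrite add0r.
Qed.

Lemma word_deg_size s : (size s)%:Z <= word_deg 0 s.
Proof.
elim: s => [|[[i j] k] s IH] //=.
by rewrite subr0 -add1n PoszD lerD.
Qed.

Lemma vac_notin_positive : vac \notin lspan positive_word.
Proof.
apply: (vac_notin_lspan (kappa := kappa) (J := J) vac_neq0) => _ [s [s0 ->]].
eexists; last exact: word_sug.
rewrite intr_eq0 gt_eqF // (lt_le_trans _ (word_deg_size s)) //.
by case: s s0.
Qed.

Lemma vac_component v : exists c : C, v - c *: vac \in lspan positive_word.
Proof.
apply: (words_ind HJ (P := fun v => exists c : C, v - c *: vac \in lspan positive_word)).
  split=> [|c u1 u2 [c1 h1] [c2 h2]]; first by exists 0; rewrite scale0r subr0 rpred0.
  exists (c * c1 + c2); rewrite scalerDl opprD addrACA -scalerA -scalerBr.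
  by rewrite rpredD // rpredZ.
move=> [|t s]; first by exists 1; rewrite scale1r subrr rpred0.
by exists 0; rewrite scale0r subr0; apply: lspan_gen; exists (t :: s).
Qed.

Definition vac_coef v : C := projT1 (cid (vac_component v)).

(** Two different coefficients would put a nonzero multiple of the vacuum into the span of the
    nonempty words, whose weights are positive. *)
Lemma vac_coefP v c : v - c *: vac \in lspan positive_word -> vac_coef v = c.
Proof.
rewrite /vac_coef; case: cid => c' /= h' h; apply/eqP; apply: contraT => cc.
case/negP: vac_notin_positive.
have : (c - c') *: vac \in lspan positive_word.
  have -> : (c - c') *: vac = (v - c' *: vac) - (v - c *: vac).
    by rewrite opprB [RHS]addrC addrA subrK scalerBl.
  by rewrite rpredB.
move/(rpredZ (c - c')^-1); rewrite scalerA mulVf ?scale1r //.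
by rewrite subr_eq0 eq_sym.
Qed.

Lemma vac_coef_linear c u v : vac_coef (c *: u + v) = c * vac_coef u + vac_coef v.
Proof.
apply: vac_coefP.
have hu : u - vac_coef u *: vac \in lspan positive_word by rewrite /vac_coef; case: cid.
have hv : v - vac_coef v *: vac \in lspan positive_word by rewrite /vac_coef; case: cid.
rewrite scalerDl opprD addrACA -scalerA -scalerBr.
by rewrite rpredD // rpredZ.
Qed.

Lemma vac_coef_vac : vac_coef vac = 1.
Proof. by apply: vac_coefP; rewrite scale1r subrr rpred0. Qed.

Lemma vac_coefZ c v : vac_coef (c *: v) = c * vac_coef v.
Proof.
have e0 : vac_coef 0 = 0 by apply: vac_coefP; rewrite scale0r subr0 rpred0.
by have := vac_coef_linear c v 0; rewrite e0 !addr0.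
Qed.

(** The coefficient of the vacuum vanishes on the whole image of [L(0)]: a word is multiplied by its
    degree, which is 0 for the empty word, and the other words have coefficient 0. *)
Lemma vac_coef_weight v e : sug *_[1] v = e *: v -> e != 0 -> vac_coef v = 0.
Proof.
move=> ve e0; have : vac_coef (sug *_[1] v) = 0.
  apply: (words_ind HJ (P := fun v => vac_coef (sug *_[1] v) = 0)).
    split=> [|c u1 u2 h1 h2].
      by rewrite nprod0r -[0](scale0r 0) vac_coefZ mul0r.
    by rewrite nprodDr nprodZr vac_coef_linear h1 h2 mulr0 addr0.
  move=> s; rewrite word_sug vac_coefZ.
  case: s => [|t s]; first by rewrite mul0r.
  rewrite (_ : vac_coef _ = 0) ?mulr0 //; apply: vac_coefP.
  by rewrite scale0r subr0; apply: lspan_gen; exists (t :: s).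
by rewrite ve vac_coefZ => /eqP; rewrite mulf_eq0 (negPf e0) => /eqP.
Qed.

End VacuumCoefficient.

(** * The algebra C[t1, t2] / <q1, q2> *)

Section TwoGenerators.
Variables (K : numFieldType) (B : comAlgType K) (x1 x2 : B).
Hypothesis x1_sqr : x1 * x1 = 2%:R *: (x1 * x2).
Hypothesis x2_sqr : x2 * x2 = 2%:R *: (x1 * x2).

(** [x1^2 x2 = 2 x1 x2^2 = 4 x1^2 x2] by the two relations in turn, and 3 is invertible. *)
Lemma x1_x12 : x1 * (x1 * x2) = 0.
Proof.
have e : x1 * (x1 * x2) = (2%:R * 2%:R) *: (x1 * (x1 * x2)).
  rewrite {1}mulrA x1_sqr -scalerAl -mulrA x2_sqr.
  by rewrite -(scalerAr _ x1) scalerA.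
have : (2%:R * 2%:R - 1 : K) *: (x1 * (x1 * x2)) = 0.
  by rewrite scalerBl scale1r; apply/eqP; rewrite subr_eq0; apply/eqP; exact: esym.
have -> : 2%:R * 2%:R - 1 = 3%:R :> K by ring.
by move/eqP; rewrite scaler_eq0 pnatr_eq0 => /eqP.
Qed.

Lemma x2_x12 : x2 * (x1 * x2) = 0.
Proof. by rewrite mulrCA x2_sqr -scalerAr x1_x12 scaler0. Qed.

Definition lin4 (c0 c1 c2 c3 : K) : B :=
  c0 *: 1 + c1 *: x1 + c2 *: x2 + c3 *: (x1 * x2).

Lemma lin4_linear c a0 a1 a2 a3 b0 b1 b2 b3 :
  c *: lin4 a0 a1 a2 a3 + lin4 b0 b1 b2 b3 =
  lin4 (c * a0 + b0) (c * a1 + b1) (c * a2 + b2) (c * a3 + b3).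
Proof.
rewrite /lin4 !scalerDr !scalerA addrACA -scalerDl; congr (_ + _).
by rewrite addrACA -scalerDl; congr (_ + _); rewrite addrACA -!scalerDl.
Qed.

Lemma lin4_mulr_x1 a0 a1 a2 a3 :
  x1 * lin4 a0 a1 a2 a3 = lin4 0 a0 0 (a1 * 2%:R + a2).
Proof.
rewrite /lin4 !(mulrDr x1) -!scalerAr [x1 * 1]mulr1 x1_sqr x1_x12.
by rewrite scaler0 !addr0 !scale0r add0r addr0 scalerDl -addrA scalerA.
Qed.

Lemma lin4_mulr_x2 a0 a1 a2 a3 :
  x2 * lin4 a0 a1 a2 a3 = lin4 0 0 a0 (a1 + a2 * 2%:R).
Proof.
rewrite /lin4 !(mulrDr x2) -!scalerAr [x2 * 1]mulr1 [x2 * x1]mulrC x2_sqr x2_x12.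
by rewrite scaler0 !addr0 !scale0r !add0r [(a1 + _) *: _]scalerDl scalerA addrA.
Qed.

Lemma lin4_0 : lin4 0 0 0 0 = 0.
Proof. by rewrite /lin4 !scale0r !addr0. Qed.

Lemma lin4_1 : lin4 1 0 0 0 = 1.
Proof. by rewrite /lin4 !scale0r !addr0 scale1r. Qed.

Lemma lin4_mulr_x12 a0 a1 a2 a3 : x1 * x2 * lin4 a0 a1 a2 a3 = lin4 0 0 0 a0.
Proof. by rewrite -mulrA lin4_mulr_x2 lin4_mulr_x1 !mul0r !add0r. Qed.

Lemma lin4_mul a0 a1 a2 a3 b0 b1 b2 b3 :
  lin4 a0 a1 a2 a3 * lin4 b0 b1 b2 b3 =
  lin4 (a0 * b0) (a0 * b1 + a1 * b0) (a0 * b2 + a2 * b0)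
    (a0 * b3 + a3 * b0 + (a1 * (b1 * 2%:R + b2) + a2 * (b1 + b2 * 2%:R))).
Proof.
have lin4Z c d0 d1 d2 d3 : c *: lin4 d0 d1 d2 d3 = lin4 (c * d0) (c * d1) (c * d2) (c * d3).
  by have := lin4_linear c d0 d1 d2 d3 0 0 0 0; rewrite lin4_0 !addr0.
have lin4D d0 d1 d2 d3 e0 e1 e2 e3 :
    lin4 d0 d1 d2 d3 + lin4 e0 e1 e2 e3 = lin4 (d0 + e0) (d1 + e1) (d2 + e2) (d3 + e3).
  by have := lin4_linear 1 d0 d1 d2 d3 e0 e1 e2 e3; rewrite scale1r !mul1r.
rewrite {1}/lin4 !mulrDl -!scalerAl mul1r lin4_mulr_x1 lin4_mulr_x2 lin4_mulr_x12.
by rewrite !lin4Z !lin4D; congr lin4; ring.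
Qed.

End TwoGenerators.

Section Independence.
Variables (K : numFieldType) (P : comAlgType K) (D0 D1 : {linear P -> P}).
Variables (ev : {rmorphism P -> K}) (X Y : P).
Hypothesis D0M : forall g h, D0 (g * h) = D0 g * h + g * D0 h.
Hypothesis D1M : forall g h, D1 (g * h) = D1 g * h + g * D1 h.
Hypothesis D0X : D0 X = 1.
Hypothesis D0Y : D0 Y = 0.
Hypothesis D1X : D1 X = 0.
Hypothesis D1Y : D1 Y = 1.
Hypothesis evZ : forall c g, ev (c *: g) = c * ev g.
Hypothesis evX : ev X = 0.
Hypothesis evY : ev Y = 0.

Lemma derivation1 (D : {linear P -> P}) :
  (forall g h, D (g * h) = D g * h + g * D h) -> D 1 = 0.
Proof.
move=> DM; have := DM 1 1; rewrite !mulr1 mul1r => h.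
by apply: (addIr (D 1)); rewrite add0r -h.
Qed.

(** [D0], [D1] and [ev] stand for the partial derivatives and the evaluation at the origin. The
    right-hand side vanishes there to second order, which settles the first three coefficients. *)
Lemma lin4_independent c0 c1 c2 c3 a b :
  lin4 X Y c0 c1 c2 c3 = a * (X * (X - 2 * Y)) + b * (Y * (Y - 2 * X)) ->
  [/\ c0 = 0, c1 = 0, c2 = 0 & c3 = 0].
Proof.
have D01 := derivation1 D0M; have D11 := derivation1 D1M.
have D00 : D0 0 = 0 by exact: linear0.
have D10 : D1 0 = 0 by exact: linear0.
have D0D g h : D0 (g + h) = D0 g + D0 h by exact: linearD.
have D1D g h : D1 (g + h) = D1 g + D1 h by exact: linearD.
have D0N g : D0 (- g) = - D0 g by exact: linearN.
have D1N g : D1 (- g) = - D1 g by exact: linearN.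
have D0Z c g : D0 (c *: g) = c *: D0 g by exact: linearZ_LR.
have D1Z c g : D1 (c *: g) = c *: D1 g by exact: linearZ_LR.
have evD g h : ev (g + h) = ev g + ev h by exact: rmorphD.
have evN g : ev (- g) = - ev g by exact: rmorphN.
have evM g h : ev (g * h) = ev g * ev h by exact: rmorphM.
have ev1 : ev 1 = 1 by exact: rmorph1.
have ev0 : ev 0 = 0 by exact: rmorph0.
have D0E := (D0X, D0Y, D01, D00, D0D, D0N, D0Z, D0M).
have D1E := (D1X, D1Y, D11, D10, D1D, D1N, D1Z, D1M).
have evE := (evX, evY, ev1, ev0, evD, evN, evZ, evM).
rewrite /lin4 -[2 : P]/(1 + 1) !mulrDl !mul1r => fE.
(* On [X^2], [X Y], [Y^2] the functional takes the values 2, 1, 2, so it kills [X^2 - 2 X Y] and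
   [Y^2 - 2 X Y]. As these have no terms of degree below 2, it also kills their multiples. *)
pose L g := ev (D0 (D0 g)) + ev (D1 (D1 g)) + ev (D0 (D1 g)).
split.
- by have := congr1 ev fE; rewrite !evE => h; ring: h.
- by have := congr1 (ev \o D0) fE; rewrite /= !D0E !evE => h; ring: h.
- by have := congr1 (ev \o D1) fE; rewrite /= !D1E !evE => h; ring: h.
- have := congr1 L fE; rewrite /L !(D0E, D1E) !evE => h; ring: h.
Qed.

End Independence.

From mathcomp Require Import mpoly.

Section QuotientAlgebraBasis.
Variable R : realType.
Local Notation C := R[i].
Local Notation P := {mpoly C[2]}.
Local Notation x1 := (qproj (t1 R)).
Local Notation x2 := (qproj (t2 R)).

Lemma qproj_eq0 (f : P) : qproj f = 0 <-> exists a b : P, f = a * q1 R + b * q2 R.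
Proof.
have -> : (qproj f = 0) = (f \in @q_ideal R : Prop).
  rewrite -[f in RHS]subr0 Quotient.idealrBE /qproj.
  apply/propext; split=> [/= h|/eqP ->]; last exact: rmorph0.
  by apply/eqP; rewrite h rmorph0.
by split=> [/asboolP|h]; last exact/asboolP.
Qed.

Lemma qprojZ (c : C) (f : P) : qproj (c *: f) = c *: qproj f.
Proof. by rewrite -mul_mpolyC qprojM. Qed.

Lemma qprojB (f g : P) : qproj (f - g) = qproj f - qproj g.
Proof. exact: (raddfB \pi_{ideal_quot @q_ideal R}%qT). Qed.

Lemma qproj_eq (f g : P) : (exists a b : P, f - g = a * q1 R + b * q2 R) ->
  qproj f = qproj g.
Proof.
by move/qproj_eq0; rewrite qprojB => h; apply: (addIr (- qproj g)); rewrite subrr.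
Qed.

Lemma qalg_x1_sqr : x1 * x1 = 2%:R *: (x1 * x2).
Proof.
rewrite -!qprojM -qprojZ; apply: qproj_eq.
exists 1, 0; rewrite mul1r mul0r addr0 /q1 scaler_nat; ring.
Qed.

Lemma qalg_x2_sqr : x2 * x2 = 2%:R *: (x1 * x2).
Proof.
rewrite -!qprojM -qprojZ; apply: qproj_eq.
exists 0, 1; rewrite mul1r mul0r add0r /q2 scaler_nat; ring.
Qed.

Local Notation qlin := (lin4 x1 x2).

(** The span of [1, x1, x2, x1 x2] contains 1 and is stable under multiplication by both variables,
    hence contains every monomial. *)
Lemma qlin_span (y : qalg R) : exists c0 c1 c2 c3, y = qlin c0 c1 c2 c3.
Proof.
have [f <-] : exists f, qproj f = y.
  by exists (generic_quotient.repr y); exact: generic_quotient.reprK.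
pose Q (f : P) := exists c0 c1 c2 c3, qproj f = qlin c0 c1 c2 c3.
have Q0 : Q 0.
  by exists 0, 0, 0, 0; rewrite lin4_0; apply/qproj_eq0; exists 0, 0; rewrite !mul0r addr0.
have Qlin c g h : Q g -> Q h -> Q (c *: g + h).
  move=> [a0 [a1 [a2 [a3 eg]]]] [b0 [b1 [b2 [b3 eh]]]].
  by do 4 eexists; rewrite qprojD qprojZ eg eh lin4_linear.
have Q1 : Q 1 by exists 1, 0, 0, 0; rewrite lin4_1 qproj1.
have QX (i : 'I_2) g : Q g -> Q ('X_i * g).
  move=> [a0 [a1 [a2 [a3 eg]]]].
  have [->|->] : i = ord0 \/ i = ord_max.
    by case: i => [[|[|//]] lt_i]; [left | right]; apply: val_inj.
  - do 4 eexists; rewrite qprojM eg.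
    exact: (lin4_mulr_x1 qalg_x1_sqr qalg_x2_sqr).
  - do 4 eexists; rewrite qprojM eg.
    exact: (lin4_mulr_x2 qalg_x1_sqr qalg_x2_sqr).
suff: Q f by [].
elim/mpolyind: f => [//|c m f _ _]; apply: Qlin.
rewrite mpolyXE_id -[\prod_(_ < _) _]mulr1; elim/big_rec: _ => [|i g _ Qg].
  by rewrite mulr1.
elim: (m i) => [|k IH]; first by rewrite expr0 mul1r.
by rewrite exprS -!mulrA in IH *; exact: QX.
Qed.

Lemma mderiv_var (i j : 'I_2) : mderiv i ('X_j : P) = (i == j)%:R.
Proof.
rewrite mderivX mnm1E eq_sym; case: eqP => [->|_]; last by rewrite scale0r.
rewrite (_ : (U_(j) - U_(j))%MM = 0%MM) ?mpolyX0 ?scale1r //.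
by apply/mnmP => k; rewrite mnmBE subnn mnm0E.
Qed.

(* The second-order functional below kills [q1] and [q2], and detects the
   coefficient of [t1 t2]. *)
Lemma qlin_inj c0 c1 c2 c3 : qlin c0 c1 c2 c3 = 0 ->
  [/\ c0 = 0, c1 = 0, c2 = 0 & c3 = 0].
Proof.
have -> : qlin c0 c1 c2 c3 =
    qproj (c0 *: 1 + c1 *: t1 R + c2 *: t2 R + c3 *: (t1 R * t2 R)).
  by rewrite !qprojD !qprojZ qprojM qproj1.
case/qproj_eq0 => a [b]; set f := _ + _ => fE.
have [] := @lin4_independent _ P (mderiv ord0) (mderiv ord_max) (mpoly.meval (fun=> 0))
  (t1 R) (t2 R) _ _ _ _ _ _ _ _ _ c0 c1 c2 c3 a b fE => //.
- exact: mderivM.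
- exact: mderivM.
- exact: mderiv_var.
- exact: mderiv_var.
- exact: mderiv_var.
- exact: mderiv_var.
- by move=> c g; exact: mevalZ.
- exact: mevalXU.
- exact: mevalXU.
Qed.

End QuotientAlgebraBasis.

(** * The map psi *)

Section DualOperator.
Variables (R : realType) (kappa : R[i]) (V : lmodType R[i]).
Variables (Y : vertexSuperalgebra V) (J : sl21 R -> V).
Hypothesis HJ : affine_currents kappa Y J.
Local Notation C := R[i].
Local Notation "a *_[ n ] b" := (nprod Y a n b)
  (at level 39, n at level 99, left associativity, format "a  *_[ n ]  b").
Local Notation vac := (vac Y).
Implicit Types (a b d : sl21 R) (p q : bool).

Fixpoint dual_op (s : seq (C * bool * sl21 R * sl21 R)) (v : V) : V :=
  if s is (c, _, a, b) :: s' then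
    c *: (J a *_[1] (J b *_[1] v)) + dual_op s' v
  else 0.

Lemma dual_op_linear s c u v :
  dual_op s (c *: u + v) = c *: dual_op s u + dual_op s v.
Proof.
elim: s => [|[[[e q] a] b] s IH] /=; first by rewrite scaler0 addr0.
rewrite IH !nprodDr !nprodZr !scalerDr !scalerA [e * c]mulrC.
by rewrite addrACA.
Qed.

Fixpoint dual_quad9 p (ta tb : t9 R) (s : seq (C * bool * t9 R * t9 R)) : C :=
  if s is (c, q, x, y) :: s' then
    c * (kappa * form9 x (add9 (add9 (bracket9 (bracket9 y ta) tb)
      (scale9 (kappa * form9 y ta) tb))
      (scale9 ((-1) ^+ (q && p) * (kappa * form9 y tb)) ta))) + dual_quad9 p ta tb s'
  else 0.

Fixpoint dual_deriv9 (td : t9 R) (s : seq (C * bool * t9 R * t9 R)) : C :=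
  if s is (c, _, x, y) :: s' then
    c * (kappa * form9 x (bracket9 y td)) + dual_deriv9 td s'
  else 0.

(** The inner mode 1 turns the quadratic vector into a current, the outer one turns that current
    into a multiple of the vacuum. *)
Lemma dual_op_quad p a b s : sl21_par p a -> homogeneous s ->
  dual_op s (quad Y J a b) =
  dual_quad9 p (entries a) (entries b) (entries_list s) *: vac.
Proof.
move=> pa; elim: s => [|[[[c q] x] y] s IH] hs; first by rewrite scale0r.
cbn [dual_op dual_quad9 dual_deriv9 entries_list].
have [_ qy hs'] := hs; rewrite (IH hs') (quad_1 HJ _ qy pa).
rewrite -!(JZ HJ) -!(JD HJ) (cur_prod1 HJ) scalerA -scalerDl; congr ((_ * (_ * _) + _) *: _).
apply: etrans (entries_form _ _) _; congr (form9 _ _).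
apply: etrans (entriesD _ _) _; congr add9.
  apply: etrans (entriesD _ _) _; congr add9.
    apply: etrans (entries_bracket _ _) _; congr bracket9.
    exact: entries_bracket.
  by apply: etrans (entriesZ _ _) _; rewrite entries_form.
by apply: etrans (entriesZ _ _) _; rewrite entries_form.
Qed.

Lemma dual_op_deriv p d s : sl21_par p d -> homogeneous s ->
  dual_op s (J d *_[-2] vac) = dual_deriv9 (entries d) (entries_list s) *: vac.
Proof.
move=> pd; elim: s => [|[[[c q] x] y] s IH] hs; first by rewrite scale0r.
cbn [dual_op dual_quad9 dual_deriv9 entries_list].
have [_ qy hs'] := hs; rewrite (IH hs') (deriv_current HJ qy 1 pd) scale0r addr0.
rewrite nprod_vac (cur_prod1 HJ) scalerA -scalerDl; congr ((_ * (_ * _) + _) *: _).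
by apply: etrans (entries_form _ _) _; congr (form9 _ _); exact: entries_bracket.
Qed.

End DualOperator.

Section DualTop.
Variable R : realType.
Local Notation C := R[i].
Implicit Types (a b d : sl21 R).

Definition dual_top9 : seq (C * bool * t9 R * t9 R) :=
  [:: (4, false, h1_9 R, h1_9 R); (-12, false, h1_9 R, h2_9 R);
      (4, false, h2_9 R, h2_9 R); (-8, false, e12_9 R, f12_9 R);
      (8, true, e1_9 R, f1_9 R); (8, true, e2_9 R, f2_9 R)].

Lemma dual_top_entries : entries_list (dual_top R) = dual_top9.
Proof. by rewrite /dual_top; entries_simpl. Qed.

Lemma dual_top_homogeneous : homogeneous (dual_top R).
Proof.
rewrite /=; do !split; first [exact: par_h1 | exact: par_h2 | exact: par_e12
  | exact: par_f12 | exact: par_e1 | exact: par_e2 | exact: par_f1 | exact: par_f2].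
Qed.

(** The diagonal part of [a] is [a_00 h_1 - a_11 h_2]. This is the coefficient of [t_1 t_2] in
    [(a_00 t_1 - a_11 t_2) (b_00 t_1 - b_11 t_2)] after substituting [t_1^2 = t_2^2 = 2 t_1 t_2]. *)
Definition top_form a b : C :=
  let o0 := ord0 in let o1 := lift ord0 ord0 in
  2 * (a o0 o0 * b o0 o0 + a o1 o1 * b o1 o1) - (a o0 o0 * b o1 o1 + a o1 o1 * b o0 o0).

Lemma dual_top_quad9 kappa p a b : kappa = - (1 / 2) -> sl21_par p a ->
  dual_quad9 kappa p (entries a) (entries b) (entries_list (dual_top R)) = top_form a b.
Proof.
rewrite dual_top_entries => -> /entries_homogeneous[x [y [z [t ea]]]].
have [b0 [b1 [b2 [b3 [b4 [b5 [b6 [b7 eb]]]]]]]] := entries_sl21 b.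
rewrite /top_form !pick9E ea eb.
by case: p {ea}; rewrite /= ?expr0 ?expr1; field.
Qed.

Lemma dual_top_deriv9 kappa p d : kappa = - (1 / 2) -> sl21_par p d ->
  dual_deriv9 kappa (entries d) (entries_list (dual_top R)) = 0.
Proof.
rewrite dual_top_entries => -> /entries_homogeneous[x [y [z [t ->]]]].
by case: p; rewrite /=; field.
Qed.

End DualTop.

Section Psi.
Variables (R : realType) (V : lmodType R[i]).
Local Notation C := R[i].
Variables (kappa : C) (kappaE : kappa = - (1 / 2)).
Variables (Y : vertexSuperalgebra V) (J : sl21 R -> V).
Hypothesis HJ : affine_currents kappa Y J.
Local Notation "a *_[ n ] b" := (nprod Y a n b)
  (at level 39, n at level 99, left associativity, format "a  *_[ n ]  b").
Local Notation vac := (vac Y).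
Local Notation sug := (sug kappa Y J).
Local Notation word := (word Y J 0 vac).
Local Notation letter := (letter R).
Implicit Types (a b d : sl21 R) (p q : bool).
Hypothesis vac_neq0 : vac <> 0.
Variables (B : comAlgType C) (x1 x2 : B).
Hypothesis x1_sqr : x1 * x1 = 2%:R *: (x1 * x2).
Hypothesis x2_sqr : x2 * x2 = 2%:R *: (x1 * x2).

Lemma ncrit : kappa + 1 != 0.
Proof.
rewrite kappaE (_ : - (1 / 2) + 1 = 2^-1 :> C); first by rewrite invr_eq0 pnatr_eq0.
by field.
Qed.

Local Notation eps := (vac_coef HJ).

Let eps_linear := vac_coef_linear HJ ncrit vac_neq0.
Let epsZ := vac_coefZ HJ ncrit vac_neq0.
Let eps_eigen := vac_coef_weight HJ ncrit vac_neq0.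

Definition psi1 v : C := eps (-2 *: (J (h2 R) *_[1] v)).
Definition psi2 v : C := eps (-2 *: (J (h1 R) *_[1] v)).
Definition psi3 v : C := eps (dual_op Y J (dual_top R) v).
Definition psi v : B := lin4 x1 x2 (eps v) (psi1 v) (psi2 v) (psi3 v).

Lemma psi_linear c u v : psi (c *: u + v) = c *: psi u + psi v.
Proof.
rewrite /psi lin4_linear; congr lin4.
- exact: eps_linear.
- by rewrite /psi1 nprodDr nprodZr scalerDr scalerA [-2 * c]mulrC -scalerA eps_linear.
- by rewrite /psi2 nprodDr nprodZr scalerDr scalerA [-2 * c]mulrC -scalerA eps_linear.
- by rewrite /psi3 dual_op_linear eps_linear.
Qed.

Section Weight.
Variables (n : int) (v : V).
Hypothesis vn : sug *_[1] v = n%:~R *: v.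

Lemma eps_weight : n != 0 -> eps v = 0.
Proof. by move=> n0; apply: (eps_eigen vn); rewrite intr_eq0. Qed.

Lemma psi1_weight : n != 1 -> psi1 v = 0.
Proof.
move=> n1; rewrite /psi1 epsZ; apply/eqP; rewrite mulf_eq0; apply/orP; right.
apply/eqP; apply: (eps_eigen (sug_current_weight HJ ncrit _ 1 vn)).
by rewrite subr_eq0 -[1%:~R]/(1%:~R : C) eqr_int.
Qed.

Lemma psi2_weight : n != 1 -> psi2 v = 0.
Proof.
move=> n1; rewrite /psi2 epsZ; apply/eqP; rewrite mulf_eq0; apply/orP; right.
apply/eqP; apply: (eps_eigen (sug_current_weight HJ ncrit _ 1 vn)).
by rewrite subr_eq0 -[1%:~R]/(1%:~R : C) eqr_int.
Qed.

Lemma psi3_weight : n != 2 -> psi3 v = 0.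
Proof.
move=> n2; have h s : sug *_[1] dual_op Y J s v = (n - 2)%:~R *: dual_op Y J s v.
  elim: s => [|[[[c q] a] b] s IH] /=; first by rewrite nprod0r scaler0.
  rewrite nprodDr nprodZr IH scalerDr; congr (_ + _); rewrite [RHS]scalerA [_ * c]mulrC -scalerA.
  congr (_ *: _); have := sug_current_weight HJ ncrit b 1 vn.
  move/(sug_current_weight HJ ncrit a 1) => ->; congr (_ *: _).
  by rewrite rmorphB /=; ring.
by apply: (eps_eigen (h _)); rewrite intr_eq0 subr_eq0.
Qed.

End Weight.

Lemma psi_vac : psi vac = 1.
Proof.
have v0 : sug *_[1] vac = 0%:~R *: vac by rewrite scale0r nprod_vac0.
rewrite /psi (vac_coef_vac HJ ncrit vac_neq0) (psi1_weight v0) // (psi2_weight v0) //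
  (psi3_weight v0) //.
exact: lin4_1.
Qed.

Lemma eps_vacZ c : eps (c *: vac) = c.
Proof. by rewrite epsZ (vac_coef_vac HJ ncrit vac_neq0) mulr1. Qed.

Lemma psi_J a : psi (J a) =
  lin4 x1 x2 0 (a ord0 ord0) (- a (lift ord0 ord0) (lift ord0 ord0)) 0.
Proof.
have vn : sug *_[1] J a = 1%:~R *: J a by rewrite (sug_J HJ ncrit).
rewrite /psi (eps_weight vn) // (psi3_weight vn) // /psi1 /psi2 !(cur_prod1 HJ).
have e1 : -2 * (kappa * invform (h2 R) a) = a ord0 ord0.
  rewrite kappaE entries_form entries_h2 pick9E.
  have [b0 [b1 [b2 [b3 [b4 [b5 [b6 [b7 ->]]]]]]]] := entries_sl21 a.
  by rewrite /=; field.
have e2 : -2 * (kappa * invform (h1 R) a) = - a (lift ord0 ord0) (lift ord0 ord0).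
  rewrite kappaE entries_form entries_h1 pick9E.
  have [b0 [b1 [b2 [b3 [b4 [b5 [b6 [b7 ->]]]]]]]] := entries_sl21 a.
  by rewrite /=; field.
by rewrite !scalerA e1 e2 !eps_vacZ.
Qed.

Lemma psi_quad a b : psi (quad Y J a b) = lin4 x1 x2 0 0 0 (top_form a b).
Proof.
have vn : sug *_[1] quad Y J a b = 2%:~R *: quad Y J a b by rewrite (sug_quad HJ ncrit).
rewrite /psi (eps_weight vn) // (psi1_weight vn) // (psi2_weight vn) //; congr lin4.
have [a0 [a1 [p0 p1 ->]]] := sl21_split a.
have eD u v : eps (u + v) = eps u + eps v.
  by have := eps_linear 1 u v; rewrite !scale1r mul1r.
have dD u v : dual_op Y J (dual_top R) (u + v) =
    dual_op Y J (dual_top R) u + dual_op Y J (dual_top R) v.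
  by have := dual_op_linear Y J (dual_top R) 1 u v; rewrite !scale1r.
rewrite (quadDl HJ) /psi3 dD eD.
rewrite (dual_op_quad HJ _ p0 (dual_top_homogeneous R)).
rewrite (dual_op_quad HJ _ p1 (dual_top_homogeneous R)).
rewrite !eps_vacZ (dual_top_quad9 _ kappaE p0) (dual_top_quad9 _ kappaE p1).
by rewrite /top_form sl21_valD !mxE; ring.
Qed.

Lemma psi_deriv d : psi (J d *_[-2] vac) = 0.
Proof.
have vn : sug *_[1] (J d *_[-2] vac) = 2%:~R *: (J d *_[-2] vac).
  have v0 : sug *_[1] vac = 0 *: vac by rewrite scale0r nprod_vac0.
  by rewrite (sug_current_weight HJ ncrit d (-2) v0) rmorphN sub0r opprK.
rewrite /psi (eps_weight vn) // (psi1_weight vn) // (psi2_weight vn) //.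
rewrite -[RHS](lin4_0 x1 x2); congr lin4.
have [d0 [d1 [p0 p1 ->]]] := sl21_split d.
have := dual_op_linear Y J (dual_top R) 1 (J d0 *_[-2] vac) (J d1 *_[-2] vac).
rewrite !scale1r -nprodDl -(JD HJ) /psi3 => ->.
rewrite (dual_op_deriv HJ p0 (dual_top_homogeneous R)).
rewrite (dual_op_deriv HJ p1 (dual_top_homogeneous R)).
rewrite (dual_top_deriv9 kappaE p0) (dual_top_deriv9 kappaE p1) -scalerDl addr0.
exact: eps_vacZ.
Qed.

Lemma psi_high n v : sug *_[1] v = n%:~R *: v -> 3 <= n -> psi v = 0.
Proof.
move=> vn le3n; rewrite /psi (eps_weight vn) ?(psi1_weight vn) ?(psi2_weight vn)
  ?(psi3_weight vn) ?lin4_0 //; by rewrite gt_eqF // (lt_le_trans _ le3n).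
Qed.

Lemma word_high s : 3 <= word_deg 0 s -> psi (word s) = 0.
Proof. by apply: psi_high; exact: (word_sug HJ ncrit). Qed.

Lemma word_deg_pos t s : 1 <= word_deg 0 (t :: s).
Proof. by apply: le_trans (word_deg_size _); rewrite lez_nat. Qed.

Lemma word_short t s : word_deg 0 (t :: s) < 2 ->
  exists i j, t :: s = [:: (i, j, 0%N)].
Proof.
case: t => [[i j] k] lt2; exists i, j; case: s => [|t s] in lt2 *.
  by move: lt2; rewrite /= addr0 subr0 ltz_nat ltnS; case: k.
by have := le_lt_trans (word_deg_size _) lt2; rewrite ltz_nat.
Qed.

Lemma psi_words u v : psi (word u *_[-1] word v) = psi (word u) * psi (word v).
Proof.
case: u => [|t u]; first by rewrite vac_nprod eqxx psi_vac mul1r.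
case: v => [|t' v]; first by rewrite nprod_vac psi_vac mulr1.
set a := word (t :: u); set b := word (t' :: v).
set m := word_deg 0 (t :: u); set n := word_deg 0 (t' :: v).
have am : sug *_[1] a = m%:~R *: a by exact: (word_sug HJ ncrit).
have bn : sug *_[1] b = n%:~R *: b by exact: (word_sug HJ ncrit).
have m1 : 1 <= m by exact: word_deg_pos.
have n1 : 1 <= n by exact: word_deg_pos.
have abw : sug *_[1] (a *_[-1] b) = (m + n)%:~R *: (a *_[-1] b).
  rewrite (conformal_weight_nprod (-1) (sug_par HJ) (sug_translation HJ ncrit) am bn).
  by rewrite rmorphN addNr subr0 rmorphD.
(* The product has weight at least 3, so the left side is 0. On the right, one factor is a multiple
   of [x1 x2] and the other has no constant term, so their product is 0 as well. *)
have [m2|m2] := leP 2 m.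
  rewrite (psi_high abw); last by apply: (lerD m2 n1).
  rewrite /psi lin4_mul // (eps_weight am) ?(eps_weight bn) ?(psi1_weight am) ?(psi2_weight am).
  - by rewrite !mul0r !mulr0 !addr0 lin4_0.
  - by rewrite gt_eqF // (lt_le_trans _ m2).
  - by rewrite gt_eqF // (lt_le_trans _ m2).
  - by rewrite gt_eqF // (lt_le_trans _ n1).
  - by rewrite gt_eqF // (lt_le_trans _ m1).
have [n2|n2] := leP 2 n.
  rewrite (psi_high abw); last by apply: (lerD m1 n2).
  rewrite /psi lin4_mul // (eps_weight am) ?(eps_weight bn) ?(psi1_weight bn) ?(psi2_weight bn).
  - by rewrite !(mul0r, mulr0, addr0) lin4_0.
  - by rewrite gt_eqF // (lt_le_trans _ n2).
  - by rewrite gt_eqF // (lt_le_trans _ n2).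
  - by rewrite gt_eqF // (lt_le_trans _ n1).
  - by rewrite gt_eqF // (lt_le_trans _ m1).
have [i [j euj]] := word_short m2; have [k [l evl]] := word_short n2.
have aE : a = J (letter i j) by rewrite /a euj /= nprod_vac.
have bE : b = J (letter k l) by rewrite /b evl /= nprod_vac.
rewrite aE bE -/(quad Y J _ _) psi_quad !psi_J lin4_mul //; congr lin4; rewrite /top_form; ring.
Qed.

Lemma psi0 : psi 0 = 0.
Proof.
by apply: (@addrI _ (psi 0)); rewrite -{1}[psi 0]scale1r -psi_linear scale1r !addr0.
Qed.

Lemma psiZ c v : psi (c *: v) = c *: psi v.
Proof. by have := psi_linear c v 0; rewrite psi0 !addr0. Qed.

Lemma psiD u v : psi (u + v) = psi u + psi v.
Proof. by have := psi_linear 1 u v; rewrite !scale1r. Qed.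

Lemma psi_mul (a b : V) : psi (a *_[-1] b) = psi a * psi b.
Proof.
move: a b; apply: (words_ind HJ (P := fun u => forall v, psi (u *_[-1] v) = psi u * psi v)).
  split=> [b|c u v hu hv b]; first by rewrite nprod0l psi0 mul0r.
  by rewrite nprodDl nprodZl !psi_linear hu hv (mulrDl (c *: psi u)) scalerAl.
move=> s; apply: (words_ind HJ (P := fun v => psi (word s *_[-1] v) = psi (word s) * psi v));
  last exact: psi_words.
split=> [|c u v hu hv]; first by rewrite nprod0r psi0 mulr0.
by rewrite nprodDr nprodZr !psi_linear hu hv (mulrDr _ (c *: psi u)) scalerAr.
Qed.

Lemma psi_words_deriv u v : psi (word u *_[-2] word v) = 0.
Proof.
case: u => [|t u]; first by rewrite vac_nprod psi0.
set a := word (t :: u); set m := word_deg 0 (t :: u).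
have am : sug *_[1] a = m%:~R *: a by exact: (word_sug HJ ncrit).
have m1 : 1 <= m by exact: word_deg_pos.
have bn := word_sug HJ ncrit v.
have abw : sug *_[1] (a *_[-2] word v) = (m + word_deg 0 v + 1)%:~R *: (a *_[-2] word v).
  rewrite (conformal_weight_nprod (-2) (sug_par HJ) (sug_translation HJ ncrit) am bn).
  by congr (_ *: _); rewrite !rmorphD rmorphN /=; ring.
case: v => [|t' v] in bn abw *; last first.
  apply: (psi_high abw); apply: (@lerD _ 2 _ 1) => //.
  by apply: lerD => //; exact: word_deg_pos.
have [m2|m2] := leP 2 m.
  by apply: (psi_high abw); rewrite addr0; exact: (lerD m2 (lexx 1)).
have [i [j euj]] := word_short m2.
by rewrite /a euj /= nprod_vac psi_deriv.
Qed.

Lemma psi_deriv_mul (a b : V) : psi (a *_[-2] b) = 0.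
Proof.
move: a b; apply: (words_ind HJ (P := fun u => forall v, psi (u *_[-2] v) = 0)).
  split=> [b|c u v hu hv b]; first by rewrite nprod0l psi0.
  by rewrite nprodDl nprodZl !psi_linear hu hv scaler0 addr0.
move=> s; apply: (words_ind HJ (P := fun v => psi (word s *_[-2] v) = 0));
  last exact: psi_words_deriv.
split=> [|c u v hu hv]; first by rewrite nprod0r psi0.
by rewrite nprodDr nprodZr !psi_linear hu hv scaler0 addr0.
Qed.

Definition neutral (s : seq ('I_3 * 'I_3 * nat)) := all (fun t => t.1.1 == t.1.2) s.

Lemma letter_diag0 i j (k : 'I_3) : i != j -> letter i j k k = 0.
Proof.
move=> ij; rewrite /= !mxE str_delta_neq // mul0r addr0.
by have [->|ki] := eqVneq k i; rewrite /= ?(negPf ij).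
Qed.

(** Odd words and words of nonintegral shifted weight both contain an off-diagonal letter, so this
    serves both cases. It also covers words of charge 0 such as [e_12(-1) f_12(-1) 1], which
    [dual_top] was chosen to kill. *)
Lemma psi_not_neutral s : ~~ neutral s -> psi (word s) = 0.
Proof.
case: s => [//|t s]; have [le2|lt2] := leP 2 (word_deg 0 (t :: s)); last first.
  have [i [j ->]] := word_short lt2; rewrite /= andbT => ij.
  by rewrite nprod_vac psi_J !letter_diag0 // oppr0 lin4_0.
have [/word_high //|lt3] := leP 3 (word_deg 0 (t :: s)).
case: t => [[i j] k] in lt3 le2 *; case: s => [|[[i' j'] k'] s] in lt3 le2 *.
  have -> : k = 1%N.
    by move: le2 lt3; rewrite /= addr0 subr0 !ltz_nat lez_nat; case: k => [|[|]].
  by move=> _; rewrite /= psi_deriv.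
have s0 : s = [::].
  by have := le_lt_trans (word_deg_size _) lt3; rewrite ltz_nat; case: s {lt3 le2}.
have [-> ->] : k = 0%N /\ k' = 0%N.
  by move: lt3; rewrite s0 /= addr0 !subr0 -PoszD ltz_nat addSn addnS !ltnS leqn0 addn_eq0;
    case/andP=> /eqP-> /eqP->.
rewrite s0 /= andbT nprod_vac -/(quad Y J _ _) psi_quad => nn.
suff -> : top_form (letter i j) (letter i' j') = 0 by rewrite lin4_0.
rewrite /top_form; move: nn; rewrite negb_and => /orP[] h.
  by rewrite !(letter_diag0 _ h) !mul0r !addr0 mulr0 subrr.
by rewrite !(letter_diag0 _ h) !mulr0 !addr0 mulr0 subrr.
Qed.

End Psi.

(** * The shifted conformal vector and C_2 *)

Section ShiftedWeights.
Variables (R : realType) (kappa : R[i]) (V : lmodType R[i]).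
Variables (Y : vertexSuperalgebra V) (J : sl21 R -> V).
Hypothesis HJ : affine_currents kappa Y J.
Hypothesis kappa_ncrit : kappa + 1 != 0.
Variable xi : rat.
Local Notation C := R[i].
Local Notation "a *_[ n ] b" := (nprod Y a n b)
  (at level 39, n at level 99, left associativity, format "a  *_[ n ]  b").
Local Notation vac := (vac Y).
Local Notation sug := (sug kappa Y J).
Local Notation word := (word Y J 0 vac).
Local Notation letter := (letter R).

(* [omega_xi]: by [sug_translation], the mode 0 of [sug] is [L(-1)]. *)
Definition shifted : V := sug + (ratr xi / 2) *: (sug *_[0] J (hplus R)).

Local Notation w := shifted.

Lemma par_hplus : sl21_par false (hplus R).
Proof.
apply/matrixP => i j; rewrite /hplus mxE sl21_valD.
have /matrixP/(_ i j) := par_h1 R; have /matrixP/(_ i j) := par_h2 R.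
by rewrite !mxE; case: ifP => // _ <- <-; rewrite addr0.
Qed.

Lemma shifted_par : vpar Y false w.
Proof.
apply: vparD; first exact: (sug_par HJ).
apply: vparZ; rewrite -[false]/(false (+) false); apply: nprod_par.
  exact: (sug_par HJ).
by apply: (cur_par HJ); exact: par_hplus.
Qed.

(** The correction term of the conformal vector is a derivative, and mode 0 of a derivative is 0; in
    the next lemma, mode 1 of a derivative is minus mode 0. *)
Lemma shifted_translation v : w *_[0] v = v *_[-2] vac.
Proof.
rewrite /shifted nprodDl (nprodZl _ _ _ (ratr xi / 2)) !(sug_translation HJ kappa_ncrit).
by rewrite nprod_derivative oppr0 scale0r scaler0 addr0.
Qed.

Lemma shifted_mode1 v :
  w *_[1] v = sug *_[1] v - (ratr xi / 2) *: (J (hplus R) *_[0] v).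
Proof.
rewrite /shifted nprodDl (nprodZl _ _ _ (ratr xi / 2)) (sug_translation HJ kappa_ncrit).
by rewrite nprod_derivative subrr scaleN1r scalerN.
Qed.

Fixpoint word_charge (s : seq ('I_3 * 'I_3 * nat)) : int :=
  if s is (i, j, _) :: s' then charge i j + word_charge s' else 0.

Lemma word_hplus s : J (hplus R) *_[0] word s = (word_charge s)%:~R *: word s.
Proof.
elim: s => [|[[i j] k] s IH] /=; first by rewrite nprod_vac0 scale0r.
rewrite (current_commutator HJ _ _ _ par_hplus (letter_par R i j)) expr0 scale1r.
rewrite (_ : (0 + (0 - k.+1%:Z) == 0) = false) // scale0r addr0 !add0r IH nprodZr.
rewrite bracket_hplus (JZ HJ) nprodZl.
by rewrite -scalerDl (intrD _ (charge i j) (word_charge s)) addrC.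
Qed.

Definition word_wt s : rat := (word_deg 0 s)%:~R - xi / 2 * (word_charge s)%:~R.

Lemma word_weight_shifted s : weight Y w (word_wt s) (word s).
Proof.
rewrite /weight shifted_mode1 (word_sug HJ kappa_ncrit) word_hplus scalerA -scalerBl.
congr (_ *: _).
have rB (x y : rat) : ratr (x - y) = ratr x - ratr y :> C by exact: rmorphB.
have rM (x y : rat) : ratr (x * y) = ratr x * ratr y :> C by exact: rmorphM.
have r2 : ratr 2^-1 = 2^-1 :> C by rewrite fmorphV rmorph_nat.
by rewrite /word_wt rB !rM r2 !ratr_int.
Qed.

Lemma weight_nprod a b n r s : weight Y w r a -> weight Y w s b ->
  weight Y w (r + s - (n%:~R + 1)) (a *_[n] b).
Proof.
move=> wa wb; rewrite /weight.
rewrite (conformal_weight_nprod n shifted_par shifted_translation wa wb).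
have rB (x y : rat) : ratr (x - y) = ratr x - ratr y :> C by exact: rmorphB.
have rD (x y : rat) : ratr (x + y) = ratr x + ratr y :> C by exact: rmorphD.
by rewrite rB !rD rmorph1 ratr_int.
Qed.

Lemma weight_decomposition r a : weight Y w r a ->
  exists n (c : 'I_n -> C) (s : 'I_n -> seq ('I_3 * 'I_3 * nat)),
    a = \sum_(i < n | word_wt (s i) == r) c i *: word (s i).
Proof.
move=> wa; have /asboolP[n [c [v [vw aE]]]] := neg_span HJ a.
have [s sE] := choice vw; exists n, c, s.
rewrite {1}aE (@eigen_component _ _ (nprod Y w 1) n
  (fun i => ratr (word_wt (s i))) (fun i => c i *: v i) (ratr r)).
- apply: eq_big => [i|i _]; last by rewrite sE.
  by rewrite (inj_eq (fmorph_inj _)).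
- move=> i /=; rewrite nprodZr sE (word_weight_shifted (s i)).
  by rewrite !scalerA mulrC.
- by rewrite -aE.
Qed.

(** Words are homogeneous, so the even words of any expansion of an odd vector add up to 0. *)
Lemma parity_decomposition a : vpar Y true a ->
  exists n (c : 'I_n -> C) (s : 'I_n -> seq ('I_3 * 'I_3 * nat)),
    a = \sum_(i < n | word_par (s i)) c i *: word (s i).
Proof.
move=> pa; have /asboolP[n [c [v [vw aE]]]] := neg_span HJ a.
have [s sE] := choice vw; exists n, c, s.
move: aE; rewrite (bigID (fun i => word_par (s i))) /=.
set u := \sum_(_ | word_par _) _; set e := \sum_(_ | _) _ => aE.
have pu : vpar Y true u.
  apply: vpar_sumr => i si; rewrite sE; apply: vparZ.
  by rewrite -si; exact: (word_homogeneous HJ).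
have pe : vpar Y false e.
  apply: vpar_sumr => i /negPf si; rewrite sE; apply: vparZ.
  by rewrite -si; exact: (word_homogeneous HJ).
have e0 : e = 0.
  apply: (vpar_direct pe); have -> : e = a - u by rewrite aE addrC addrK.
  by apply: vparD => //; exact: vparN.
by rewrite aE e0 addr0; apply: eq_bigr => i _; rewrite sE.
Qed.

Lemma neutral_par s : neutral s -> word_par s = false.
Proof.
elim: s => [//|[[i j] k] s IH] /= /andP[/eqP -> /IH ->].
by rewrite addbb.
Qed.

Lemma neutral_charge s : neutral s -> word_charge s = 0.
Proof.
elim: s => [//|[[i j] k] s IH] /= /andP[/eqP -> /IH ->].
by rewrite /charge subrr.
Qed.

Lemma neutral_wt_int s : neutral s -> word_wt s \is a Num.int.
Proof.
by move=> /neutral_charge s0; rewrite /word_wt s0 mulr0 subr0; exact: intr_int.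
Qed.

End ShiftedWeights.

(** * psi vanishes on C_2 *)

Section C2.
Variables (R : realType) (V : lmodType R[i]).
Local Notation C := R[i].
Variables (kappa : C) (kappaE : kappa = - (1 / 2)).
Variables (Y : vertexSuperalgebra V) (J : sl21 R -> V).
Hypothesis HJ : affine_currents kappa Y J.
Variable xi : rat.
Hypothesis simpleY : vsimple Y.
Local Notation "a *_[ n ] b" := (nprod Y a n b)
  (at level 39, n at level 99, left associativity, format "a  *_[ n ]  b").
Local Notation vac := (vac Y).
Local Notation w := (shifted kappa Y J xi).
Local Notation word := (word Y J 0 vac).
Local Notation letter := (letter R).
Local Notation C2 := (C2gen Y w).
Local Notation ncrit := (ncrit kappaE).
Let vac_neq0 : vac <> 0 := simpleY.1.

Section Psi.
Variables (B : comAlgType C) (x1 x2 : B).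
Hypothesis x1_sqr : x1 * x1 = 2%:R *: (x1 * x2).
Hypothesis x2_sqr : x2 * x2 = 2%:R *: (x1 * x2).
Local Notation psi := (psi HJ x1 x2).

Let psi_sum0 n (P : pred 'I_n) (c : 'I_n -> C) s :
  (forall i, P i -> ~~ neutral (s i)) -> psi (\sum_(i | P i) c i *: word (s i)) = 0.
Proof.
move=> h; elim/big_rec: _ => [|i v /h si IH]; first exact: (psi0 kappaE).
by rewrite (psi_linear kappaE) // IH (psi_not_neutral kappaE) // scaler0 addr0.
Qed.

Lemma psi_nonint r a : weight Y w r a -> r \isn't a Num.int -> psi a = 0.
Proof.
move=> /(weight_decomposition HJ ncrit)[n [c [s ->]]] nr; apply: psi_sum0 => i /eqP si.
by apply: contra nr => /neutral_wt_int; rewrite -si.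
Qed.

Lemma psi_odd a : vpar Y true a -> psi a = 0.
Proof.
move=> /(parity_decomposition HJ)[n [c [s ->]]]; apply: psi_sum0 => i si.
by apply/negP => /neutral_par; rewrite si.
Qed.

Lemma psi_C2 v : v \in lspan C2 -> psi v = 0.
Proof.
apply: (lspan_sub (P := fun v => psi v = 0)).
  split=> [|c u u' hu hu']; first exact: (psi0 kappaE).
  by rewrite (psi_linear kappaE) // hu hu' scaler0 addr0.
move=> _ [r a b _ _|r a b nr wa].
  exact: (psi_deriv_mul kappaE).
by rewrite (psi_mul kappaE) // (psi_nonint wa nr) mul0r.
Qed.

End Psi.

End C2.

Lemma small_notin_int (q : rat) : 0 < q -> q < 1 -> q \isn't a Num.int.
Proof.
move=> q0 q1; apply/negP => /intrP[z qz]; move: q0 q1.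
by rewrite qz ltr0z ltrz1; case: z {qz} => [[|z]|z].
Qed.

(** * Four vectors span A_2 *)

Section UpperBound.
Variables (R : realType) (V : lmodType R[i]).
Local Notation C := R[i].
Variables (kappa : C) (kappaE : kappa = - (1 / 2)).
Variables (Y : vertexSuperalgebra V) (J : sl21 R -> V).
Hypothesis HJ : affine_currents kappa Y J.
Variable xi : rat.
Hypothesis xi_gt0 : 0 < xi.
Hypothesis xi_lt1 : xi < 1.
Hypothesis simpleY : vsimple Y.
Local Notation "a *_[ n ] b" := (nprod Y a n b)
  (at level 39, n at level 99, left associativity, format "a  *_[ n ]  b").
Local Notation vac := (vac Y).
Local Notation w := (shifted kappa Y J xi).
Local Notation word := (word Y J 0 vac).
Local Notation letter := (letter R).
Local Notation quad := (quad Y J).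
Local Notation C2 := (C2gen Y w).
Local Notation ncrit := (ncrit kappaE).
Local Notation h1 := (h1 R).
Local Notation h2 := (h2 R).

Lemma weight_vac : weight Y w 0 vac.
Proof. by rewrite /weight nprod_vac0 raddf0 scale0r. Qed.

Lemma weight_derivative r a : weight Y w r a -> weight Y w (r + 1) (a *_[-2] vac).
Proof.
move=> wa; have := weight_nprod HJ ncrit (-2) wa weight_vac.
by rewrite addr0 rmorphN /= (_ : r - (- 2 + 1) = r + 1) //; ring.
Qed.

(** [C2gen] provides only mode -2. A deeper mode of [a] is a shallower one of its derivative, whose
    weight is larger by 1 and so still integral. *)
Lemma C2_int r a b (k : nat) : r \is a Num.int -> weight Y w r a ->
  a *_[- k.+2%:Z] b \in lspan C2.
Proof.
elim: k => [|k IH] in r a * => ri wa; first by apply: lspan_gen; exact: C2Int ri wa.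
rewrite nprod_lower rpredZ //; apply: (IH (r + 1)); last exact: weight_derivative.
by rewrite rpredD // rpred1.
Qed.

Lemma C2_nonint r a b (k : nat) : r \isn't a Num.int -> weight Y w r a ->
  a *_[- k.+1%:Z] b \in lspan C2.
Proof.
elim: k => [|k IH] in r a * => ri wa; first by apply: lspan_gen; exact: C2NonInt ri wa.
rewrite nprod_lower rpredZ //; apply: (IH (r + 1)); last exact: weight_derivative.
by apply: contra ri => r1; rewrite -[r](addrK 1) rpredB // rpred1.
Qed.

Lemma letter_weight i j : weight Y w (1 - xi / 2 * (charge i j)%:~R) (J (letter i j)).
Proof.
have := word_weight_shifted HJ ncrit xi [:: (i, j, 0%N)].
by rewrite /= nprod_vac /word_wt /= !addr0.
Qed.

(** Off the diagonal the charge is 1, -1, 2 or -2, so the weight differs from 1 by [xi / 2] or [xi],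
    both strictly between 0 and 1. *)
Lemma offdiag_nonint i j : i != j -> 1 - xi / 2 * (charge i j)%:~R \isn't a Num.int.
Proof.
move=> ij.
have xi2 : 0 < xi / 2 by rewrite divr_gt0.
have xi2' : xi / 2 < 1 by rewrite ltr_pdivrMr // mul1r (lt_trans xi_lt1).
have int1 (q : rat) : 0 < q -> q < 1 -> (1 - q \isn't a Num.int) /\ (1 + q \isn't a Num.int).
  move=> q0 q1; have qn := small_notin_int q0 q1.
  split; apply: contra qn => h.
    by rewrite -[q](subKr 1) rpredB // rpred1.
  by rewrite -[q](addKr 1) rpredD // rpredN rpred1.
have [n1 p1] := int1 _ xi2 xi2'; have [n2 p2] := int1 _ xi_gt0 xi_lt1.
have e2 : xi / 2 * 2 = xi by rewrite divfK.
elim/ord3_ind: i ij; elim/ord3_ind: j => //= _; rewrite /charge /hdiag /=.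
- by rewrite -[(1 - -1)%:~R]/(2 : rat) e2.
- by rewrite -[(1 - 0)%:~R]/(1 : rat) mulr1.
- by rewrite -[(-1 - 1)%:~R]/(- 2 : rat) mulrN opprK e2.
- by rewrite -[(-1 - 0)%:~R]/(- 1 : rat) mulrN mulr1 opprK.
- by rewrite -[(0 - 1)%:~R]/(- 1 : rat) mulrN mulr1 opprK.
- by rewrite -[(0 - -1)%:~R]/(1 : rat) mulr1.
Qed.

Local Ltac letter_eq := apply: entries_eq;
  rewrite /entries /= /str !mxE !big_ord_recl !big_ord0 !mxE /ipar /eq_op /=;
  do ![congr (_, _)]; ring.

Lemma letter_h1 : letter ord0 ord0 = h1. Proof. letter_eq. Qed.
Lemma letter_h2 : letter (lift ord0 ord0) (lift ord0 ord0) = -1 *: h2.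
Proof. letter_eq. Qed.
Lemma letter_0 : letter (lift ord0 (lift ord0 ord0)) (lift ord0 (lift ord0 ord0)) = 0 *: h2.
Proof. letter_eq. Qed.
Lemma letter_e12 : letter ord0 (lift ord0 ord0) = e12 R. Proof. letter_eq. Qed.
Lemma letter_e1 : letter ord0 (lift ord0 (lift ord0 ord0)) = e1 R. Proof. letter_eq. Qed.
Lemma letter_e2 : letter (lift ord0 (lift ord0 ord0)) (lift ord0 ord0) = e2 R.
Proof. letter_eq. Qed.

Lemma weight_h1 : weight Y w 1 (J h1).
Proof. by rewrite -letter_h1 -[1](subr0) -[0](mulr0 (xi / 2)); exact: letter_weight. Qed.

Lemma weight_h2 : weight Y w 1 (J h2).
Proof.
have := letter_weight (lift ord0 ord0) (lift ord0 ord0).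
rewrite letter_h2 (JZ HJ) /charge subrr mulr0 subr0 /weight nprodZr scalerA mulrC -scalerA.
by apply: scalerI; rewrite oppr_eq0 oner_eq0.
Qed.

Lemma bracket_h12 : bracket h1 h2 = 0.
Proof.
apply: entries_eq; rewrite entries0 entries_bracket entries_h1 entries_h2 /=.
by do ![congr (_, _)]; ring.
Qed.

Variables (Q : lmodType C) (pi : {linear V -> Q}).
Hypothesis pi_C2 : forall v, v \in lspan C2 -> pi v = 0.
Hypothesis pi_ker : forall v, pi v = 0 -> v \in lspan C2.

(** Makes multiplication by [h_1] and [h_2] well defined modulo C_2. Commuting [h(-1)] past [a_n]
    produces modes [n - 1 - i] of [h_i a], whose weight [r - i] is integral exactly when [r] is;
    these modes are deep enough to lie in C_2. *)
Lemma C2_stable h v : sl21_par false h -> weight Y w 1 (J h) ->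
  v \in lspan C2 -> J h *_[-1] v \in lspan C2.
Proof.
move=> ph wh; apply: (lspan_sub (preimage_subspace _ _ _ _)) => u hu.
have key r a b n : weight Y w r a ->
    (forall i : nat, (J h *_[i] a) *_[-1 + n - i%:Z] b \in lspan C2) ->
    a *_[n] (J h *_[-1] b) \in lspan C2 -> J h *_[-1] (a *_[n] b) \in lspan C2.
  move=> wa hi hab; have [M hM] := nprod_trunc_nat Y (J h) a 0.
  have := nprod_commutator_even b n (m := -1) (M := M) (b := a) (cur_par HJ ph).
  move=> /(_ _)/wrap[i /hM|]; first by rewrite add0r => ->; rewrite scaler0.
  move/eqP; rewrite subr_eq => /eqP ->; apply: rpredD => //.
  by apply: rpred_sum => i _; rewrite rpredZ.
have wi r a (i : nat) : weight Y w r a -> weight Y w (r - i%:R) (J h *_[i] a).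
  move=> wa; have := weight_nprod HJ ncrit i wh wa.
  by rewrite (_ : 1 + r - (i%:~R + 1) = r - i%:R) //; ring.
have int_sub r (i : nat) : (r - i%:R \is a Num.int) = (r \is a Num.int).
  apply/idP/idP => h'; last by rewrite rpredB // rpred_nat.
  by rewrite -[r](subrK i%:R) rpredD // rpred_nat.
case: hu => [r a b ri wa|r a b nr wa].
  apply: (key r) => //; last by apply: lspan_gen; exact: C2Int ri wa.
  move=> i; rewrite (_ : -1 - 2 - i%:Z = - i.+1.+2%:Z).
    by apply: (@C2_int (r - i%:R)); [rewrite int_sub | exact: wi].
  by rewrite -[i.+3]addn3 PoszD; ring.
apply: (key r) => //; last by apply: lspan_gen; exact: C2NonInt nr wa.
move=> i; rewrite (_ : -1 - 1 - i%:Z = - i.+2%:Z).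
  by apply: (@C2_nonint (r - i%:R)); [rewrite int_sub | exact: wi].
by rewrite -[i.+2]addn2 PoszD; ring.
Qed.

Lemma pi_congr h u v : sl21_par false h -> weight Y w 1 (J h) ->
  pi u = pi v -> pi (J h *_[-1] u) = pi (J h *_[-1] v).
Proof.
move=> ph wh uv; apply/eqP; rewrite -subr_eq0 -linearB -nprodBr; apply/eqP/pi_C2.
by apply: C2_stable => //; apply: pi_ker; rewrite linearB uv subrr.
Qed.

Lemma pi_offdiag i j b (k : nat) : i != j -> pi (J (letter i j) *_[- k.+1%:Z] b) = 0.
Proof.
by move=> ij; apply: pi_C2; exact: (C2_nonint _ _ (offdiag_nonint ij) (letter_weight i j)).
Qed.

Lemma pi_quad_offdiag i j b : i != j -> pi (quad (letter i j) b) = 0.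
Proof. exact: (@pi_offdiag i j _ 0). Qed.

Let piD u v : pi (u + v) = pi u + pi v. Proof. exact: linearD. Qed.
Let piZ c v : pi (c *: v) = c *: pi v. Proof. exact: linearZ_LR. Qed.
Let pi0 : pi 0 = 0. Proof. exact: linear0. Qed.

Let double (x y : Q) : (-2 : C) *: x + (4 : C) *: y = 0 -> x = 2%:R *: y.
Proof.
have n2 : (-2 : C) != 0 by rewrite oppr_eq0 pnatr_eq0.
move/eqP; rewrite addr_eq0 => /eqP h; apply: (scalerI n2).
by rewrite h scalerA -scaleNr; congr (_ *: _); ring.
Qed.

Lemma pi_h11 : pi (quad h1 h1) = 2%:R *: pi (quad h1 h2).
Proof.
have := null_vector HJ ncrit simpleY (null1_homogeneous R) (par_h1 R).
rewrite kappaE => /(_ (@null1_mode1 R) (@null1_mode2 R)) /(congr1 pi).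
(* Every product of root vectors in the list has an off-diagonal first factor, so modulo C_2 only
   [-2 h_1 h_1 + 4 h_1 h_2] remains. *)
rewrite /null1 /qsum -letter_e12 -letter_e1 -letter_e2 pi0 !piD !piZ.
rewrite !pi_quad_offdiag // (pi_C2 (C2_int _ 0 (rpred1 _) weight_h1)).
by rewrite !scaler0 pi0 !addr0; exact: double.
Qed.

Lemma pi_h22 : pi (quad h2 h2) = 2%:R *: pi (quad h1 h2).
Proof.
have := null_vector HJ ncrit simpleY (null2_homogeneous R) (par_h2 R).
rewrite kappaE => /(_ (@null2_mode1 R) (@null2_mode2 R)) /(congr1 pi).
rewrite /null2 /qsum -letter_e12 -letter_e1 -letter_e2 pi0 !piD !piZ.
rewrite !pi_quad_offdiag // (pi_C2 (C2_int _ 0 (rpred1 _) weight_h2)).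
by rewrite !scaler0 pi0 !addr0 addrC; exact: double.
Qed.

Lemma h1_h2_commute v : J h1 *_[-1] (J h2 *_[-1] v) = J h2 *_[-1] (J h1 *_[-1] v).
Proof.
rewrite (current_commutator HJ _ _ _ (par_h1 R) (par_h2 R)) bracket_h12 (J0 HJ).
by rewrite nprod0l expr0 scale1r scale0r !addr0.
Qed.

Lemma quad_h21 : quad h2 h1 = quad h1 h2.
Proof.
by rewrite /quad -{1}[J h1](nprod_vac Y) -h1_h2_commute nprod_vac.
Qed.

Local Notation pi_h1 := (pi_congr (par_h1 R) weight_h1).
Local Notation pi_h2 := (pi_congr (par_h2 R) weight_h2).

Lemma pi_h1_top : pi (J h1 *_[-1] quad h1 h2) = 2%:R *: pi (J h2 *_[-1] quad h1 h2).
Proof.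
rewrite -{1}quad_h21 {1}/quad h1_h2_commute -/(quad h1 h1).
by rewrite -piZ -nprodZr; apply: pi_h2; rewrite pi_h11 piZ.
Qed.

Lemma pi_h2_top : pi (J h2 *_[-1] quad h1 h2) = 2%:R *: pi (J h1 *_[-1] quad h1 h2).
Proof.
rewrite {1}/quad -h1_h2_commute -/(quad h2 h2).
by rewrite -piZ -nprodZr; apply: pi_h1; rewrite pi_h22 piZ.
Qed.

(** The argument of [x1_x12], carried out with modes: at this stage [pi] is only a linear map, and
    no product on the quotient is available. *)
Lemma pi_top0 : pi (J h1 *_[-1] quad h1 h2) = 0 /\ pi (J h2 *_[-1] quad h1 h2) = 0.
Proof.
have e := pi_h1_top; rewrite pi_h2_top scalerA in e.
have n3 : (3 : C) != 0 by rewrite pnatr_eq0.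
have x0 : pi (J h1 *_[-1] quad h1 h2) = 0.
  apply: (scalerI n3); rewrite scaler0; apply: (addIr (pi (J h1 *_[-1] quad h1 h2))).
  rewrite add0r {3}e -{2}[pi _]scale1r -scalerDl; congr (_ *: _); ring.
by split=> //; rewrite pi_h2_top x0 scaler0.
Qed.

(** By induction on words: an off-diagonal first letter or a mode below -1 leads into C_2, and the
    relations found above close the span under [h_1(-1)] and [h_2(-1)]. *)
Lemma pi_span v : exists c0 c1 c2 c3 : C,
  pi v = c0 *: pi vac + c1 *: pi (J h1) + c2 *: pi (J h2) + c3 *: pi (quad h1 h2).
Proof.
pose P v := exists c0 c1 c2 c3 : C,
  pi v = c0 *: pi vac + c1 *: pi (J h1) + c2 *: pi (J h2) + c3 *: pi (quad h1 h2).
have P0 u : pi u = 0 -> P u.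
  by rewrite /P => ->; exists 0, 0, 0, 0; rewrite !scale0r !addr0.
have Plin c u u' : P u -> P u' -> P (c *: u + u').
  move=> [a0 [a1 [a2 [a3 eu]]]] [b0 [b1 [b2 [b3 eu']]]].
  exists (c * a0 + b0), (c * a1 + b1), (c * a2 + b2), (c * a3 + b3).
  rewrite piD piZ eu eu' !scalerDr !scalerA !scalerDl.
  rewrite addrACA; congr (_ + _); rewrite addrACA; congr (_ + _).
  by rewrite addrACA.
have [X0 Z0] := pi_top0.
have P1 u : P u -> P (J h1 *_[-1] u).
  move=> [a0 [a1 [a2 [a3 eu]]]].
  have e : pi u = pi (a0 *: vac + a1 *: J h1 + a2 *: J h2 + a3 *: quad h1 h2).
    by rewrite eu !piD !piZ.
  rewrite /P (pi_h1 e).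
  exists 0, a0, 0, (a1 * 2%:R + a2).
  rewrite !nprodDr !nprodZr nprod_vac !piD !piZ X0 -/(quad h1 h1) -/(quad h1 h2) pi_h11.
  by rewrite scaler0 !scale0r add0r !addr0 scalerA [(_ + a2) *: _]scalerDl addrA.
have P2 u : P u -> P (J h2 *_[-1] u).
  move=> [a0 [a1 [a2 [a3 eu]]]].
  have e : pi u = pi (a0 *: vac + a1 *: J h1 + a2 *: J h2 + a3 *: quad h1 h2).
    by rewrite eu !piD !piZ.
  rewrite /P (pi_h2 e).
  exists 0, 0, a0, (a1 + a2 * 2%:R).
  rewrite !nprodDr !nprodZr nprod_vac !piD !piZ Z0 -/(quad h2 h1) -/(quad h2 h2) pi_h22 quad_h21.
  by rewrite scaler0 !scale0r !add0r !addr0 scalerA [(a1 + _) *: _]scalerDl addrA.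
apply: (words_ind HJ (P := P)); first by split=> //; apply: P0.
elim=> [|[[i j] k] s IH] /=.
  by exists 1, 0, 0, 0; rewrite !scale0r !addr0 scale1r.
rewrite sub0r; have [<-|ij] := eqVneq i j; last by apply: P0; exact: pi_offdiag.
case: k => [|k]; last first.
  apply/P0/pi_C2; apply: C2_int; last exact: letter_weight.
  by rewrite /charge subrr mulr0 subr0 rpred1.
have PZ c u : P u -> P (c *: u)
  by move=> Pu; rewrite -[_ *: u]addr0; apply: Plin => //; exact: P0.
elim/ord3_ind: i.
- by rewrite letter_h1; exact: P1.
- by rewrite letter_h2 (JZ HJ) nprodZl; apply: PZ; exact: P2.
- by rewrite letter_0 (JZ HJ) nprodZl; apply: PZ; exact: P2.
Qed.

End UpperBound.

Section LinearQuotientTheory.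
Variables (K : fieldType) (V : lmodType K) (S : V -> Prop).

Lemma lproj_eq0 v : lproj S v = 0 <-> v \in lspan S.
Proof.
rewrite -(linear0 (lproj S)) -[v in v \in _]subr0 -lproj_eq.
by split=> [->|/eqP].
Qed.

Lemma lquot_lift (W : lmodType K) (g : {linear V -> W}) :
  (forall v, v \in lspan S -> g v = 0) ->
  exists f : {linear lquot S -> W}, forall v, f (lproj S v) = g v.
Proof.
move=> g0; pose f (x : lquot S) : W := g (generic_quotient.repr x).
have fE v : f (lproj S v) = g v.
  apply/eqP; rewrite /f -subr_eq0 -linearB; apply/eqP/g0.
  by rewrite -lproj_eq lproj_repr.
have flin : linear f.
  move=> c x y; have [u <-] := lproj_surj x; have [v <-] := lproj_surj y.
  by rewrite -linearP !fE linearP.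
pose F : {linear lquot S -> W} := HB.pack f (GRing.isLinear.Build _ _ _ _ f flin).
by exists F.
Qed.

End LinearQuotientTheory.

(** * The isomorphism *)

Section Assembly.
Variables (R : realType) (V : lmodType R[i]).
Local Notation C := R[i].
Variables (kappa : C) (kappaE : kappa = - (1 / 2)).
Variables (Y : vertexSuperalgebra V) (J : sl21 R -> V).
Hypothesis HJ : affine_currents kappa Y J.
Variable xi : rat.
Hypothesis xi_gt0 : 0 < xi.
Hypothesis xi_lt1 : xi < 1.
Hypothesis simpleY : vsimple Y.
Local Notation w := (shifted kappa Y J xi).
Variables (B : comAlgType C) (x1 x2 : B).
Hypothesis x1_sqr : x1 * x1 = 2%:R *: (x1 * x2).
Hypothesis x2_sqr : x2 * x2 = 2%:R *: (x1 * x2).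
Hypothesis B_span : forall y, exists c0 c1 c2 c3, y = lin4 x1 x2 c0 c1 c2 c3.
Hypothesis B_free : forall c0 c1 c2 c3, lin4 x1 x2 c0 c1 c2 c3 = 0 ->
  [/\ c0 = 0, c1 = 0, c2 = 0 & c3 = 0].

Local Notation pi := (A2proj Y w).
Local Notation psi := (psi HJ x1 x2).

Let pi_ker v : pi v = 0 <-> v \in lspan (C2gen Y w).
Proof. exact: lproj_eq0. Qed.

Let pi_span' v := pi_span kappaE HJ xi_gt0 xi_lt1 simpleY
  (fun v => (pi_ker v).2) (fun v => (pi_ker v).1) v.

Lemma A2proj_surj (x : A2 Y w) : exists v, pi v = x.
Proof. exact: lproj_surj. Qed.

Lemma A2_cofinite : C2_cofinite Y w.
Proof.
pose b (i : 'I_4) := nth 0 [:: pi (vac Y); pi (J (h1 R)); pi (J (h2 R));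
  pi (quad Y J (h1 R) (h2 R))] i.
exists 4%N, b => x; have [v <-] := A2proj_surj x.
have [c0 [c1 [c2 [c3 ->]]]] := pi_span' v.
exists (fun i => nth 0 [:: c0; c1; c2; c3] i).
by rewrite !big_ord_recl big_ord0 /b /= addr0 !addrA.
Qed.

Let vac_neq0 : vac Y <> 0 := simpleY.1.

Lemma psi_h1 : psi (J (h1 R)) = x1.
Proof.
rewrite (psi_J kappaE HJ vac_neq0) !pick9E entries_h1 /=.
by rewrite /lin4 oppr0 !scale0r scale1r add0r !addr0.
Qed.

Lemma psi_h2 : psi (J (h2 R)) = x2.
Proof.
rewrite (psi_J kappaE HJ vac_neq0) !pick9E entries_h2 /=.
by rewrite /lin4 opprK !scale0r scale1r !add0r addr0.
Qed.

Lemma psi_h12 : psi (quad Y J (h1 R) (h2 R)) = x1 * x2.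
Proof.
rewrite (psi_quad kappaE HJ vac_neq0) /top_form !pick9E entries_h1 entries_h2 /=.
rewrite (_ : _ - _ = 1); last by ring.
by rewrite /lin4 !scale0r scale1r !add0r.
Qed.

Lemma psi_lin4 c0 c1 c2 c3 :
  psi (c0 *: vac Y + c1 *: J (h1 R) + c2 *: J (h2 R) + c3 *: quad Y J (h1 R) (h2 R)) =
  lin4 x1 x2 c0 c1 c2 c3.
Proof.
rewrite !(psiD kappaE HJ vac_neq0) !(psiZ kappaE HJ vac_neq0).
by rewrite psi_h1 psi_h2 psi_h12 (psi_vac kappaE HJ vac_neq0).
Qed.

(** psi descends to [f] since it kills C_2. The four vectors that span A_2 are sent to
    [1, x1, x2, x1 x2]: their independence makes [f] injective, and their spanning makes it
    surjective. *)
Lemma A2_iso : A2_isomorphic Y w B.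
Proof.
pose Psi : {linear V -> B} := HB.pack psi
  (GRing.isLinear.Build _ _ _ _ psi (psi_linear kappaE HJ vac_neq0 x1 x2)).
have Psi0 v : v \in lspan (C2gen Y w) -> Psi v = 0.
  exact: (psi_C2 kappaE HJ simpleY x1_sqr x2_sqr).
have [f fE] := lquot_lift Psi0.
have fpi v : f (pi v) = psi v by exact: fE.
have pi_lin4 c0 c1 c2 c3 :
    c0 *: pi (vac Y) + c1 *: pi (J (h1 R)) + c2 *: pi (J (h2 R))
      + c3 *: pi (quad Y J (h1 R) (h2 R)) =
    pi (c0 *: vac Y + c1 *: J (h1 R) + c2 *: J (h2 R) + c3 *: quad Y J (h1 R) (h2 R)).
  have piD u v : pi (u + v) = pi u + pi v by exact: linearD.
  have piZ c v : pi (c *: v) = c *: pi v by exact: linearZ_LR.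
  by rewrite !piD !piZ.
have fP c u v : f (c *: u + v) = c *: f u + f v by exact: linearP.
have f_inj : injective f.
  move=> x y exy; apply/eqP; rewrite -subr_eq0; apply/eqP.
  have : f (x - y) = 0 by rewrite linearB exy subrr.
  have [v <-] := A2proj_surj (x - y); have [c0 [c1 [c2 [c3 ev]]]] := pi_span' v.
  rewrite ev pi_lin4 fpi psi_lin4 => /B_free[-> -> -> ->].
  by rewrite !scale0r !addr0 linear0.
have f_surj y : exists x, f x = y.
  have [c0 [c1 [c2 [c3 ->]]]] := B_span y.
  by eexists; rewrite -psi_lin4 -fpi.
have [g gK] := choice f_surj.
have fK : cancel f g by move=> x; apply: f_inj; rewrite gK.
(* The product is pulled back along [f], so bilinearity is automatic; its prescribed values are then
   checked after applying [f], where nonintegral weights give 0 by [psi_nonint]. *)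
exists (fun x y => g (f x * f y)); split; first split.
- by move=> c x y z; apply: f_inj; rewrite gK !fP !gK mulrDl -scalerAl.
- by move=> c x y z; apply: f_inj; rewrite gK !fP !gK mulrDr -scalerAr.
- move=> r s a b wa wb; apply: f_inj; rewrite gK !fpi.
  have [ri|nr] := boolP (r \is a Num.int); last first.
    by rewrite (psi_nonint kappaE HJ simpleY _ _ wa nr) mul0r linear0.
  have [si|ns] := boolP (s \is a Num.int); last first.
    by rewrite (psi_nonint kappaE HJ simpleY _ _ wb ns) mulr0 linear0.
  by rewrite /= fpi (psi_mul kappaE HJ vac_neq0 x1_sqr x2_sqr).
- exists f; split.
  + by exists g.
  + by rewrite /A2one fpi (psi_vac kappaE HJ vac_neq0).
  + by move=> x y; rewrite gK.
  + move=> _ [v pv ->]; rewrite fpi.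
    exact: (psi_odd kappaE HJ simpleY).
Qed.

End Assembly.

(** * The image of the shifted conformal vector in the quotient *)

Section QuotientConformalVector.
Variables (R : realType) (kappa : R[i]).
Local Notation V := (affV kappa).
Variables (Y : vertexSuperalgebra V) (L : lmodType R[i]).
Variables (YL : vertexSuperalgebra L) (p : {linear V -> L}).
Hypothesis Yaff : affine_structure Y.
Hypothesis pquot : simple_quotient Y YL p.

Lemma quot_sugawara : p (sugawara kappa) = sug kappa YL (quot_cur p).
Proof.
have pD u v : p (u + v) = p u + p v by exact: linearD.
have pB u v : p (u - v) = p u - p v by exact: linearB.
have pZ c v : p (c *: v) = c *: p v by exact: linearZ_LR.
have pP a b : p (cur a (-1) (cur b (-1) (affvac kappa))) = quad YL (quot_cur p) a b.
  by rewrite -(quot_nprod Yaff pquot).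
have casimirE (Q := quad YL (quot_cur p)) : qsum YL (quot_cur p) (casimir R) =
    Q (h1 R) (h2 R) + Q (h2 R) (h1 R) + Q (e12 R) (f12 R) + Q (f12 R) (e12 R)
    - Q (e1 R) (f1 R) + Q (f1 R) (e1 R) - Q (e2 R) (f2 R) + Q (f2 R) (e2 R).
  rewrite /casimir; cbn [qsum]; rewrite -/Q.
  move: (Q (h1 R) (h2 R)) (Q (h2 R) (h1 R)) (Q (e12 R) (f12 R)) (Q (f12 R) (e12 R)).
  move: (Q (e1 R) (f1 R)) (Q (f1 R) (e1 R)) (Q (e2 R) (f2 R)) (Q (f2 R) (e2 R)) => *.
  by rewrite !scale1r !scaleN1r addr0 !addrA.
apply: etrans (pZ _ _) _; congr (_ *: _); apply: etrans _ (esym casimirE).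
apply: etrans (pD _ _) _; congr (_ + _); last exact: pP.
apply: etrans (pB _ _) _; congr (_ - _); last exact: pP.
apply: etrans (pD _ _) _; congr (_ + _); last exact: pP.
apply: etrans (pB _ _) _; congr (_ - _); last exact: pP.
do 3 (apply: etrans (pD _ _) _; congr (_ + _); last exact: pP).
exact: pP.
Qed.

Lemma quot_omega xi : p (omega Y xi) = shifted kappa YL (quot_cur p) xi.
Proof.
have pD u v : p (u + v) = p u + p v by exact: linearD.
have pZ c v : p (c *: v) = c *: p v by exact: linearZ_LR.
apply: etrans (pD _ _) _; congr (_ + _); first exact: quot_sugawara.
apply: etrans (pZ _ _) _; congr (_ *: _).
by case: pquot => -[_ _ ->] _ _; rewrite quot_sugawara.
Qed.

End QuotientConformalVector.

Theorem theorem4p4 (R : realType) (xi : rat) (xi_gt0 : 0 < xi) (xi_lt1 : xi < 1)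
  (Y : vertexSuperalgebra (affV (- (1 / 2) : R[i])))
  (Yaff : affine_structure Y)
  (L : lmodType R[i]) (YL : vertexSuperalgebra L)
  (p : {linear affV (- (1 / 2) : R[i]) -> L})
  (Lsimple : simple_quotient Y YL p) :
  A2_isomorphic YL (p (omega Y xi)) (qalg R)
  /\ C2_cofinite YL (p (omega Y xi)).
Proof.
have HJ := quot_currents Yaff Lsimple.
have simpleL : vsimple YL by case: Lsimple.
rewrite (quot_omega Yaff Lsimple xi); split.
  exact: (A2_iso erefl HJ xi_gt0 xi_lt1 simpleL (@qalg_x1_sqr R) (@qalg_x2_sqr R)
    (@qlin_span R) (@qlin_inj R)).
exact: (A2_cofinite erefl HJ xi_gt0 xi_lt1 simpleL).
Qed.
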